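(* Let $\mathcal{B}=\{B_t\}_{t\ge0}$, $\mathcal{J}=\{J_t\}_{t\ge0}$, $\mathcal{E}$, $\mu_i,\sigma_i:\mathbb{R}_+\times\mathbb{R}\to\mathbb{R}$ ($i\in\mathcal{E}$), $x_0\in\mathbb{R}$, $h_i$ and $\mu_i^*$ be as in the context. Assume: (1) for every $i\in\mathcal{E}$: $\mu_i$ is continuous, linearly growing and locally Lipschitz continuous; $\sigma_i$ is in $\mathcal{C}^{1,1}$, linearly growing, locally Lipschitz continuous and Lipschitz continuous on its second entry; $\partial_1\sigma_i$ and $\partial_2\sigma_i$ are locally Lipschitz continuous; (2) there are constants $0<v<V<\infty$ and $K>0$ with $v<\sigma_i(t,x)<V$ and $|\partial_1\sigma_i(t,x)|/\sigma_i(t,x)^2\le K$ for all $i\in\mathcal{E}$, $t\ge0$, $x\in\mathbb{R}$; (3) for every $i\in\mathcal{E}$, $\mu_i^*$ is Lipschitz continuous on its second entry; (4) for every $T>0$, the number $N_T=\#\{s\in(0,T]:J_s\ne J_{s^-}\}$ of jumps of $\mathcal{J}$ on $(0,T]$ satisfies, for some $\gamma_0=\gamma_0(T)>0$, $\mathbb{P}(N_T>n)=o\left(e^{-n(\log n-\gamma_0)}\right)$ as $n\to\infty$. Let $\{\mathcal{F}^\lambda\}_{\lambda>0}$, $\mathcal{F}^\lambda=\{F^\lambda_t\}_{t\ge0}$, be a family of processes with continuous paths of finite variation on compact intervals, defined on the same probability space, that converges strongly to $\mathcal{B}$, i.e. $\lim_{\lambda\to\infty}\sup_{t\in[0,T]}|F^\lambda_t-B_t|=0$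 almost surely for every $T>0$. Suppose that for some $\delta:\mathbb{R}_+\to\mathbb{R}_+$ with $\lim_{\lambda\to\infty}\delta(\lambda)=0$, for all $q>0$ and $T>0$ there is a constant $\alpha=\alpha(q,T)>0$, dependent on $q$ and $T$ only, with $$\mathbb{P}\left(\sup_{t\in[0,T]}|F^\lambda_t-B_t|\ge\alpha\,\delta(\lambda)\right)=o(\lambda^{-q})\quad\text{as }\lambda\to\infty.$$ For $\lambda>0$ let $\mathcal{X}^\lambda=\{X^\lambda_t\}_{t\ge0}$ be the unique solution of $$\mathrm{d}X^\lambda_t=\left(\mu_{J_t}(t,X^\lambda_t)-\tfrac12\sigma_{J_t}(t,X^\lambda_t)\,\partial_2\sigma_{J_t}(t,X^\lambda_t)\right)\mathrm{d}t+\sigma_{J_t}(t,X^\lambda_t)\,\mathrm{d}F^\lambda_t,\qquad X^\lambda_0=x_0,$$ and let $\mathcal{X}=\{X_t\}_{t\ge0}$ be the unique continuous solution of the regime-switching SDE $$\mathrm{d}X_t=\mu_{J_t}(t,X_t)\,\mathrm{d}t+\sigma_{J_t}(t,X_t)\,\mathrm{d}B_t,\qquad X_0=x_0.$$ Then: (i) $\{\mathcal{X}^\lambda\}_{\lambda>0}$ converges strongly to $\mathcal{X}$, i.e. for every $T>0$, $\lim_{\lambda\to\infty}\sup_{t\in[0,T]}|X^\lambda_t-X_t|=0$ almost surely; (ii) for all $q,T>0$ there exists $\gamma=\gamma(q,T)>0$ such that for all $\varepsilon>0$, $$\mathbb{P}\left(\sup_{t\in[0,T]}|X^\lambda_t-X_t|\ge\gamma\,\delta(\lambda)\lambda^{\varepsilon}\right)=o(\lambda^{-q})\quad\text{as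 }\lambda\to\infty.$$
   Context: $\mathbb{R}_+=[0,\infty)$. $\mathcal{B}$ is a standard Brownian motion and $\mathcal{J}$ is a càdlàg jump process with finite state space $\mathcal{E}$, independent of $\mathcal{B}$, with finitely many jumps on compact intervals (not necessarily Markovian). The SDE driven by $\mathcal{B}$ is an Itô equation (with respect to the usual augmentation of the filtration generated by $\mathcal{B}$ and $\mathcal{J}$); the equation driven by $\mathcal{F}^\lambda$ is understood pathwise, with Lebesgue–Stieltjes integrals, and its solutions are continuous. $\partial_k$ is the partial derivative with respect to the $k$th entry. $\mathcal{C}^{1,1}$ is the class of continuous functions with continuous first partial derivatives in each of the two entries. A function $g:\mathbb{R}_+\times\mathbb{R}\to\mathbb{R}$ is: *linearly growing* if there is $E>0$ with $|g(t,x)|\le E(1+t+|x|)$ for all $t\ge0,x\in\mathbb{R}$; *locally Lipschitz continuous* if for each compact $\mathcal{K}\subset\mathbb{R}_+\times\mathbb{R}$ there is $M_{\mathcal{K}}>0$ with $|g(t_1,x_1)-g(t_2,x_2)|\le M_{\mathcal{K}}(|t_1-t_2|+|x_1-x_2|)$ for all $(t_1,x_1),(t_2,x_2)\in\mathcal{K}$; *Lipschitz continuous on its second entry* if there is $M>0$ with $|g(t,x_1)-g(t,x_2)|\le M|x_1-x_2|$ for all $t\ge0$, $x_1,x_2\in\mathbb{R}$. For $i\in\mathcal{E}$, $h_i(t,x):=\int_{x_0}^x\frac{1}{\sigma_i(t,y)}\,\mathrm{d}y$; for each fixed $t$, $h_i^{-1}(t,\cdot)$ is the inverse of the bijection $h_i(t,\cdot):\mathbb{R}\to\mathbb{R}$;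 and $$\mu_i^*(t,\ell):=(\partial_1h_i)\left(t,h_i^{-1}(t,\ell)\right)+\frac{\mu_i(t,h_i^{-1}(t,\ell))}{\sigma_i(t,h_i^{-1}(t,\ell))}-\frac12(\partial_2\sigma_i)\left(t,h_i^{-1}(t,\ell)\right).$$ *)

(* Defs.v *)
From HB Require Import structures.
From mathcomp Require Import all_boot all_order all_algebra.
From mathcomp Require Import all_classical all_reals all_analysis.

Set Implicit Arguments.
Unset Strict Implicit.
Unset Printing Implicit Defensive.

Import Order.TTheory GRing.Theory Num.Theory.
Import numFieldNormedType.Exports.

Local Open Scope classical_set_scope.
Local Open Scope ring_scope.

(* Time is the half-line R_+.  Functions of time and processes are typed on the
   whole of R, and only their values at nonnegative times are ever used. *)

Section coefficients.
Context {R : realType}.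
Implicit Types (g : R -> R -> R) (t x : R).

Definition half_plane : set (R * R) := [set p | 0 <= p.1].

Definition continuous_on_half_plane g : Prop :=
  {within half_plane, continuous (fun p => g p.1 p.2)}.

Definition linearly_growing g : Prop :=
  exists2 E : R, 0 < E &
    forall t x : R, 0 <= t -> `|g t x| <= E * (1 + t + `|x|).

Definition locally_lipschitz g : Prop :=
  forall K : set (R * R), compact K -> K `<=` half_plane ->
    exists2 M : R, 0 < M & forall p q : R * R, K p -> K q ->
      `|g p.1 p.2 - g q.1 q.2| <= M * (`|p.1 - q.1| + `|p.2 - q.2|).

Definition lipschitz_in_space g : Prop :=
  exists2 M : R, 0 < M & forall t x y : R, 0 <= t ->
    `|g t x - g t y| <= M * `|x - y|.

(* The time derivative is taken relative to R_+: it is the usual derivative for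
   t > 0, and the right derivative at t = 0. *)
Definition quotient_time g t x (s : R) : R := (g s x - g t x) / (s - t).

Definition time_nbhs t : set_system R := within [set s | 0 <= s] t^'.

Definition derivable_time g t x : Prop :=
  cvg (quotient_time g t x s @[s --> time_nbhs t]).

Definition partial1 g t x : R := lim (quotient_time g t x s @[s --> time_nbhs t]).

Definition partial2 g t x : R := derive1 (g t) x.

Definition C11 g : Prop :=
  [/\ continuous_on_half_plane g,
      forall t x : R, 0 <= t -> derivable_time g t x,
      forall t x : R, 0 <= t -> derivable (g t) x 1,
      continuous_on_half_plane (partial1 g) &
      continuous_on_half_plane (partial2 g)].

Definition oriented_integral (a b : R) (f : R -> R) : R :=
  if a <= b then \int[lebesgue_measure]_(y in `[a, b]) f y
  else - \int[lebesgue_measure]_(y in `[b, a]) f y.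

Definition lamperti (x0 : R) (sigma : R -> R -> R) t x : R :=
  oriented_integral x0 x (fun y => (sigma t y)^-1).

Definition lamperti_inv (x0 : R) (sigma : R -> R -> R) t : R -> R :=
  pinv setT (lamperti x0 sigma t).

Definition mu_star (x0 : R) (mu sigma : R -> R -> R) t (l : R) : R :=
  let y := lamperti_inv x0 sigma t l in
  partial1 (lamperti x0 sigma) t y + mu t y / sigma t y
  - 2^-1 * partial2 sigma t y.

End coefficients.

Section paths.
Context {R : realType}.
Implicit Types f g : R -> R.

Definition continuous_path f : Prop := {within `[0, +oo[, continuous f}.

(* Extended-real valued, so that it is +oo on unbounded differences. *)
Definition sup_dist (T : R) f g : \bar R :=
  ereal_sup [set `|f t - g t|%:E | t in `[0, T]].

Definition finite_variation f : Prop :=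
  forall T : R, 0 < T -> bounded_variation 0 T f.

(* v is the Lebesgue-Stieltjes integral of phi over ]0, t] against df, where f
   has finite variation on compact intervals: f is split into a difference of
   two nondecreasing right-continuous functions.  Any two splittings for which
   phi is integrable give the same v. *)
Definition is_LS_integral f (phi : R -> R) (t v : R) : Prop :=
  exists G H : cumulative R R,
    [/\ forall s : R, 0 <= s -> f s = G s - H s,
        (lebesgue_stieltjes_measure G).-integrable `]0, t] (EFin \o phi),
        (lebesgue_stieltjes_measure H).-integrable `]0, t] (EFin \o phi) &
        v = \int[lebesgue_stieltjes_measure G]_(s in `]0, t]) phi s
          - \int[lebesgue_stieltjes_measure H]_(s in `]0, t]) phi s].

(* x is a continuous solution of
   dx_t = b_{j_t}(t, x_t) dt + sigma_{j_t}(t, x_t) df_t, with x_0 = x0. *)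
Definition pathwise_solution (E : Type) (b sigma : E -> R -> R -> R)
    (x0 : R) (j : R -> E) (f x : R -> R) : Prop :=
  continuous_path x /\
  forall t : R, 0 <= t ->
    is_LS_integral f (fun s => sigma (j s) s (x s)) t
      (x t - x0 - \int[lebesgue_measure]_(s in `[0, t]) b (j s) s (x s)).

End paths.

Definition at_infinity {R : realType} : filter_on R :=
  FilterType (pinfty_nbhs R) _.

Section processes.
Context {R : realType} {d : measure_display} {Omega : measurableType d}.
Variable P : probability Omega R.
Implicit Types X B : R -> Omega -> R.

Definition continuous_process X : Prop :=
  (forall t : R, 0 <= t -> measurable_fun setT (X t)) /\
  (forall w, continuous_path (X ^~ w)).

Definition events_rv (Z : Omega -> R) : set (set Omega) :=
  [set A | exists2 U, measurable U & A = Z @^-1` U].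

Definition sigma_process (D : set R) X : set (set Omega) :=
  <<s [set A | exists2 t, D t & events_rv (X t) A] >>.

Definition events_state (E : finType) (D : set R) (J : R -> Omega -> E)
    : set (set Omega) :=
  [set A | exists2 t, D t & exists i, A = J t @^-1` [set i]].

Definition sigma_state (E : finType) (D : set R) (J : R -> Omega -> E)
    : set (set Omega) :=
  <<s events_state D J >>.

Definition independent_events (C D : set (set Omega)) : Prop :=
  forall U V, C U -> D V -> P (U `&` V) = (P U * P V)%E.

(* The second parameter of normal_prob is the standard deviation. *)
Definition brownian_motion B : Prop :=
  [/\ continuous_process B,
      {ae P, forall w, B 0 w = 0},
      forall s t : R, 0 <= s -> s < t ->
        independent_events (sigma_process `[0, s] B)
                           (events_rv (fun w => B t w - B s w)) &
      forall s t : R, 0 <= s -> s < t -> forall U : set R, measurable U ->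
        P [set w | U (B t w - B s w)] = normal_prob 0 (Num.sqrt (t - s)) U].

Section jump_process.
Context {E : finType}.
Implicit Type J : R -> Omega -> E.

Definition left_limit (j : R -> E) (s : R) (i : E) : Prop :=
  \forall r \near s^'-, j r = i.

Definition cadlag (j : R -> E) : Prop :=
  (forall t : R, 0 <= t -> \forall r \near t^'+, j r = j t) /\
  (forall t : R, 0 < t -> exists i, left_limit j t i).

Definition jump_times (j : R -> E) (T : R) : set R :=
  [set s | 0 < s <= T /\ exists2 i, left_limit j s i & j s != i].

Definition jump_process J : Prop :=
  [/\ forall (t : R) i, 0 <= t -> measurable (J t @^-1` [set i]),
      forall w, cadlag (J ^~ w) &
      forall w (T : R), 0 < T -> finite_set (jump_times (J ^~ w) T)].

Definition jump_count J (T : R) (w : Omega) : \bar R :=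
  counting (jump_times (J ^~ w) T).

(* Usual augmentation of the filtration generated by B and J: adjunction of the
   P-null events, then right-continuous regularization.  The null sets are those
   of the sigma-algebra of Omega, that is all of them if P is complete; in
   general the result is the trace on that sigma-algebra of the augmentation by
   all P-negligible sets. *)
Definition augmented_filtration B J (t : R) : set (set Omega) :=
  \bigcap_(s in [set s | t < s])
    <<s sigma_process `[0, s] B `|` sigma_state `[0, s] J
        `|` [set N | measurable N /\ P N = 0%E] >>.

End jump_process.

Section ito.
Variable filt : R -> set (set Omega).

Definition measurable_wrt (G : set (set Omega)) (Z : Omega -> R) : Prop :=
  events_rv Z `<=` G.

Definition adapted X : Prop :=
  forall t : R, 0 <= t -> measurable_wrt (filt t) (X t).

(* sum over k < n of xi_k 1_{]t_k, t_{k+1}]}, with xi_k bounded and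
   filt(t_k)-measurable. *)
Record simple_process := SimpleProcess {
  sp_size : nat;
  sp_time : nat -> R;
  sp_coef : nat -> Omega -> R;
  sp_time_ge0 : 0 <= sp_time 0%N;
  sp_time_le : forall k, sp_time k <= sp_time k.+1;
  sp_adapted : forall k, measurable_wrt (filt (sp_time k)) (sp_coef k);
  sp_bounded : exists M : R, forall k w, `|sp_coef k w| <= M }.

Definition simple_val (S : simple_process) (s : R) (w : Omega) : R :=
  \sum_(k < sp_size S)
    sp_coef S k w * \1_(`]sp_time S k, sp_time S k.+1] : set R) s.

Definition simple_integral B (S : simple_process) (t : R) (w : Omega) : R :=
  \sum_(k < sp_size S)
    sp_coef S k w
      * (B (Num.min t (sp_time S k.+1)) w - B (Num.min t (sp_time S k)) w).

Definition cvg_proba0 (Z : nat -> Omega -> \bar R) : Prop :=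
  forall e : R, 0 < e ->
    P [set w | (e%:E <= Z n w)%E] @[n --> \oo] --> 0%E.

(* I is the Ito integral of H against B (B being a Brownian motion for filt, and
   H progressively measurable with int_0^T H^2 ds < oo almost surely): I is
   continuous, and is the limit, in probability and uniformly on compact
   intervals, of the integrals of simple processes S_n such that
   int_0^T (S_n - H)^2 ds tends to 0 in probability for every T. *)
Definition is_ito_integral B (H I : R -> Omega -> R) : Prop :=
  continuous_process I /\
  exists S : nat -> simple_process, forall T : R, 0 < T ->
    cvg_proba0 (fun n w =>
      \int[lebesgue_measure]_(s in `[0%R, T])
        ((simple_val (S n) s w - H s w) ^+ 2)%:E)%E /\
    cvg_proba0 (fun n w =>
      sup_dist T (simple_integral B (S n) ^~ w) (I ^~ w)).

(* X is a continuous solution of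
   dX_t = mu_{J_t}(t, X_t) dt + sigma_{J_t}(t, X_t) dB_t, with X_0 = x0. *)
Definition sde_solution (E : Type) (mu sigma : E -> R -> R -> R) (x0 : R)
    B (J : R -> Omega -> E) X : Prop :=
  [/\ continuous_process X, adapted X &
      exists2 I : R -> Omega -> R,
        is_ito_integral B (fun s w => sigma (J s w) s (X s w)) I &
        {ae P, forall w, forall t : R, 0 <= t ->
          X t w = x0
            + \int[lebesgue_measure]_(s in `[0, t]) mu (J s w) s (X s w)
            + I t w}].

End ito.

Definition converges_strongly (Y : R -> R -> Omega -> R) (Z : R -> Omega -> R)
    : Prop :=
  forall T : R, 0 < T ->
    {ae P, forall w,
      sup_dist T (Y lambda ^~ w) (Z ^~ w) @[lambda --> +oo] --> 0%E}.

End processes.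

(* Main.v *)
(* Between two jumps of [J], the Lamperti transform [Y_t = h_i (t, X_t)] satisfies
   [dY = mu*_i (t, Y) dt + dB], and the transform of [X^lambda] satisfies the same
   equation with [F^lambda] in place of [B]: the drift correction in the equation
   of [X^lambda] is what the Ito formula produces for [X].  Since the noise is
   additive and [mu*_i] is Lipschitz, Gronwall's lemma gives
   [|X^lambda - X|_t <= K (|X^lambda - X|_a + Phi)] on each interval starting at
   [a] where [J] is constant, with [Phi = sup_[0,T] |F^lambda - B|] and [K]
   deterministic; through [N_T] jumps this accumulates to
   [sup |X^lambda - X| <= (K + 1)^(N_T + 1) Phi], whence (i).  For (ii), cut at
   [N_T <= n] with [n] the integer part of [eps ln lambda / ln (K + 1)], so that
   [(K + 1)^n <= lambda^eps], while [P (N_T > n) = o (lambda^-q)].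

   The Ito formula is only needed for fixed rational endpoints, along a uniform
   grid: the residuals [R_k = I_{k+1} - I_k - H_k (B_{k+1} - B_k)] of the Ito
   integral [I] of [H] satisfy [sum w_k R_k -> 0] and [sum R_k^2 -> 0] in
   probability, and Taylor expansion along the path does the rest.  The left
   limits of [J] give the convergence of step approximations of [H]. *)
Require Import Defs.
From HB Require Import structures.
From mathcomp Require Import all_boot all_order all_algebra.
From mathcomp Require Import finmap.
From mathcomp Require Import all_classical all_reals all_analysis.
From mathcomp Require Import measurable_realfun ring lra.
Set Implicit Arguments.
Unset Strict Implicit.
Unset Printing Implicit Defensive.

Import Order.TTheory GRing.Theory Num.Theory.
Import numFieldNormedType.Exports.

Local Open Scope classical_set_scope.
Local Open Scope ring_scope.

(** * Continuous paths and Riemann sums *)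

(** The definition of [is_ito_integral] only supplies simple processes converging in probability,
    with no uniform bound, while the estimates are [L2] ones. Since [sigma] is bounded by [V],
    coefficients can be clipped to [[- V, V]]: this does not increase the distance to the integrand,
    turns convergence in probability into convergence of means, and by a Lenglart inequality leaves
    the limit unchanged. A second obstacle is that regimes start and end at random times, whereas
    only countably many null sets can be discarded: the transformed equation is proved for fixed
    endpoints on the event that [J] stays in one regime there, and extended from rational to
    arbitrary endpoints by continuity. The equations of [X] and [X^lambda] go through the same
    change of variables, with quadratic variation density [sigma ^+ 2] and [0] respectively. As the
    transformed noise is additive, no stochastic estimate is left afterwards: one null set serves
    all [lambda], [T] and jump counts, and probability reenters only through the events on [Phi] and
    [N_T]. *)

Section path_tools.
Context {R : realType}.
Implicit Types (f : R -> R) (s t T e : R).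

Lemma continuous_path_at f s e : continuous_path f -> 0 <= s -> 0 < e ->
  exists2 del, 0 < del & forall r, 0 <= r -> `|r - s| < del -> `|f r - f s| < e.
Proof.
move=> /subspace_continuousP cf s0 e0.
have /cf/cvgrPdist_lt/(_ e e0) : [set` `[0, +oo[] s by rewrite /= in_itv/= s0.
rewrite near_withinE => /nbhs_ballP[del /= del0 h]; exists del => // r r0 rs.
rewrite distrC; apply: h; last by rewrite /= in_itv/= r0.
by rewrite /ball/= distrC.
Qed.

Lemma continuous_path_seq f (u : nat -> R) s : continuous_path f ->
  0 <= s -> (forall n, 0 <= u n) -> u n @[n --> \oo] --> s ->
  f (u n) @[n --> \oo] --> f s.
Proof.
move=> cf s0 u0 us; apply/cvgrPdist_lt => e e0.
have [del del0 h] := continuous_path_at cf s0 e0.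
have /cvgrPdist_lt/(_ del del0) := us.
by apply: filterS => n /=; rewrite distrC [in X in _ -> X]distrC; exact: h.
Qed.

Lemma continuous_path_uniform f T e : continuous_path f -> 0 < e ->
  exists2 del, 0 < del & forall r s, 0 <= r <= T -> 0 <= s <= T ->
    `|r - s| < del -> `|f r - f s| < e.
Proof.
move=> cf e0.
have /compact_near_coveringP/near_covering_withinP cov :=
  @segment_compact R 0 T.
pose Q (del r : R) := forall s, 0 <= s <= T -> `|r - s| < del -> `|f r - f s| < e.
have : \forall del \near 0^'+, `[0, T] `<=` Q del.
  apply: cov => r; rewrite /= in_itv/= => /andP[r0 rT].
  have e20 : 0 < e / 2 by rewrite divr_gt0.
  have [del del0 h] := continuous_path_at cf r0 e20.
  have d20 : 0 < del / 2 by rewrite divr_gt0.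
  exists (ball r (del / 2), [set x | 0 < x < del / 2]) => /=.
    split; first exact: nbhsx_ballx.
    near=> x; apply/andP; split; first by near: x; exact: nbhs_right_gt.
    by near: x; exact: nbhs_right_lt.
  move=> [r' x] /= [rr' /andP[x0 xd]] r'0T s s0T r's.
  rewrite /ball/= in rr'; move: r'0T s0T; rewrite in_itv/= => /andP[r'0 _] /andP[s0 _].
  rewrite (le_lt_trans (ler_distD (f r) _ _))// [ltRHS]splitr ltrD//.
    by apply: h => //; rewrite distrC (lt_trans rr')// ltr_pdivrMr// ltr_pMr// ltr1n.
  rewrite distrC; apply: h => //.
  rewrite distrC (le_lt_trans (ler_distD r' _ _))// [ltRHS]splitr ltrD//.
  exact: lt_trans xd.
move=> H; have [del [Hd del0]] := @filter_ex _ (0^'+) _ _ (filterI H (nbhs_right_gt 0)).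
by exists del => // r s r0T s0T; exact: Hd.
Unshelve. all: by end_near. Qed.

Lemma continuous_pathP f :
  (forall s e, 0 <= s -> 0 < e -> exists2 del, 0 < del &
    forall r, 0 <= r -> `|r - s| < del -> `|f r - f s| < e) ->
  continuous_path f.
Proof.
move=> h; apply/subspace_continuousP => s; rewrite /= in_itv/= andbT => s0.
apply/cvgrPdist_lt => e e0; rewrite near_withinE.
have [del del0 hd] := h s e s0 e0.
apply/nbhs_ballP; exists del => //= r rs; rewrite /= in_itv/= andbT => r0.
by rewrite distrC; apply: hd => //; rewrite distrC.
Qed.

Lemma continuous_path_within f a b : 0 <= a -> continuous_path f ->
  {within `[a, b], continuous f}.
Proof.
move=> a0; apply: continuous_subspaceW => x /=; rewrite !in_itv/= andbT.
by move=> /andP[+ _]; exact: le_trans.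
Qed.

Lemma continuous_path_bounded f T : continuous_path f ->
  exists2 C, 0 < C & forall r, 0 <= r <= T -> `|f r| <= C.
Proof.
move=> cf; have /compact_bounded[M [_ Mf]] : compact (f @` `[0, T]).
  apply: continuous_compact; last exact: segment_compact.
  exact: continuous_path_within.
exists (Num.max M 0 + 1); first by rewrite ltr_wpDl ?ltr01// le_max lexx orbT.
move=> r r0T; apply: (Mf (Num.max M 0 + 1)); last by exists r.
by rewrite ltr_pwDr// le_max lexx.
Qed.

Lemma continuous_path_integrable f a b : 0 <= a -> continuous_path f ->
  lebesgue_measure.-integrable `[a, b] (EFin \o f).
Proof.
move=> a0 cf; apply: continuous_compact_integrable.
  exact: segment_compact.
exact: continuous_path_within.
Qed.

(** Local Lipschitz continuity on boxes only. No compact set is mentioned any more, which makes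
    stability under products, inverses and integration in [x] a matter of explicit constants. *)
Definition box_lipschitz (g : R -> R -> R) : Prop := forall T C : R,
  exists2 M, 0 < M & forall t s x y, 0 <= t <= T -> 0 <= s <= T ->
    `|x| <= C -> `|y| <= C -> `|g t x - g s y| <= M * (`|t - s| + `|x - y|).

Lemma locally_lipschitz_box (g : R -> R -> R) :
  locally_lipschitz g -> box_lipschitz g.
Proof.
move=> lg T C; have [||M M0 h] := lg (`[0, T] `*` `[- C, C]).
- by apply: compact_setX; exact: segment_compact.
- by move=> p [/=]; rewrite in_itv/= => /andP[].
exists M => // t s x y t0 s0 xC yC; apply: (h (t, x) (s, y)) => /=.
  by split; rewrite in_itv/= -?ler_norml.
by split; rewrite in_itv/= -?ler_norml.
Qed.

Lemma box_lipschitz_path (g : R -> R -> R) f : box_lipschitz g ->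
  continuous_path f -> continuous_path (fun s => g s (f s)).
Proof.
move=> lg cf; apply: continuous_pathP => s e s0 e0.
have [C C0 fC] := continuous_path_bounded (s + 1) cf.
have [M M0 gM] := lg (s + 1) C.
have eM : 0 < e / (2 * M) by rewrite divr_gt0// mulr_gt0.
have [del del0 h] := continuous_path_at cf s0 eM.
(* Radius [1] keeps [r] inside [[0, s + 1]], where [C] and [M] are valid; the two other radii each
   take half of [e / M]. *)
exists (Num.min 1 (Num.min del (e / (2 * M)))).
  by rewrite !lt_min ltr01 del0.
move=> r r0; rewrite !lt_min => /andP[rs1 /andP[rsd rse]].
have rs : 0 <= r <= s + 1.
  by rewrite r0/=; move: rs1; rewrite ltr_norml => /andP[_]; lra.
have ss : 0 <= s <= s + 1 by rewrite s0/=; lra.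
apply: le_lt_trans (gM _ _ _ _ rs ss (fC _ rs) (fC _ ss)) _.
rewrite mulrC -ltr_pdivlMr//.
have := h _ r0 rsd.
have -> : e / M = e / (2 * M) + e / (2 * M) by field; exact: lt0r_neq0.
exact: ltrD.
Qed.

Lemma continuous_pathB f g : continuous_path f -> continuous_path g ->
  continuous_path (fun s => f s - g s).
Proof. by move=> cf cg x; apply: cvgB; [exact: cf|exact: cg]. Qed.

Lemma continuous_pathD f g : continuous_path f -> continuous_path g ->
  continuous_path (fun s => f s + g s).
Proof. by move=> cf cg x; apply: cvgD; [exact: cf|exact: cg]. Qed.

Lemma continuous_pathM f g : continuous_path f -> continuous_path g ->
  continuous_path (fun s => f s * g s).
Proof. by move=> cf cg x; apply: cvgM; [exact: cf|exact: cg]. Qed.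

End path_tools.

Section riemann_sums.
Context {R : realType}.
Local Notation mu := (@lebesgue_measure R).
Implicit Types (f : R -> R) (a b c s t e : R).

Lemma Rintegral_itv_split f a b c : a <= b -> b <= c ->
  mu.-integrable `[a, c] (EFin \o f) ->
  \int[mu]_(x in `[a, c]) f x
    = \int[mu]_(x in `[a, b]) f x + \int[mu]_(x in `[b, c]) f x.
Proof.
move=> ab bc intf; have := @Rintegral_itvB R f (BLeft a) (BRight c) b intf.
rewrite !bnd_simp => /(_ ab bc) h.
have -> : \int[mu]_(x in `[b, c]) f x = \int[mu]_(x in `]b, c]) f x.
  rewrite -Rintegral_itv_obnd_cbnd//; apply: integrableS intf => //.
  by apply: subset_itv; rewrite bnd_simp.
by rewrite -h addrC subrK.
Qed.

Lemma Rintegral_itv_cst a b c : a <= b ->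
  \int[mu]_(x in `[a, b]) c = c * (b - a).
Proof.
move=> ab; rewrite Rintegral_cst//= lebesgue_measure_itv/= lte_fin.
by move: ab; rewrite le_eqVlt => /predU1P[->|->//]; rewrite ltxx subrr.
Qed.

(** One lemma for two uses: with [c = 0] it bounds the size of the integral, with [c] a value of [f]
    the error of one rectangle. *)
Lemma Rintegral_itv_close f a b c e : a <= b ->
  mu.-integrable `[a, b] (EFin \o f) ->
  (forall u, a <= u <= b -> `|f u - c| <= e) ->
  `|\int[mu]_(x in `[a, b]) f x - c * (b - a)| <= e * (b - a).
Proof.
move=> ab intf h.
have icst k : mu.-integrable `[a, b] (EFin \o (fun=> k)).
  apply: continuous_compact_integrable; first exact: segment_compact.
  by move=> x; exact: cvg_cst.
rewrite -!Rintegral_itv_cst// -RintegralB//.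
have ifc : mu.-integrable `[a, b] (EFin \o (fun x => f x - c)).
  exact: (integrableB _ intf (icst c)).
apply: le_trans (le_normr_Rintegral _ ifc) _ => //.
apply: le_Rintegral => //.
exact: (integrable_abse ifc).
Qed.

(** For [n = 0] the division gives [0] and every point is [s], so that monotonicity and membership
    need no positivity of [n]. *)
Definition grid s t (n k : nat) : R := s + (t - s) * k%:R / n%:R.

Lemma grid0 s t n : grid s t n 0 = s.
Proof. by rewrite /grid mulr0 mul0r addr0. Qed.

Lemma grid_end s t n : (0 < n)%N -> grid s t n n = t.
Proof.
by move=> n0; rewrite /grid mulfK ?pnatr_eq0 -?lt0n// addrC subrK.
Qed.

Lemma gridS s t n k : grid s t n k.+1 = grid s t n k + (t - s) / n%:R.
Proof. by rewrite /grid -natr1; ring. Qed.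

Lemma grid_le s t n k l : s <= t -> (k <= l)%N -> grid s t n k <= grid s t n l.
Proof.
move=> st kl; rewrite lerD2l ler_wpM2r ?invr_ge0// ler_wpM2l ?subr_ge0//.
by rewrite ler_nat.
Qed.

Lemma grid_in s t n k : s <= t -> (k <= n)%N -> s <= grid s t n k <= t.
Proof.
move=> st kn; rewrite -{1}(grid0 s t n) grid_le//=.
case: n => [|n] in kn *; first by move: kn; rewrite leqn0 => /eqP ->; rewrite grid0.
by rewrite -[leRHS](@grid_end s t n.+1)// grid_le.
Qed.

Lemma grid_sum s t n (g : R -> R) : (0 < n)%N ->
  \sum_(k < n) (g (grid s t n k.+1) - g (grid s t n k)) = g t - g s.
Proof.
move=> n0; rewrite -[in RHS](grid_end s t n0) -[in X in _ - X](grid0 s t n).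
by rewrite -(telescope_sumr (fun k => g (grid s t n k)))// big_mkord.
Qed.

Lemma grid_mesh s t del : 0 < del -> \forall n \near \oo, (t - s) / n%:R < del.
Proof.
move=> del0; near=> n.
have n0 : (0 : R) < n%:R by rewrite ltr0n; near: n; exact: nbhs_infty_gt.
rewrite ltr_pdivrMr// mulrC -ltr_pdivrMr//.
by near: n; exact: nbhs_infty_gtr.
Unshelve. all: by end_near. Qed.

(** Uniform continuity bounds the error on each cell by [e] times its length, and the lengths add up
    to [t - s]. The left endpoint is used because it is the one at which adapted weights are known
    later on. *)
Lemma riemann_sum f s t e : 0 <= s -> s <= t -> continuous_path f -> 0 < e ->
  \forall n \near \oo,
    `|\int[mu]_(x in `[s, t]) f x
      - \sum_(k < n) f (grid s t n k) * ((t - s) / n%:R)| <= e * (t - s).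
Proof.
move=> s0 st cf e0; have [del del0 h] := continuous_path_uniform t cf e0.
near=> n.
have n0 : (0 < n)%N by near: n; exact: nbhs_infty_gt.
have mesh : (t - s) / n%:R < del by near: n; exact: grid_mesh.
have st0 : 0 <= (t - s) / n%:R by rewrite divr_ge0// subr_ge0.
have intf a b : 0 <= a -> mu.-integrable `[a, b] (EFin \o f).
  by move=> a0; exact: continuous_path_integrable.
pose F x := \int[mu]_(y in `[s, x]) f y.
have -> : \int[mu]_(x in `[s, t]) f x = F t - F s.
  by rewrite /F set_itv1 Rintegral_set1 subr0.
rewrite -(grid_sum s t F n0) -sumrB.
apply: le_trans (ler_norm_sum _ _ _) _.
have -> : e * (t - s) = \sum_(k < n) e * ((t - s) / n%:R).
  rewrite sumr_const card_ord -[RHS]mulr_natr; field.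
  by rewrite pnatr_eq0 -lt0n.
apply: ler_sum => k _.
have kn : (k < n)%N by [].
have /andP[sk kt] := grid_in st (ltnW kn).
have kk : grid s t n k <= grid s t n k.+1 by exact: grid_le.
have /andP[_ k1t] := grid_in st kn.
rewrite /F (Rintegral_itv_split sk kk); last exact: intf.
rewrite [X in X - _]addrAC subrr add0r.
have -> : (t - s) / n%:R = grid s t n k.+1 - grid s t n k by rewrite gridS; ring.
apply: Rintegral_itv_close => //; first by apply: intf; exact: le_trans sk.
move=> u /andP[ku uk]; apply/ltW/h.
- by rewrite (le_trans s0 (le_trans sk ku)) (le_trans uk k1t).
- by rewrite (le_trans s0 sk).
- rewrite ger0_norm ?subr_ge0//; apply: le_lt_trans mesh.
  by rewrite lerBlDl -gridS.
Unshelve. all: by end_near. Qed.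

End riemann_sums.

(** * Gaussian moments *)

Lemma measurable_fun_EFin d (T : measurableType d) (R : realType) (D : set T)
    (f : T -> R) :
  measurable_fun D f -> measurable_fun D (fun x => (f x)%:E).
Proof. by move=> mf; exact/measurable_EFinP. Qed.

Section real_ge0_integral.
Context d (T : measurableType d) (R : realType) (m : {measure set T -> \bar R}).
Implicit Types (f g : T -> R).

Lemma ge0_intZl (k : R) f : 0 <= k -> measurable_fun setT f ->
  (forall x, 0 <= f x) ->
  (\int[m]_x (k * f x)%:E = k%:E * \int[m]_x (f x)%:E)%E.
Proof.
move=> k0 mf f0; under eq_integral do rewrite EFinM.
rewrite ge0_integralZl//; first exact: measurable_fun_EFin.
by move=> x _; rewrite lee_fin.
Qed.

Lemma ge0_intD f g : measurable_fun setT f -> measurable_fun setT g ->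
  (forall x, 0 <= f x) -> (forall x, 0 <= g x) ->
  (\int[m]_x (f x + g x)%:E = \int[m]_x (f x)%:E + \int[m]_x (g x)%:E)%E.
Proof.
move=> mf mg f0 g0; under eq_integral do rewrite EFinD.
rewrite ge0_integralD//.
- by move=> x _; rewrite lee_fin.
- exact: measurable_fun_EFin.
- by move=> x _; rewrite lee_fin.
- exact: measurable_fun_EFin.
Qed.

Lemma ge0_le_int f g : measurable_fun setT f -> measurable_fun setT g ->
  (forall x, 0 <= f x) -> (forall x, f x <= g x) ->
  (\int[m]_x (f x)%:E <= \int[m]_x (g x)%:E)%E.
Proof.
move=> mf mg f0 fg; apply: ge0_le_integral => //.
- by move=> x _; rewrite lee_fin.
- exact: measurable_fun_EFin.
- exact: measurable_fun_EFin.
- by move=> x _; rewrite lee_fin.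
Qed.

End real_ge0_integral.

Lemma prob_int_cst d (T : measurableType d) (R : realType)
    (P : probability T R) (k : R) : (\int[P]_x k%:E = k%:E)%E.
Proof. by rewrite integral_cst// [X in (_ * X)%E]probability_setT mule1. Qed.

Section density.
Context d (T : measurableType d) (R : realType).
Variables (nu mu : {measure set T -> \bar R}) (p : T -> R).
Hypotheses (mp : measurable_fun setT p) (p0 : forall x, 0 <= p x).
Hypothesis nuE : forall A, measurable A -> nu A = (\int[mu]_(x in A) (p x)%:E)%E.
Import HBNNSimple.

Let integral_density_nnsfun (f : {nnsfun T >-> R}) :
  (\int[nu]_x (f x)%:E = \int[mu]_x ((f x)%:E * (p x)%:E))%E.
Proof.
under [LHS]eq_integral do rewrite fimfunE -fsumEFin//.
rewrite [LHS]ge0_integral_fsum//; last 2 first.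
  - by move=> r; exact/measurable_EFinP/measurableT_comp.
  - by move=> n x _; exact: nnfun_muleindic_ge0.
under [RHS]eq_integral.
  move=> x xD; rewrite fimfunE -fsumEFin// ge0_mule_fsuml; last first.
    by move=> r; exact: nnfun_muleindic_ge0.
  over.
rewrite [RHS]ge0_integral_fsum//; last 2 first.
  - move=> r; apply: emeasurable_funM; last exact/measurable_EFinP.
    exact/measurable_EFinP/measurableT_comp.
  - move=> n x _; rewrite mule_ge0// ?lee_fin//.
    by exact: nnfun_muleindic_ge0.
apply: eq_fsbigr => r _.
rewrite integralZl_indic_nnsfun//= integral_indic// setIT nuE//.
(* A negative level has an empty preimage; a nonnegative constant [r] may leave the integral. *)
have [r0|r0] := leP 0 r; last first.
  rewrite preimage_nnfun0// integral_set0 mule0 integral0_eq// => x _.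
  by rewrite indicE in_set0 mulr0 mul0e.
under [RHS]eq_integral do rewrite EFinM -muleA.
rewrite ge0_integralZl//; last 2 first.
- by apply: emeasurable_funM; apply/measurable_EFinP.
- by move=> x _; rewrite mule_ge0// lee_fin.
congr *%E; rewrite integral_mkcond/=.
apply: eq_integral => x _; rewrite patchE indicE.
by case: ifPn => _; rewrite ?mul1e ?mul0e.
Qed.

(** Both sides agree on simple functions by [nuE] and linearity; monotone convergence along
    [nnsfun_approx] does the rest, on the right because [p] is nonnegative and the products still
    increase. *)
Lemma ge0_integral_density (f : T -> \bar R) :
  measurable_fun setT f -> (forall x, 0 <= f x)%E ->
  (\int[nu]_x f x = \int[mu]_x (f x * (p x)%:E))%E.
Proof.
move=> mf f0; pose f_ := nnsfun_approx measurableT mf.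
transitivity (limn (fun n => \int[nu]_x (f_ n x)%:E)%E).
  rewrite -monotone_convergence//=.
  - apply: eq_integral => ? /[!inE] xD; apply/esym/cvg_lim => //=.
    exact: cvg_nnsfun_approx.
  - by move=> n; exact/measurable_EFinP/measurable_funTS.
  - by move=> n ? _; rewrite lee_fin.
  - by move=> ? _ ? ? mn; rewrite lee_fin; exact/lefP/nd_nnsfun_approx.
under eq_fun do rewrite integral_density_nnsfun.
rewrite -monotone_convergence//=.
- apply: eq_integral => x _; apply/cvg_lim => //.
  by apply: cvgeZr => //; apply: cvg_nnsfun_approx => // y _.
- by move=> n; apply: emeasurable_funM; apply/measurable_EFinP.
- by move=> n x _; rewrite mule_ge0// lee_fin.
- move=> x _ a b ab; apply: lee_wpmul2r; rewrite lee_fin//.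
  exact/lefP/nd_nnsfun_approx.
Qed.
End density.

Section gaussian.
Context {R : realType}.
Implicit Types (s h x r : R).

Lemma ge0_integral_normal_prob m s (f : R -> \bar R) :
  measurable_fun setT f -> (forall x, 0 <= f x)%E ->
  (\int[normal_prob m s]_x f x
    = \int[lebesgue_measure]_x (f x * (normal_pdf m s x)%:E))%E.
Proof.
move=> mf f0; apply: ge0_integral_density => //.
- exact: measurable_normal_pdf.
- by move=> x; exact: normal_pdf_ge0.
Qed.

(** The exponent is chosen so that the factor turns the density of standard deviation [s] into [r]
    times the density of standard deviation [r * s]. This is the generating function of the square,
    parametrized by its own value. *)
Lemma normal_expR_square s r : 0 < s -> 0 < r ->
  (\int[normal_prob 0 s]_x
     (expR ((1 - r ^- 2) / (2 * s ^+ 2) * x ^+ 2))%:E = r%:E)%E.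
Proof.
move=> s0 r0; have rs0 : r * s != 0 by rewrite mulf_neq0// gt_eqF.
rewrite ge0_integral_normal_prob//; last first.
  apply: measurable_fun_EFin; apply: measurableT_comp => //.
  by apply: measurable_funM => //; exact: measurable_funX.
transitivity (\int[lebesgue_measure]_x (r%:E * (normal_pdf 0 (r * s) x)%:E))%E.
  apply: eq_integral => x _; rewrite -!EFinM; congr EFin.
  rewrite !normal_pdfE ?gt_eqF// ?mulr_gt0// /normal_peak /normal_fun.
  have -> : Num.sqrt ((r * s) ^+ 2 * pi *+ 2) = r * Num.sqrt (s ^+ 2 * pi *+ 2).
    have -> : (r * s) ^+ 2 * pi *+ 2 = r ^+ 2 * (s ^+ 2 * pi *+ 2) by ring.
    by rewrite sqrtrM ?sqr_ge0// sqrtr_sqr gtr0_norm.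
  set S := Num.sqrt _; set E1 := expR _; set E2 := expR _; set E3 := expR _.
  have S0 : S != 0.
    by rewrite gt_eqF// sqrtr_gt0 mulrn_wgt0// mulr_gt0 ?pi_gt0 ?exprn_gt0.
  have <- : E1 * E2 = E3.
    rewrite -expRD; congr expR.
    by rewrite !subr0; field; rewrite !gt_eqF.
  by field; apply/andP; split => //; exact: lt0r_neq0.
rewrite ge0_integralZl//.
- by rewrite integral_normal_pdf mule1.
- by apply: measurable_fun_EFin; exact: measurable_normal_pdf.
- by move=> x _; rewrite lee_fin normal_pdf_ge0.
- by rewrite lee_fin ltW.
Qed.

(** Completing the square: the tilted density is the one with mean [h * s ^+ 2], up to the stated
    factor. *)
Lemma normal_expR_linear s h : 0 < s ->
  (\int[normal_prob 0 s]_x (expR (h * x))%:E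
    = (expR (h ^+ 2 * s ^+ 2 / 2))%:E)%E.
Proof.
move=> s0.
rewrite ge0_integral_normal_prob//; last first.
  have mh : measurable_fun [set: R] (fun x : R => h * x).
    exact: measurable_funM.
  by apply: measurable_fun_EFin; apply: measurableT_comp => //; exact: mh.
transitivity (\int[lebesgue_measure]_x
   ((expR (h ^+ 2 * s ^+ 2 / 2))%:E * (normal_pdf (h * s ^+ 2) s x)%:E))%E.
  apply: eq_integral => x _; rewrite -!EFinM; congr EFin.
  rewrite !normal_pdfE ?gt_eqF// ?mulr_gt0// /normal_fun.
  rewrite mulrCA [RHS]mulrCA; congr *%R; rewrite -!expRD; congr expR.
  by rewrite !subr0; field; rewrite !gt_eqF.
rewrite ge0_integralZl//.
- by rewrite integral_normal_pdf mule1.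
- by apply: measurable_fun_EFin; exact: measurable_normal_pdf.
- by move=> x _; rewrite lee_fin normal_pdf_ge0.
Qed.

End gaussian.

Section normal_moments.
Context d (T : measurableType d) (R : realType) (P : probability T R).
Variables (Z : T -> R) (s : R).
Hypotheses (mZ : measurable_fun setT Z) (s0 : 0 < s).
Hypothesis lawZ : forall U : set R, measurable U ->
  P [set w | U (Z w)] = normal_prob 0 s U.

Lemma ge0_integral_normal_law (f : R -> \bar R) :
  measurable_fun setT f -> (forall x, 0 <= f x)%E ->
  (\int[P]_w f (Z w) = \int[normal_prob 0 s]_x f x)%E.
Proof.
move=> mf f0.
pose mZI := @isMeasurableFun.Build _ _ T (measurableTypeR R) Z mZ.
pose Z' : {mfun T >-> measurableTypeR R} := HB.pack Z mZI.
rewrite -[LHS](@ge0_integral_distribution _ _ _ (measurableTypeR R) R P Z' f mf f0).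
by apply: eq_measure_integral => A mA _; exact: lawZ.
Qed.

Lemma normal_law_expR_square (r : R) : 0 < r ->
  (\int[P]_w (expR ((1 - r ^- 2) / (2 * s ^+ 2) * Z w ^+ 2))%:E = r%:E)%E.
Proof.
move=> r0; rewrite -(normal_expR_square s0 r0).
apply: (@ge0_integral_normal_law
  (fun x => (expR ((1 - r ^- 2) / (2 * s ^+ 2) * x ^+ 2))%:E)) => //.
  apply: measurable_fun_EFin; apply: measurableT_comp => //.
  by apply: measurable_funM => //; exact: measurable_funX.
Qed.

Lemma normal_law_expR_linear (h : R) :
  (\int[P]_w (expR (h * Z w))%:E = (expR (h ^+ 2 * s ^+ 2 / 2))%:E)%E.
Proof.
rewrite -(normal_expR_linear h s0).
apply: (@ge0_integral_normal_law (fun x => (expR (h * x))%:E)) => //.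
have mh : measurable_fun [set: R] (fun x : R => h * x).
  exact: measurable_funM.
by apply: measurable_fun_EFin; apply: measurableT_comp => //; exact: mh.
Qed.

Let mZ2 : measurable_fun setT (fun w => Z w ^+ 2).
Proof. exact: measurable_funX. Qed.

Let sqr_le_expR (y : R) : 0 <= y -> y ^+ 2 <= 4 * expR y.
Proof.
move=> y0; have h : 1 + y / 2 <= expR (y / 2) by exact: expR_ge1Dx.
have -> : expR y = expR (y / 2) ^+ 2 by rewrite expr2 -expRD; congr expR; field.
have : (1 + y / 2) ^+ 2 <= expR (y / 2) ^+ 2.
  by rewrite ler_sqr ?nnegrE ?expR_ge0// addr_ge0// divr_ge0.
by nra.
Qed.

(** A crude bound in place of the exact [3 * s ^+ 4]. At [r = 2] the exponent is
    [c = 3 / (8 * s ^+ 2)], and [y ^+ 2 <= 4 * expR y] at [y = c * Z ^+ 2] gives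
    [Z ^+ 4 <= 256 / 9 * s ^+ 4 * expR y], whose mean is at most [64 * s ^+ 4]. *)
Lemma normal_law_4th : (\int[P]_w (Z w ^+ 4)%:E <= (64 * s ^+ 4)%:E)%E.
Proof.
have := @normal_law_expR_square 2 ltac:(by []).
set c := (1 - _) / _ => E2.
have mE : measurable_fun setT (fun w => expR (c * Z w ^+ 2)).
  by apply: measurableT_comp => //; exact: measurable_funM.
have s40 : 0 < s ^+ 4 by rewrite exprn_gt0.
apply: (@le_trans _ _
  (\int[P]_w ((256 / 9 * s ^+ 4) * (expR (c * Z w ^+ 2)))%:E))%E.
  apply: ge0_le_int => //.
  - exact: measurable_funX.
  - exact: measurable_funM.
  - by move=> w; rewrite exprn_even_ge0.
  - move=> w.
    have cZ0 : 0 <= c * Z w ^+ 2.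
      apply: mulr_ge0; last exact: sqr_ge0.
      apply: divr_ge0; last by rewrite mulr_ge0// sqr_ge0.
      by rewrite subr_ge0 invf_le1 ?exprn_gt0// expr2; lra.
    have := sqr_le_expR cZ0.
    have -> : (c * Z w ^+ 2) ^+ 2 = 9 * Z w ^+ 4 / (64 * s ^+ 4).
      by rewrite /c; field; exact: lt0r_neq0.
    by rewrite ler_pdivrMr ?mulr_gt0// => h; lra.
rewrite ge0_intZl//; last by rewrite mulr_ge0// ltW.
by rewrite E2 -EFinM lee_fin; lra.
Qed.

(** Unlike the fourth moment, this one must be exact: the squares of Brownian increments are later
    centred at it. *)
Lemma normal_law_square : (\int[P]_w (Z w ^+ 2)%:E = (s ^+ 2)%:E)%E.
Proof.
have m0 : (0 <= \int[P]_w (Z w ^+ 2)%:E)%E.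
  by apply: integral_ge0 => w _; rewrite lee_fin sqr_ge0.
have mooo : (\int[P]_w (Z w ^+ 2)%:E < +oo)%E.
  apply: (@le_lt_trans _ _ (\int[P]_w (1 + Z w ^+ 4)%:E))%E.
    apply: ge0_le_int => //.
    - by apply: measurable_funD => //; exact: measurable_funX.
    - by move=> w; rewrite sqr_ge0.
    - move=> w; rewrite (exprM _ 2 2); set u := Z w ^+ 2.
      by have : 0 <= (u - 1) ^+ 2 := sqr_ge0 _; have : 0 <= u := sqr_ge0 _; nra.
  rewrite ge0_intD//.
  - rewrite prob_int_cst lte_add_pinfty ?ltry//.
    by apply: le_lt_trans normal_law_4th _; rewrite ltry.
  - exact: measurable_funX.
  - by move=> w; rewrite exprn_even_ge0.
move ME : (\int[P]_w (Z w ^+ 2)%:E)%E m0 mooo => m; case: m ME => // M ME M0 _.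
rewrite lee_fin in M0.
(* [1 + h x ^ 2 <= expR (h x ^ 2)] for [h] of either sign; both sides are
   integrated, and then [h] tends to [0] *)
have key r : 0 < r -> (r ^+ 2 - 1) * M <= 2 * s ^+ 2 * r ^+ 2 * (r - 1).
  move=> r0; have := normal_law_expR_square r0.
  set c := (_ / _) => Er.
  have mE : measurable_fun setT (fun w => expR (c * Z w ^+ 2)).
    by apply: measurableT_comp => //; apply: measurable_funM => //.
  suff h : c * M <= r - 1.
    have -> : (r ^+ 2 - 1) * M = c * M * (2 * s ^+ 2 * r ^+ 2).
      by rewrite /c; field; rewrite !gt_eqF.
    rewrite [leRHS]mulrC; apply: ler_wpM2r => //.
    by rewrite mulr_ge0 ?sqr_ge0// mulr_ge0 ?sqr_ge0.
  have [c0|c0] := leP 0 c.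
    have : (\int[P]_w (1 + c * Z w ^+ 2)%:E <= r%:E)%E.
      rewrite -Er; apply: ge0_le_int => //.
      - by apply: measurable_funD => //; exact: measurable_funM.
      - by move=> w; rewrite addr_ge0// mulr_ge0// sqr_ge0.
      - by move=> w; rewrite expR_ge1Dx.
    rewrite ge0_intD//; last 2 first.
    - exact: measurable_funM.
    - by move=> w; rewrite mulr_ge0// sqr_ge0.
    rewrite ge0_intZl//; last by move=> w; rewrite sqr_ge0.
    rewrite prob_int_cst ME -EFinM -EFinD lee_fin.
    by lra.
  have nc0 : 0 <= - c by rewrite oppr_ge0 ltW.
  have : (1%:E <= \int[P]_w (expR (c * Z w ^+ 2) + (- c) * Z w ^+ 2)%:E)%E.
    rewrite -(prob_int_cst P 1); apply: ge0_le_int => //.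
    - by apply: measurable_funD => //; exact: measurable_funM.
    - by move=> w; have := expR_ge1Dx (c * Z w ^+ 2); lra.
  rewrite ge0_intD//; last 2 first.
  - exact: measurable_funM.
  - by move=> w; rewrite mulr_ge0// sqr_ge0.
  rewrite ge0_intZl//; last by move=> w; rewrite sqr_ge0.
  by rewrite Er ME -EFinM -EFinD lee_fin; lra.
have s20 : 0 < s ^+ 2 by rewrite exprn_gt0.
congr EFin; apply/eqP; rewrite eq_le; apply/andP; split; apply/ler_addgt0Pr => e e0.
(* [r = 1 + t]: after division by [t], the inequality [2 * (1 + t) ^+ 2 <= (2 + t) * (1 + 2 * t)]
   leaves [M <= s ^+ 2 + 2 * t * s ^+ 2], and [t] is chosen to make the excess at most [e]. The next
   case is the mirror image [r = 1 - t]. *)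
- pose t := Num.min 1 (e / (2 * s ^+ 2)).
  have t0 : 0 < t by rewrite lt_min ltr01 divr_gt0// mulr_gt0.
  have t1 : t <= 1 by rewrite ge_min lexx.
  have te : t * (2 * s ^+ 2) <= e by rewrite -ler_pdivlMr ?mulr_gt0// ge_min lexx orbT.
  have := key (1 + t) (addr_gt0 ltr01 t0).
  rewrite (_ : _ * M = t * ((2 + t) * M)); last ring.
  rewrite (_ : _ * (_ - 1) = t * (2 * s ^+ 2 * (1 + t) ^+ 2)); last ring.
  rewrite ler_pM2l// => h.
  have : (2 + t) * M <= (2 + t) * (s ^+ 2 * (1 + 2 * t)).
    by apply: le_trans h _; nra.
  by rewrite ler_pM2l ?addr_gt0// => ?; lra.
- pose t := Num.min (2^-1) (e / (2 * s ^+ 2)).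
  have t0 : 0 < t by rewrite lt_min invr_gt0 ltr0n divr_gt0// mulr_gt0.
  have t1 : t <= 2^-1 by rewrite ge_min lexx.
  have te : t * (2 * s ^+ 2) <= e by rewrite -ler_pdivlMr ?mulr_gt0// ge_min lexx orbT.
  have := key (1 - t) ltac:(lra).
  rewrite (_ : _ * M = - (t * ((2 - t) * M))); last ring.
  rewrite (_ : _ * (_ - 1) = - (t * (2 * s ^+ 2 * (1 - t) ^+ 2))); last ring.
  rewrite lerN2 ler_pM2l// => h.
  have : (2 - t) * (s ^+ 2 * (1 - 2 * t)) <= (2 - t) * M.
    by apply: le_trans h; nra.
  by rewrite ler_pM2l; [move=> ?; lra|lra].
Qed.

Lemma normal_law_integrable_square : P.-integrable setT (fun w => (Z w ^+ 2)%:E).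
Proof.
apply/integrableP; split; first exact: measurable_fun_EFin.
under eq_integral do rewrite gee0_abs ?lee_fin ?sqr_ge0//.
by rewrite normal_law_square ltry.
Qed.

Lemma normal_law_integrable : P.-integrable setT (EFin \o Z).
Proof.
apply: (@le_integrable _ _ _ _ _ _ _ (fun w => (1 + Z w ^+ 2)%:E)) => //.
- exact/measurable_EFinP.
- move=> w _ /=; rewrite lee_fin [leRHS]ger0_norm ?addr_ge0 ?sqr_ge0//.
  by rewrite -(real_normK (num_real (Z w))); have := normr_ge0 (Z w); nra.
- under eq_fun do rewrite EFinD.
  apply: integrableD => //; last exact: normal_law_integrable_square.
  exact: finite_measure_integrable_cst.
Qed.

(** Integrating [1 + h x <= expR (h x)] gives [h * m <= expR y - 1] with [y = h ^+ 2 * s ^+ 2 / 2],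
    and [expR y <= 1 + 2 * y] for [y <= 2^-1]. Dividing by small [h] of either sign bounds [m] from
    both sides. *)
Lemma normal_law_mean : \int[P]_w Z w = 0.
Proof.
set m := Rintegral _ _ _.
have i1 : P.-integrable setT (fun=> 1%:E) by exact: finite_measure_integrable_cst.
have key h : `|h| * s <= 1 -> h * m <= h ^+ 2 * s ^+ 2.
  move=> hs; pose y := h ^+ 2 * s ^+ 2 / 2.
  have ih : P.-integrable setT (EFin \o (fun w => h * Z w)).
    apply: (eq_integrable _ (fun w => h%:E * (Z w)%:E)%E) => //.
    by apply: integrableZl => //; exact: normal_law_integrable.
  have y0 : 0 <= y by rewrite /y divr_ge0// mulr_ge0 ?sqr_ge0.
  have y1 : y <= 2^-1.
    have : (`|h| * s) ^+ 2 <= 1 by rewrite exprn_ile1// mulr_ge0// ltW.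
    by rewrite exprMn real_normK ?num_real// /y => ?; lra.
  have ey : expR y <= 1 + 2 * y.
    have := expR_ge1Dx (- y); rewrite expRN => h1.
    have e0 := expR_gt0 y.
    have : (1 - y) * expR y <= 1 by rewrite -ler_pdivlMr// div1r.
    by move=> ?; nra.
  have : \int[P]_w (1 + h * Z w) <= \int[P]_w expR (h * Z w).
    apply: le_Rintegral => //.
    - apply: (eq_integrable _ (fun w => 1%:E + (h * Z w)%:E)%E) => //.
      exact: integrableD.
    - apply/integrableP; split.
        apply: measurable_fun_EFin; apply: measurableT_comp => //.
        by apply: measurable_funM => //.
      under eq_integral do rewrite gee0_abs ?lee_fin ?expR_ge0//=.
      by rewrite normal_law_expR_linear ltry.
    - by move=> w _; exact: expR_ge1Dx.
  rewrite RintegralD// Rintegral_cst// [X in fine X]probability_setT mulr1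
    RintegralZl//; last first.
    exact: normal_law_integrable.
  rewrite {2}/Rintegral normal_law_expR_linear /= -/y -/m => h1.
  by move: ey h1; rewrite /y => ? ?; lra.
apply/eqP; rewrite eq_le; apply/andP; split; apply/ler_addgt0Pr => e e0.
all: pose t := Num.min (s^-1) (e / s ^+ 2).
all: have t0 : 0 < t by rewrite lt_min invr_gt0 s0 divr_gt0// exprn_gt0.
all: have ts : t * s <= 1 by rewrite -ler_pdivlMr// div1r ge_min lexx.
all: have te : t * s ^+ 2 <= e by rewrite -ler_pdivlMr ?exprn_gt0// ge_min lexx orbT.
- have := key t; rewrite gtr0_norm// => /(_ ts).
  by rewrite expr2 -mulrA ler_pM2l// add0r => /le_trans; apply.
- have := key (- t); rewrite normrN gtr0_norm// => /(_ ts).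
  rewrite sqrrN mulNr expr2 -mulrA -mulrN ler_pM2l// => h.
  by rewrite -lerBlDl sub0r (le_trans h).
Qed.

End normal_moments.

(** * Independence and the augmented filtration *)

Section independence.
Context d (T : measurableType d) (R : realType) (P : probability T R).
Variables (W Y : T -> R).
Hypotheses (mW : measurable_fun setT W) (mY : measurable_fun setT Y).
Hypothesis WY : forall U V : set R, measurable U -> measurable V ->
  P (W @^-1` U `&` Y @^-1` V) = (P (W @^-1` U) * P (Y @^-1` V))%E.
Hypotheses (iW : P.-integrable setT (EFin \o W))
           (iY : P.-integrable setT (EFin \o Y)).
Local Notation S := (measurableTypeR R).

Let mWI := @isMeasurableFun.Build _ _ T S W mW.
Let W' : {mfun T >-> S} := HB.pack W mWI.
Let mYI := @isMeasurableFun.Build _ _ T S Y mY.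
Let Y' : {mfun T >-> S} := HB.pack Y mYI.
Let mWYI := @isMeasurableFun.Build _ _ T (S * S)%type (fun w => (W w, Y w))
  (measurable_fun_pair mW mY).
Let WY' : {mfun T >-> (S * S)%type} := HB.pack (fun w => (W w, Y w)) mWYI.

(** Independence says that the law of the pair and the product of the laws agree on rectangles,
    which determines them on the product space. *)
Let jointE (f : S * S -> \bar R) :
  (\int[distribution P W' \x distribution P Y']_z f z
    = \int[distribution P WY']_z f z)%E.
Proof.
apply: eq_measure_integral => A mA _.
exact: product_measure_unique.
Qed.

Let mul_law (z : S * S) : \bar R := (z.1 * z.2)%:E.

Let mmul : measurable_fun setT mul_law.
Proof.
apply: measurable_fun_EFin.
exact: (measurable_funM measurable_fst measurable_snd).
Qed.

Let iWlaw : (distribution P W').-integrable setT (EFin : S -> \bar R).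
Proof.
apply/integrableP; split; first exact: measurable_fun_EFin.
rewrite (@ge0_integral_distribution _ _ _ S R P W' (fun x : S => `|x%:E|%E))//.
  by case/integrableP : iW.
by apply: measurableT_comp => //; exact: measurable_fun_EFin.
Qed.

Let iYlaw : (distribution P Y').-integrable setT (EFin : S -> \bar R).
Proof.
apply/integrableP; split; first exact: measurable_fun_EFin.
rewrite (@ge0_integral_distribution _ _ _ S R P Y' (fun x : S => `|x%:E|%E))//.
  by case/integrableP : iY.
by apply: measurableT_comp => //; exact: measurable_fun_EFin.
Qed.

Let imul : (distribution P W' \x distribution P Y')%E.-integrable setT mul_law.
Proof.
apply/integrable12ltyP => //.
under eq_integral => x _.
  under eq_integral => y _ do rewrite /mul_law/= normrM EFinM.
  rewrite ge0_integralZl//; last first.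
    by do 2 apply: measurableT_comp => //; exact: measurable_fun_EFin.
  over.
rewrite /= ge0_integralZr//; last 2 first.
- apply: measurable_fun_EFin.
  apply: (@measurableT_comp _ _ _ _ _ _ (@Num.norm _ R) _ id) => //; exact: normr_measurable.
- by apply: integral_ge0 => y _; rewrite lee_fin.
have /integrableP[_ h1] := iWlaw; have /integrableP[_ h2] := iYlaw.
apply: lte_mul_pinfty => //; first by apply: integral_ge0 => x _; rewrite lee_fin.
by rewrite ge0_fin_numE//; apply: integral_ge0 => x _; rewrite lee_fin.
Qed.

Lemma independent_integrableM : P.-integrable setT (fun w => (W w * Y w)%:E).
Proof.
apply/integrableP; split.
  by apply: measurable_fun_EFin; exact: measurable_funM.
have /integrableP[_] := imul; rewrite jointE.
rewrite (@ge0_integral_distribution _ _ _ (S * S)%type R P WY'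
  (fun z => `|mul_law z|%E))//.
by apply: measurableT_comp.
Qed.

Lemma independent_expectationM :
  \int[P]_w (W w * Y w) = \int[P]_w W w * \int[P]_w Y w.
Proof.
rewrite /Rintegral.
rewrite -(@integral_distribution _ _ _ (S * S)%type R P WY' mul_law mmul
  independent_integrableM).
rewrite -jointE -integral12_prod_meas1//= /fubini_F.
under eq_integral => x _.
  rewrite /mul_law/=; under eq_integral => y _ do rewrite EFinM.
  rewrite integralZl//; over.
rewrite /=.
have /fineK yf : (\int[distribution P Y']_y y%:E)%E \is a fin_num.
  exact: integrable_fin_num.
rewrite -yf integralZr// fineM//; last exact: integrable_fin_num.
have mE : measurable_fun [set: S] (EFin : S -> \bar R) by exact: measurable_fun_EFin.
congr (fine _ * _).
  by rewrite (@integral_distribution _ _ _ S R P W' (fun x : S => x%:E)).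
by rewrite (@integral_distribution _ _ _ S R P Y' (fun x : S => x%:E)).
Qed.

End independence.

Section augmented_filtration_independence.
Context d (Omega : measurableType d) (R : realType) (P : probability Omega R).
Context (E : finType) (B : R -> Omega -> R) (J : R -> Omega -> E).
Hypotheses (hB : brownian_motion P B) (hJ : jump_process J).
Hypothesis hBJ : independent_events P (sigma_process `[0, +oo[ B)
                                      (sigma_state `[0, +oo[ J).

Let preaug (s : R) := sigma_process `[0, s] B `|` sigma_state `[0, s] J
        `|` [set N | measurable N /\ P N = 0%E].

Lemma brownian_measurable (t : R) : 0 <= t -> measurable_fun setT (B t).
Proof. by case: hB => -[h _] _ _ _; exact: h. Qed.

Let incr_measurable (s t : R) : 0 <= s -> s <= t ->
  measurable_fun setT (fun w => B t w - B s w).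
Proof.
move=> s0 st; apply: measurable_funB; apply: brownian_measurable => //.
exact: le_trans st.
Qed.

Lemma sigma_process_measurable (D : set R) : D `<=` `[0, +oo[ ->
  sigma_process D B `<=` measurable.
Proof.
move=> D0; apply: smallest_sub; first exact: sigma_algebra_measurable.
move=> _ [t Dt [U mU ->]]; rewrite -[_ @^-1` _]setTI.
by apply: brownian_measurable => //; have /= := D0 t Dt; rewrite in_itv/= andbT.
Qed.

Lemma sigma_state_measurable (D : set R) : D `<=` `[0, +oo[ ->
  sigma_state D J `<=` measurable.
Proof.
move=> D0; apply: smallest_sub; first exact: sigma_algebra_measurable.
move=> _ [t Dt [i ->]]; case: hJ => h _ _; apply: h.
by have /= := D0 t Dt; rewrite in_itv/= andbT.
Qed.

Let sub0s (s : R) : [set` `[0, s]] `<=` [set` `[0, +oo[].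
Proof. by move=> x /=; rewrite !in_itv/= => /andP[-> _]. Qed.

Let sigma_process_mono (D D' : set R) : D `<=` D' ->
  sigma_process D B `<=` sigma_process D' B.
Proof.
move=> DD; apply: smallest_sub; first exact: smallest_sigma_algebra.
move=> A [t Dt h]; apply: sub_gen_smallest; exists t => //; exact: DD.
Qed.

Let sigma_state_mono (D D' : set R) : D `<=` D' ->
  sigma_state D J `<=` sigma_state D' J.
Proof.
move=> DD; apply: smallest_sub; first exact: smallest_sigma_algebra.
move=> A [t Dt h]; apply: sub_gen_smallest; exists t => //; exact: DD.
Qed.

Let incr_event (s t : R) (U : set R) : 0 <= s -> s <= t -> measurable U ->
  sigma_process `[0, +oo[ B ((fun w => B t w - B s w) @^-1` U).
Proof.
move=> s0 st mU.
pose G : set (set Omega) := [set A | exists2 t, `[0, +oo[%classic t & events_rv (B t) A].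
have mG r : 0 <= r -> measurable_fun [set: g_sigma_algebraType G] (B r).
  move=> r0 _ V mV; rewrite setTI; apply: sub_gen_smallest.
  exists r; first by rewrite /= in_itv/= r0.
  by exists V.
have : measurable_fun [set: g_sigma_algebraType G] (fun w => B t w - B s w).
  by apply: measurable_funB; apply: mG => //; exact: le_trans st.
by move=> /(_ measurableT U mU); rewrite setTI.
Qed.

(** Both sides are finite measures in [A], so it is enough to compare them on a generating family
    stable under intersection. On the intersection of an event of [B] up to [s] and an event of [J],
    independence of [J] from the whole path of [B] removes the second, and independence of
    increments the first. *)
Lemma independent_preaugmented (s t : R) A (U : set R) : 0 <= s -> s < t ->
  <<s preaug s >> A -> measurable U ->
  P (A `&` (fun w => B t w - B s w) @^-1` U)
    = (P A * P ((fun w => (B t w - B s w)%R) @^-1` U))%E.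
Proof.
move=> s0 st sA mU; set D := (fun w => B t w - B s w) @^-1` U.
have mD : measurable D.
  by rewrite -[D]setTI; apply: incr_measurable => //; exact: ltW.
(* The null events are adjoined to the family itself: intersections with them stay null, so
   stability under intersection is kept. *)
pose Pi : set (set Omega) := [set C | exists A1 A2, [/\ sigma_process `[0, s] B A1,
    sigma_state `[0, s] J A2 & C = A1 `&` A2]] `|` [set N | measurable N /\ P N = 0%E].
have mPi : Pi `<=` measurable.
  move=> C [[A1 [A2 [h1 h2 ->]]]|[]//]; apply: measurableI.
  - by apply: sigma_process_measurable h1; exact: sub0s.
  - by apply: sigma_state_measurable h2; exact: sub0s.
have sT1 : sigma_process `[0, s] B setT.
  exact: (@measurableT _ (g_sigma_algebraType
      [set A | exists2 t, `[0, s]%classic t & events_rv (B t) A])).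
have sT2 : sigma_state `[0, s] J setT.
  exact: (@measurableT _ (g_sigma_algebraType (events_state `[0, s] J))).
have PD : P D \is a fin_num by exact: fin_num_measure.
have PD0 : 0 <= fine (P D) by rewrite fine_ge0.
pose m2 : {measure set Omega -> \bar R} := mscale (NngNum PD0) P.
pose m1 : {measure set Omega -> \bar R} := mrestr P mD.
have -> : (P A * P D = m2 A)%E by rewrite /m2 /= /mscale/= muleC fineK.
rewrite -[LHS]/(m1 A).
have nullI C N : measurable C -> measurable N -> P N = 0%E -> P (C `&` N) = 0%E.
  move=> mC mN N0; apply/eqP; rewrite eq_le measure_ge0 andbT -N0.
  by rewrite le_measure ?inE//; exact: measurableI.
apply: (@g_sigma_algebra_measure_unique _ R Omega Pi mPi (fun=> setT)).
- by move=> _; left; exists setT, setT; rewrite setTI.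
- by rewrite bigcup_const.
- move=> C1 C2 /[dup] /mPi mC1 [[A1 [A2 [a1 a2 C1E]]]|[mN N0]]; last first.
    move=> /mPi mC2; right; split; first exact: measurableI.
    by rewrite setIC nullI.
  move=> /[dup] /mPi mC2 [[A1' [A2' [a1' a2' C2E]]]|[mN N0]]; last first.
    by right; split; [exact: measurableI|rewrite nullI].
  left; exists (A1 `&` A1'), (A2 `&` A2'); split.
  - exact: (@measurableI _ (g_sigma_algebraType
      [set A | exists2 t, `[0, s]%classic t & events_rv (B t) A])).
  - exact: (@measurableI _ (g_sigma_algebraType (events_state `[0, s] J))).
  - by rewrite C1E C2E setIACA.
- move=> C [[A1 [A2 [a1 a2 ->]]]|[mC C0]]; last first.
    rewrite /m1 /m2 /= /mrestr /mscale/= C0 mule0.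
    by rewrite setIC nullI.
  rewrite /m1 /m2 /= /mrestr /mscale/= fineK//.
  have b1 : sigma_process `[0, +oo[ B A1 by apply: sigma_process_mono a1; exact: sub0s.
  have b2 : sigma_state `[0, +oo[ J A2 by apply: sigma_state_mono a2; exact: sub0s.
  (* [A1] and [D] both belong to the path of [B], hence the event of [J] is set aside first. *)
  rewrite setIAC hBJ//; last first.
    apply: (@measurableI _ (g_sigma_algebraType
      [set A | exists2 t, `[0, +oo[%classic t & events_rv (B t) A])) => //.
    by apply: incr_event => //; exact: ltW.
  rewrite (hBJ b1 b2); case: hB => _ _ h _; rewrite (h s t s0 st A1 D a1); last by exists U.
  by rewrite [(P A1 * _)%E]muleC muleA.
- by move=> _; rewrite /m1/= /mrestr setTI -ge0_fin_numE.
- move: sA; apply: smallest_sub; first exact: smallest_sigma_algebra.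
  move=> C [[h|h]|h].
  + by apply: sub_gen_smallest; left; exists C, setT; rewrite setIT.
  + by apply: sub_gen_smallest; left; exists setT, C; rewrite setTI.
  + by apply: sub_gen_smallest; right.
Qed.

End augmented_filtration_independence.

Section filtered_brownian.
Context d (Omega : measurableType d) (R : realType) (P : probability Omega R).

(** The interface through which moments and Ito sums are estimated. How the filtration was augmented
    matters only for showing that it satisfies these clauses. *)
Record filtered_brownian (filt : R -> set (set Omega)) (B : R -> Omega -> R)
    : Prop := FilteredBrownian {
  fb_sigma : forall t, sigma_algebra setT (filt t);
  fb_measurable : forall t, filt t `<=` measurable;
  fb_mono : forall s t, s <= t -> filt s `<=` filt t;
  fb_adapted : forall t, 0 <= t -> measurable_wrt (filt t) (B t);
  fb_indep : forall (s t : R) A (U : set R), 0 <= s -> s < t ->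
    filt s A -> measurable U ->
    P (A `&` (fun w => B t w - B s w) @^-1` U)
      = (P A * P ((fun w => (B t w - B s w)%R) @^-1` U))%E;
  fb_law : forall (s t : R) (U : set R), 0 <= s -> s < t -> measurable U ->
    P [set w | U (B t w - B s w)] = normal_prob 0 (Num.sqrt (t - s)) U }.

Lemma measurable_wrtP (G : set (set Omega)) (Z : Omega -> R) :
  sigma_algebra setT G ->
  measurable_wrt G Z <-> measurable_fun [set: g_sigma_algebraType G] Z.
Proof.
move=> sG; split => [h _ U mU|h _ [U mU ->]].
  by rewrite setTI; apply: sub_gen_smallest; apply: h; exists U.
have := h measurableT U mU; rewrite setTI.
by rewrite /measurable/= sigma_algebra_id.
Qed.

Lemma measurable_wrtW (G : set (set Omega)) (Z : Omega -> R) :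
  G `<=` measurable -> measurable_wrt G Z -> measurable_fun setT Z.
Proof. by move=> Gm h _ U mU; rewrite setTI; apply/Gm/h; exists U. Qed.

Lemma normal_prob_set1 (s a : R) : normal_prob 0 s [set a] = 0%E :> \bar R.
Proof.
have /null_content_dominatesP := @normal_prob_dominates R 0 s.
by apply; [exact: measurable_set1|exact: lebesgue_measure_set1].
Qed.

(** The endpoints carry no mass in the limit law, so almost surely the indicators of []a, b]] are
    eventually constant, and dominated convergence applies. The event [A] is carried along because
    the limit is taken in a product formula. *)
Lemma cvg_prob_itv (Zn : nat -> Omega -> R) (Z : Omega -> R) (a b : R) A :
  (forall n, measurable_fun setT (Zn n)) -> measurable_fun setT Z ->
  measurable A ->
  (forall w, Zn n w @[n --> \oo] --> Z w) ->
  P (Z @^-1` [set a]) = 0%E -> P (Z @^-1` [set b]) = 0%E ->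
  P (A `&` Zn n @^-1` `]a, b]) @[n --> \oo] --> P (A `&` Z @^-1` `]a, b]).
Proof.
move=> mZn mZ mA ZnZ Za Zb.
have mC (Y : Omega -> R) : measurable_fun setT Y ->
    measurable (A `&` Y @^-1` `]a, b]).
  by move=> mY; apply: measurableI => //; rewrite -[_ @^-1` _]setTI; exact: mY.
have PE (Y : Omega -> R) : measurable_fun setT Y ->
    P (A `&` Y @^-1` `]a, b]) = (\int[P]_w (\1_(A `&` Y @^-1` `]a, b]) w)%:E)%E.
  by move=> mY; rewrite integral_indic ?setIT//; exact: mC.
rewrite PE//; under eq_fun do rewrite PE//.
have mZ1 c : measurable (Z @^-1` [set c]).
  by rewrite -[_ @^-1` _]setTI; exact: mZ.
have [] // := @dominated_convergence _ _ _ P setT measurableT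
  (fun n w => (\1_(A `&` Zn n @^-1` `]a, b]) w)%:E)
  (fun w => (\1_(A `&` Z @^-1` `]a, b]) w)%:E) (fun=> 1%E).
- by move=> n; apply: measurable_fun_EFin; apply: measurable_indic; exact: mC.
- by apply: measurable_fun_EFin; apply: measurable_indic; exact: mC.
- exists (Z @^-1` [set a] `|` Z @^-1` [set b]); split.
  + exact: measurableU.
  + apply/eqP; rewrite eq_le measure_ge0 andbT.
    have ab0 : (P (Z @^-1` [set a]) + P (Z @^-1` [set b]) <= 0)%E.
      by rewrite Za Zb adde0.
    exact: le_trans (@measureU2 _ _ _ P _ _ (mZ1 a) (mZ1 b)) ab0.
  move=> w /= h; apply: contrapT => /not_orP[/eqP za /eqP zb]; apply: h => _.
  apply: cvg_near_cst.
  have near_lt c : Z w != c -> \forall n \near \oo, (Zn n w < c) = (Z w < c).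
    move=> zc; have [lt|gt|/eqP] := ltgtP (Z w) c; last by rewrite (negbTE zc).
      by near=> n; near: n; exact: (cvgr_lt (Z w)).
    by near=> n; apply/negbTE; rewrite -leNgt ltW//; near: n; exact: (cvgr_gt (Z w)).
  have near_ne c : Z w != c -> \forall n \near \oo, Zn n w != c.
    move=> zc; have [lt|gt|/eqP] := ltgtP (Z w) c; last by rewrite (negbTE zc).
      by near=> n; apply/negbT/lt_eqF; near: n; exact: (cvgr_lt (Z w)).
    by near=> n; apply/negbT/gt_eqF; near: n; exact: (cvgr_gt (Z w)).
  near=> n; congr EFin; rewrite !indicE; congr (_%:R).
  have na : (Zn n w < a) = (Z w < a) by near: n; exact: near_lt.
  have nb : (Zn n w < b) = (Z w < b) by near: n; exact: near_lt.
  have nea : Zn n w != a by near: n; exact: near_ne.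
  have neb : Zn n w != b by near: n; exact: near_ne.
  have itv (z : R) : z != a -> z != b -> (z \in `]a, b]%classic) = ~~ (z < a) && (z < b).
    by move=> ea eb; rewrite mem_setE in_itv/= -leNgt lt_neqAle eq_sym ea/=
      (le_eqVlt z) (negbTE eb).
  rewrite !in_setI; congr (_ && _).
  rewrite -[LHS]/(Zn n w \in `]a, b]%classic) -[RHS]/(Z w \in `]a, b]%classic).
  by rewrite !itv// na nb.
- exact: finite_measure_integrable_cst.
- by apply: aeW => w n _; rewrite gee0_abs ?lee_fin// indicE lern1 leq_b1.
Unshelve. all: by end_near. Qed.

End filtered_brownian.

Section augmented_filtration_brownian.
Context d (Omega : measurableType d) (R : realType) (P : probability Omega R).
Context (E : finType) (B : R -> Omega -> R) (J : R -> Omega -> E).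
Hypotheses (hB : brownian_motion P B) (hJ : jump_process J).
Hypothesis hBJ : independent_events P (sigma_process `[0, +oo[ B)
                                      (sigma_state `[0, +oo[ J).
Let filt := augmented_filtration P B J.
Let gen (s : R) := sigma_process `[0, s] B `|` sigma_state `[0, s] J
        `|` [set N | measurable N /\ P N = 0%E].

Let sub0s (s : R) : [set` `[0, s]] `<=` [set` `[0, +oo[].
Proof. by move=> x /=; rewrite !in_itv/= => /andP[-> _]. Qed.

Let gen_measurable s : <<s gen s >> `<=` measurable.
Proof.
apply: smallest_sub; first exact: sigma_algebra_measurable.
move=> C [[h|h]|[]//].
- by apply: (sigma_process_measurable hB) h; exact: sub0s.
- by apply: (sigma_state_measurable hJ) h; exact: sub0s.
Qed.

Lemma augmented_brownian_measurable_at t : 0 <= t ->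
  measurable_wrt (filt t) (B t).
Proof.
move=> t0 A hA s /= ts; apply: sub_gen_smallest; left; left.
apply: sub_gen_smallest; exists t => //.
by rewrite /= in_itv/= t0 ltW.
Qed.

Lemma augmented_state_measurable t i : 0 <= t -> filt t (J t @^-1` [set i]).
Proof.
move=> t0 s /= ts; apply: sub_gen_smallest; left; right.
apply: sub_gen_smallest; exists t; last by exists i.
by rewrite /= in_itv/= t0 ltW.
Qed.

Let incr_measurable (s t : R) : 0 <= s -> s <= t ->
  measurable_fun setT (fun w => B t w - B s w).
Proof.
move=> s0 st; apply: measurable_funB; apply: (brownian_measurable hB) => //.
exact: le_trans st.
Qed.

(** Only independence is delicate. An event of the right-continuous filtration at [s] lies in the
    unregularized one at each later time [u], so it is independent of [B t - B u], and [u] tends to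
    [s] along continuous paths. *)
Lemma augmented_filtered_brownian : filtered_brownian P filt B.
Proof.
have mfilt t : filt t `<=` measurable.
  by move=> A /(_ (t + 1)) h; apply: gen_measurable; apply: h; rewrite /= ltrDl.
split => //.
- move=> t; split.
  + by move=> s _; exact: (@measurable0 _ (g_sigma_algebraType (gen s))).
  + move=> A fA s ts; exact: (@measurableD _ (g_sigma_algebraType (gen s))
      setT A measurableT (fA s ts)).
  + move=> A fA s ts; exact: (@bigcupT_measurable _ (g_sigma_algebraType (gen s))
      A (fun n => fA n s ts)).
- by move=> s t st A fA u tu; apply: fA; exact: le_lt_trans st tu.
- exact: augmented_brownian_measurable_at.
- move=> s t A U s0 st fA mU.
  pose u n : R := s + (t - s) / 2 * harmonic n.
  have ts0 : 0 < t - s by rewrite subr_gt0.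
  have su n : s < u n by rewrite ltrDl mulr_gt0 ?divr_gt0// harmonic_gt0.
  have ut n : u n < t.
    have h1 : harmonic n <= 1 :> R by rewrite invf_le1// ler1n.
    have h0 := @harmonic_gt0 R n.
    by rewrite -ltrBrDl; nra.
  have u0 n : 0 <= u n by rewrite (le_trans s0)// ltW.
  have us : u n @[n --> \oo] --> s.
    rewrite -[X in _ --> X]addr0; apply: cvgD; first exact: cvg_cst.
    rewrite -(mulr0 ((t - s) / 2)); apply: cvgM; first exact: cvg_cst.
    exact: cvg_harmonic.
  pose Z w := B t w - B s w; pose Zn n w := B t w - B (u n) w.
  have mZ : measurable_fun setT Z by apply: incr_measurable => //; exact: ltW.
  have mZn n : measurable_fun setT (Zn n) by apply: incr_measurable => //; exact: ltW.
  have mA : measurable A by exact: mfilt fA.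
  have ZnZ w : Zn n w @[n --> \oo] --> Z w.
    apply: cvgB; first exact: cvg_cst.
    apply: (@continuous_path_seq _ (B ^~ w)) => //.
    by case: hB => -[_ h] _ _ _; exact: h.
  have Z1 a : P (Z @^-1` [set a]) = 0%E.
    case: hB => _ _ _ h; rewrite -(normal_prob_set1 (Num.sqrt (t - s)) a).
    by rewrite -(h s t s0 st _ (measurable_set1 a)).
  (* The limit is taken on intervals only, the law of the increment having no atom; half-open
     intervals then determine the measures. *)
  have itvE a b : P (A `&` Z @^-1` `]a, b]) = (P A * P (Z @^-1` `]a, b]))%E.
    have c1 := cvg_prob_itv mZn mZ mA ZnZ (Z1 a) (Z1 b).
    have c2 := cvg_prob_itv mZn mZ measurableT ZnZ (Z1 a) (Z1 b).
    have PA : P A \is a fin_num by exact: fin_num_measure.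
    have c3 := cvgeZl PA c2.
    rewrite setTI in c3.
    apply: (cvg_unique _ c1); last first.
      apply: cvg_trans c3; apply: near_eq_cvg; near=> n.
      rewrite setTI (independent_preaugmented hB hJ hBJ (u0 n) (ut n))//.
      exact: (fA (u n) (su n)).
    exact: ereal_hausdorff.
  have mYI := @isMeasurableFun.Build _ _ Omega (measurableTypeR R) Z mZ.
  pose Z' : {mfun Omega >-> measurableTypeR R} := HB.pack Z mYI.
  pose PA : {nonneg R} := NngNum (fine_ge0 (measure_ge0 P A)).
  pose m2 : {measure set (measurableTypeR R) -> \bar R} :=
    mscale PA (distribution P Z').
  pose m1 : {measure set (measurableTypeR R) -> \bar R} :=
    pushforward (mrestr P mA) Z'.
  have {}mZ' : measurable_fun setT Z' by exact: mZ.
  have m1E V : m1 mZ' V = P (A `&` Z @^-1` V).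
    by rewrite /m1/= /pushforward /mrestr setIC.
  have m2E V : m2 V = (P A * P (Z @^-1` V))%E.
    by rewrite /m2/= /mscale/= fineK// fin_num_measure.
  rewrite -[LHS]m1E -[RHS]m2E.
  apply: (@measure_unique _ R (measurableTypeR R) (@ocitv R)
    (fun n => `](- n%:R), n%:R]%classic) _ _ _ _ (m1 mZ') m2) => //; try exact: ocitvI.
  + by move=> n; exact: is_ocitv.
  + exact: bigcup_itvT.
  + by move=> V [[a b]] _ <-; rewrite m1E m2E itvE.
  + move=> n; rewrite m1E -ge0_fin_numE//.
    by apply: fin_num_measure; apply: measurableI => //; rewrite -[_ @^-1` _]setTI; exact: mZ.
- by move=> s t U s0 st mU; case: hB => _ _ _; apply.
Unshelve. all: by end_near. Qed.

End augmented_filtration_brownian.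

(** * Second moments of step integrals *)

Section finite_sums.
Context d (T : measurableType d) (R : realType) (P : {measure set T -> \bar R}).

Lemma integrable_finsum (I : finType) (F : I -> T -> R) :
  (forall i, P.-integrable setT (EFin \o F i)) ->
  P.-integrable setT (EFin \o (fun w => \sum_i F i w)).
Proof.
move=> h; rewrite (_ : _ \o _ = (fun w => \sum_i (F i w)%:E)%E); last first.
  by apply/funext => w /=; rewrite sumEFin.
by apply: integrable_sum => // i _; exact: h.
Qed.

Lemma Rintegral_finsum (I : finType) (F : I -> T -> R) :
  (forall i, P.-integrable setT (EFin \o F i)) ->
  \int[P]_w (\sum_i F i w) = \sum_i \int[P]_w F i w.
Proof.
move=> h; rewrite /Rintegral; under eq_integral do rewrite -sumEFin.
rewrite integral_sum//.
rewrite -[LHS]sum_fine// => i _; exact: integrable_fin_num (h i).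
Qed.

Lemma integrable_realD (f g : T -> R) :
  P.-integrable setT (EFin \o f) -> P.-integrable setT (EFin \o g) ->
  P.-integrable setT (EFin \o (fun w => f w + g w)).
Proof. by move=> fi gi; exact: (integrableD _ fi gi). Qed.

Lemma integrable_realZl (k : R) (f : T -> R) :
  P.-integrable setT (EFin \o f) -> P.-integrable setT (EFin \o (fun w => k * f w)).
Proof.
move=> fi; rewrite (_ : _ \o _ = (fun w => k%:E * (f w)%:E)%E)//.
exact: integrableZl.
Qed.

Lemma integrableMbounded (W Y : T -> R) (M : R) : measurable_fun setT W ->
  (forall w, `|W w| <= M) -> P.-integrable setT (EFin \o Y) ->
  P.-integrable setT (EFin \o (fun w => W w * Y w)).
Proof.
move=> mW WM iY; have /integrableP[/measurable_EFinP mY _] := iY.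
apply: (@le_integrable _ _ _ _ _ _ _ (EFin \o (fun w => M * Y w))) => //.
- by apply: measurable_fun_EFin; exact: measurable_funM.
- move=> w _ /=; rewrite lee_fin !normrM ler_wpM2r//.
  exact: le_trans (ler_norm _).
- exact: integrable_realZl.
Qed.

End finite_sums.

Section brownian_expectations.
Context d (Omega : measurableType d) (R : realType) (P : probability Omega R).
Context (filt : R -> set (set Omega)) (B : R -> Omega -> R).
Hypothesis hfb : filtered_brownian P filt B.
Implicit Types (s t u a b c : R) (W : Omega -> R).

Let fm t := @fb_measurable _ _ _ _ _ _ hfb t.

Lemma fb_measurable_at t : 0 <= t -> measurable_fun setT (B t).
Proof. by move=> t0; apply: (measurable_wrtW (@fm t)); exact: (fb_adapted hfb). Qed.

Lemma measurable_wrt_mono s t W : s <= t ->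
  measurable_wrt (filt s) W -> measurable_wrt (filt t) W.
Proof. by move=> st h A /h; exact: (fb_mono hfb). Qed.

Lemma fb_incr_measurable s t : 0 <= s -> s <= t ->
  measurable_fun setT (fun w => B t w - B s w).
Proof.
move=> s0 st; apply: measurable_funB; apply: fb_measurable_at => //.
exact: le_trans st.
Qed.

Lemma fb_incr_wrt s t u : 0 <= s -> s <= t -> t <= u ->
  measurable_wrt (filt u) (fun w => B t w - B s w).
Proof.
move=> s0 st tu; have t0 := le_trans s0 st.
apply/(measurable_wrtP _ (fb_sigma hfb u)); apply: measurable_funB.
- apply/(measurable_wrtP _ (fb_sigma hfb u)).
  exact: (measurable_wrt_mono tu (fb_adapted hfb t0)).
- apply/(measurable_wrtP _ (fb_sigma hfb u)).
  exact: (measurable_wrt_mono (le_trans st tu) (fb_adapted hfb s0)).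
Qed.

Lemma measurable_wrtM u W W' : measurable_wrt (filt u) W ->
  measurable_wrt (filt u) W' -> measurable_wrt (filt u) (fun w => W w * W' w).
Proof.
move=> h h'; apply/(measurable_wrtP _ (fb_sigma hfb u)); apply: measurable_funM;
exact/(measurable_wrtP _ (fb_sigma hfb u)).
Qed.

Let sqrt_gt0 s t : s < t -> 0 < Num.sqrt (t - s).
Proof. by move=> st; rewrite sqrtr_gt0 subr_gt0. Qed.

Let sqrt_sqr s t : s < t -> Num.sqrt (t - s) ^+ 2 = t - s.
Proof. by move=> st; rewrite sqr_sqrtr// subr_ge0 ltW. Qed.

Lemma fb_incr_square s t : 0 <= s -> s <= t ->
  (\int[P]_w ((B t w - B s w) ^+ 2)%:E = (t - s)%:E)%E.
Proof.
move=> s0; rewrite le_eqVlt => /predU1P[<-|st].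
  by under eq_integral do rewrite subrr expr0n/=; rewrite integral0 subrr.
rewrite (@normal_law_square _ _ _ _ (fun w => B t w - B s w) _ _ (sqrt_gt0 st)).
- by rewrite sqrt_sqr.
- by apply: fb_incr_measurable => //; exact: ltW.
- by move=> U mU; exact: (fb_law hfb).
Qed.

Lemma fb_incr_4th s t : 0 <= s -> s <= t ->
  (\int[P]_w ((B t w - B s w) ^+ 4)%:E <= (64 * (t - s) ^+ 2)%:E)%E.
Proof.
move=> s0; rewrite le_eqVlt => /predU1P[<-|st].
  by under eq_integral do rewrite subrr expr0n/=; rewrite integral0 subrr expr0n/= mulr0.
have := @normal_law_4th _ _ _ P (fun w => B t w - B s w) _
  (@fb_incr_measurable _ _ s0 (ltW st)) (sqrt_gt0 st).
rewrite (exprM _ 2 2) sqrt_sqr//; apply.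
by move=> U mU; exact: (fb_law hfb).
Qed.

Lemma fb_incr_integrable s t : 0 <= s -> s <= t ->
  P.-integrable setT (EFin \o (fun w => B t w - B s w)).
Proof.
move=> s0; rewrite le_eqVlt => /predU1P[<-|st].
  by under eq_fun do rewrite subrr; exact: finite_measure_integrable_cst.
apply: (@normal_law_integrable _ _ _ _ (fun w => B t w - B s w) _ _ (sqrt_gt0 st)).
- by apply: fb_incr_measurable => //; exact: ltW.
- by move=> U mU; exact: (fb_law hfb).
Qed.

Lemma fb_incr_integrable_square s t : 0 <= s -> s <= t ->
  P.-integrable setT (EFin \o (fun w => (B t w - B s w) ^+ 2)).
Proof.
move=> s0 st; apply/integrableP; split.
  by apply: measurable_fun_EFin; apply: measurable_funX; exact: fb_incr_measurable.
under eq_integral do rewrite /= ger0_norm ?sqr_ge0//.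
by rewrite fb_incr_square// ltry.
Qed.

Lemma fb_incr_mean s t : 0 <= s -> s <= t -> \int[P]_w (B t w - B s w) = 0.
Proof.
move=> s0; rewrite le_eqVlt => /predU1P[<-|st].
  by under eq_Rintegral do rewrite subrr; rewrite /Rintegral integral0.
apply: (@normal_law_mean _ _ _ _ (fun w => B t w - B s w) _ _ (sqrt_gt0 st)).
- by apply: fb_incr_measurable => //; exact: ltW.
- by move=> U mU; exact: (fb_law hfb).
Qed.

Let indep s t W (g : R -> R) : 0 <= s -> s < t -> measurable_wrt (filt s) W ->
  measurable_fun setT g -> forall U V : set R, measurable U -> measurable V ->
  P (W @^-1` U `&` (fun w => g (B t w - B s w)) @^-1` V)
    = (P (W @^-1` U) * P ((fun w => g (B t w - B s w)%R) @^-1` V))%E.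
Proof.
move=> s0 st sW mg U V mU mV.
apply: (fb_indep hfb (A := W @^-1` U) (U := g @^-1` V)) => //.
  by apply: sW; exists U.
by rewrite -[_ @^-1` _]setTI; exact: mg.
Qed.

Lemma fb_mul_incr s t W : 0 <= s -> s <= t -> measurable_wrt (filt s) W ->
  P.-integrable setT (EFin \o W) ->
  P.-integrable setT (EFin \o (fun w => W w * (B t w - B s w))) /\
  \int[P]_w (W w * (B t w - B s w)) = 0.
Proof.
move=> s0; rewrite le_eqVlt => /predU1P[<- sW iW|st sW iW].
  split; last by under eq_Rintegral do rewrite subrr mulr0; rewrite /Rintegral integral0.
  by under eq_fun do rewrite subrr mulr0; exact: finite_measure_integrable_cst.
have mW := measurable_wrtW (@fm s) sW.
have mD := fb_incr_measurable s0 (ltW st).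
have ind := indep s0 st sW (@measurable_id _ _ setT).
have iD := fb_incr_integrable s0 (ltW st).
split; first exact: (independent_integrableM mW mD ind iW iD).
by rewrite (independent_expectationM mW mD ind iW iD) fb_incr_mean ?mulr0// ltW.
Qed.

Lemma fb_mul_incr_square s t W : 0 <= s -> s <= t -> measurable_wrt (filt s) W ->
  P.-integrable setT (EFin \o W) ->
  P.-integrable setT (EFin \o (fun w => W w * (B t w - B s w) ^+ 2)) /\
  \int[P]_w (W w * (B t w - B s w) ^+ 2) = (\int[P]_w W w) * (t - s).
Proof.
move=> s0; rewrite le_eqVlt => /predU1P[<- sW iW|st sW iW].
  split; last first.
    under eq_Rintegral do rewrite subrr expr0n mulr0.
    by rewrite /Rintegral integral0 subrr mulr0.
  by under eq_fun do rewrite subrr expr0n mulr0; exact: finite_measure_integrable_cst.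
have mW := measurable_wrtW (@fm s) sW.
have mX : measurable_fun [set: R] (fun x : R => x ^+ 2) by exact: measurable_funX.
have mD : measurable_fun setT (fun w => (B t w - B s w) ^+ 2).
  by apply: measurable_funX; apply: fb_incr_measurable => //; exact: ltW.
have ind := indep s0 st sW mX.
have iD := fb_incr_integrable_square s0 (ltW st).
split; first exact: (independent_integrableM mW mD ind iW iD).
rewrite (independent_expectationM mW mD ind iW iD); congr *%R.
by rewrite /Rintegral fb_incr_square// ltW.
Qed.

Lemma bounded_integrable W (M : R) : measurable_fun setT W ->
  (forall w, `|W w| <= M) -> P.-integrable setT (EFin \o W).
Proof.
move=> mW WM; rewrite (_ : W = fun w => W w * 1); last by under eq_fun do rewrite mulr1.
by apply: (integrableMbounded mW WM); exact: finite_measure_integrable_cst.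
Qed.

(** With [a <= b], the second increment is the first one plus an increment after [a], which is
    centred given the past; what is left is a square. *)
Lemma fb_bilinear c a b W (M : R) : 0 <= c -> c <= a -> c <= b ->
  measurable_wrt (filt c) W -> (forall w, `|W w| <= M) ->
  P.-integrable setT (EFin \o (fun w => W w * (B a w - B c w) * (B b w - B c w))) /\
  \int[P]_w (W w * (B a w - B c w) * (B b w - B c w))
    = (\int[P]_w W w) * (Num.min a b - c).
Proof.
move=> c0 + + sW WM; wlog ab : a b / a <= b => [hwlog|ca cb].
  have /orP[ab|ba] := le_total a b; first exact: hwlog.
  move=> ca cb; have := hwlog b a ba cb ca; rewrite minC.
  by under eq_fun do rewrite mulrAC; under eq_Rintegral do rewrite mulrAC.
have mW := measurable_wrtW (@fm c) sW.
have iW := bounded_integrable mW WM.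
have [i2 e2] := fb_mul_incr_square c0 ca sW iW.
have iWD : P.-integrable setT (EFin \o (fun w => W w * (B a w - B c w))).
  by apply: (integrableMbounded mW WM); exact: fb_incr_integrable.
have sWD : measurable_wrt (filt a) (fun w => W w * (B a w - B c w)).
  apply: measurable_wrtM; first exact: (measurable_wrt_mono ca).
  exact: fb_incr_wrt.
have [i1 e1] := fb_mul_incr (le_trans c0 ca) ab sWD iWD.
have -> : (fun w => W w * (B a w - B c w) * (B b w - B c w)) = (fun w =>
    W w * (B a w - B c w) ^+ 2 + W w * (B a w - B c w) * (B b w - B a w)).
  by apply/funext => w; ring.
split; first exact: integrable_realD.
by rewrite RintegralD// e1 e2 addr0 min_l.
Qed.

(** Length of the intersection of []u, v]] and []u', v']]; the outer maximum gives [0] when they are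
    disjoint. *)
Definition overlap (u v u' v' : R) : R :=
  Num.max 0 (Num.min v v' - Num.max u u').

Lemma overlapC u v u' v' : overlap u v u' v' = overlap u' v' u v.
Proof. by rewrite /overlap minC (maxC u). Qed.

(** The interval that starts first is split at [u'], the start of the other. The piece before [u']
    is known at [u'] and multiplies a centred increment; the piece after it falls under
    [fb_bilinear]. *)
Lemma fb_covariance (u v u' v' : R) W W' (M M' : R) :
  0 <= u -> u <= v -> 0 <= u' -> u' <= v' ->
  measurable_wrt (filt u) W -> (forall w, `|W w| <= M) ->
  measurable_wrt (filt u') W' -> (forall w, `|W' w| <= M') ->
  P.-integrable setT (EFin \o (fun w =>
    W w * (B v w - B u w) * (W' w * (B v' w - B u' w)))) /\
  \int[P]_w (W w * (B v w - B u w) * (W' w * (B v' w - B u' w)))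
    = (\int[P]_w (W w * W' w)) * overlap u v u' v'.
Proof.
wlog uu' : u v u' v' W W' M M' / u <= u' => [hwlog|].
  have [uu|/ltW uu] := leP u u'; first exact: hwlog.
  move=> u0 uv u'0 u'v' sW WM sW' W'M.
  have := hwlog u' v' u v W' W M' M uu u'0 u'v' u0 uv sW' W'M sW WM.
  rewrite overlapC.
  have -> : (fun w => W' w * W w) = (fun w => W w * W' w).
    by apply/funext => w; rewrite mulrC.
  have -> // : (fun w => W' w * (B v' w - B u' w) * (W w * (B v w - B u w))) =
    (fun w => W w * (B v w - B u w) * (W' w * (B v' w - B u' w))).
  by apply/funext => w; rewrite mulrC.
move=> u0 uv u'0 u'v' sW WM sW' W'M.
pose WW w := W w * W' w.
have sWW : measurable_wrt (filt u') WW.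
  by apply: measurable_wrtM => //; exact: (measurable_wrt_mono uu').
have WWM w : `|WW w| <= M * M' by rewrite normrM ler_pM.
have mWW := measurable_wrtW (@fm u') sWW.
have um : u <= Num.min v u' by rewrite le_min uv.
have mu' : Num.min v u' <= u' by rewrite ge_min lexx orbT.
have sL : measurable_wrt (filt u') (fun w => WW w * (B (Num.min v u') w - B u w)).
  by apply: measurable_wrtM => //; exact: fb_incr_wrt.
have iL : P.-integrable setT (EFin \o (fun w => WW w * (B (Num.min v u') w - B u w))).
  by apply: (integrableMbounded mWW WWM); exact: fb_incr_integrable.
have [i1 e1] := fb_mul_incr u'0 u'v' sL iL.
have uM : u' <= Num.max v u' by rewrite le_max lexx orbT.
have [i2 e2] := fb_bilinear u'0 uM u'v' sWW WWM.
have -> : (fun w => W w * (B v w - B u w) * (W' w * (B v' w - B u' w))) =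
    (fun w => WW w * (B (Num.max v u') w - B u' w) * (B v' w - B u' w) +
    WW w * (B (Num.min v u') w - B u w) * (B v' w - B u' w)).
  by apply/funext => w; rewrite /WW; have [h|h] := leP v u'; ring.
split; first exact: integrable_realD.
rewrite RintegralD// e1 e2 addr0; congr *%R.
rewrite /overlap (max_r uu').
have [h|h] := leP v u'.
  by rewrite (min_l u'v') subrr max_l// subr_le0 ge_min h.
by rewrite max_r// subr_ge0 le_min u'v' ltW.
Qed.

End brownian_expectations.

(** * Step integrands on overlapping intervals and the Ito isometry *)

Section step_functions.
Context {R : realType} (I : finType).
Variables (lo hi c : I -> R).
Local Notation mu := (@lebesgue_measure R).

Let indicM i j s : \1_(`]lo i, hi i]%classic : set R) s * \1_(`]lo j, hi j]%classic : set R) s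
  = \1_(`]Num.max (lo i) (lo j), Num.min (hi i) (hi j)]%classic : set R) s :> R.
Proof.
rewrite !indicE -natrM mulnb !mem_setE !in_itv/= gt_max le_min.
by rewrite andbACA.
Qed.

Let integrable_indic_oc (a b k : R) :
  mu.-integrable setT (EFin \o (fun s => k * \1_(`]a, b]%classic : set R) s)).
Proof.
rewrite (_ : _ \o _ = (fun s => k%:E * (\1_(`]a, b]%classic : set R) s)%:E)%E)//.
apply: integrableZl => //; apply/integrableP; split.
  by apply: measurable_fun_EFin; exact: measurable_indic.
under eq_integral do rewrite gee0_abs ?lee_fin//.
rewrite integral_indic//= setIT lebesgue_measure_itv/=.
by case: ifP => _; rewrite ?ltry// -EFinB ltry.
Qed.

Let Rintegral_indic_oc (a b k : R) :
  \int[mu]_s (k * \1_(`]a, b]%classic : set R) s) = k * Num.max 0 (b - a).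
Proof.
rewrite RintegralZl//; last first.
  rewrite (_ : \1_ _ = (fun s => 1 * \1_(`]a, b]%classic : set R) s)).
    exact: integrable_indic_oc.
  by apply/funext => s; rewrite mul1r.
congr *%R; rewrite /Rintegral integral_indic//= setIT lebesgue_measure_itv/= lte_fin.
by case: (ltP a b) => ab /=; [rewrite max_r// subr_ge0 ltW|rewrite max_l// subr_le0].
Qed.

(** The intervals need not be disjoint, hence the double sum: a product of two indicators is the
    indicator of the intersection, whose length is [overlap]. *)
Lemma integral_step_square :
  (\int[mu]_s ((\sum_i c i * \1_(`]lo i, hi i]%classic : set R) s) ^+ 2)%:E
   = (\sum_i \sum_j c i * c j * overlap (lo i) (hi i) (lo j) (hi j))%:E)%E.
Proof.
have E : (fun s => (\sum_i c i * \1_(`]lo i, hi i]%classic : set R) s) ^+ 2) =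
  (fun s => \sum_i \sum_j c i * c j *
     \1_(`]Num.max (lo i) (lo j), Num.min (hi i) (hi j)]%classic : set R) s).
  apply/funext => s; rewrite expr2 big_distrlr; apply: eq_bigr => i _ /=.
  by apply: eq_bigr => j _; rewrite mulrACA indicM.
have i1 i : mu.-integrable setT (EFin \o (fun s => \sum_j c i * c j *
     \1_(`]Num.max (lo i) (lo j), Num.min (hi i) (hi j)]%classic : set R) s)).
  by apply: integrable_finsum => j; exact: integrable_indic_oc.
have i2 := integrable_finsum i1.
transitivity ((\int[mu]_s ((\sum_i c i * \1_(`]lo i, hi i]%classic : set R) s) ^+ 2))%:E)%R.
  have i3 := i2; rewrite -E in i3.
  by rewrite /Rintegral fineK//; exact: integrable_fin_num i3.
rewrite E Rintegral_finsum//; congr EFin; apply: eq_bigr => i _.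
rewrite Rintegral_finsum; last by move=> j; exact: integrable_indic_oc.
by apply: eq_bigr => j _; rewrite Rintegral_indic_oc.
Qed.

End step_functions.

Section isometry.
Context d (Omega : measurableType d) (R : realType) (P : probability Omega R).
Context (filt : R -> set (set Omega)) (B : R -> Omega -> R).
Hypothesis hfb : filtered_brownian P filt B.
Local Notation mu := (@lebesgue_measure R).

(** Both sides expand into the same double sum of mean products of coefficients weighted by
    [overlap]. Overlapping intervals and an arbitrary finite index type are allowed, so that
    differences of step integrands on different partitions need no common refinement. *)
Lemma ito_isometry (I : finType) (lo hi M : I -> R) (xi : I -> Omega -> R) :
  (forall i, 0 <= lo i) -> (forall i, lo i <= hi i) ->
  (forall i, measurable_wrt (filt (lo i)) (xi i)) ->
  (forall i w, `|xi i w| <= M i) ->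
  (\int[P]_w ((\sum_i xi i w * (B (hi i) w - B (lo i) w)) ^+ 2)%:E
  = \int[P]_w \int[mu]_s
      ((\sum_i xi i w * \1_(`]lo i, hi i]%classic : set R) s) ^+ 2)%:E)%E.
Proof.
move=> lo0 lohi sxi xiM.
under [RHS]eq_integral do rewrite integral_step_square.
have cov i j := fb_covariance hfb (lo0 i) (lohi i) (lo0 j) (lohi j)
  (sxi i) (xiM i) (sxi j) (xiM j).
have mxi i := measurable_wrtW (@fb_measurable _ _ _ _ _ _ hfb (lo i)) (sxi i).
have -> : (fun w => ((\sum_i xi i w * (B (hi i) w - B (lo i) w)) ^+ 2)%:E) =
    (EFin \o (fun w => \sum_i \sum_j xi i w * (B (hi i) w - B (lo i) w) *
        (xi j w * (B (hi j) w - B (lo j) w)))).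
  by apply/funext => w /=; rewrite expr2 big_distrlr.
have ixx i j : P.-integrable setT (EFin \o (fun w => xi i w * xi j w)).
  apply: (integrableMbounded (mxi i) (xiM i)).
  exact: (bounded_integrable P (mxi j) (xiM j)).
have ixo i j : P.-integrable setT (EFin \o (fun w => xi i w * xi j w *
      overlap (lo i) (hi i) (lo j) (hi j))).
  under eq_fun do rewrite mulrC.
  exact: integrable_realZl.
have j1 i := integrable_finsum (fun j => (cov i j).1).
have j2 := integrable_finsum j1.
have k1 i := integrable_finsum (ixo i).
have k2 := integrable_finsum k1.
rewrite -[LHS]fineK; last exact: integrable_fin_num.
rewrite -[RHS]fineK; last exact: integrable_fin_num k2.
congr EFin; rewrite -[LHS]/(Rintegral _ _ _) -[RHS]/(Rintegral _ _ _).
rewrite Rintegral_finsum// Rintegral_finsum//; apply: eq_bigr => i _.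
rewrite Rintegral_finsum; last by move=> j; exact: (cov i j).1.
rewrite Rintegral_finsum//; apply: eq_bigr => j _.
by rewrite (cov i j).2 RintegralZr.
Qed.

(** The summands are orthogonal: given the past, each squared increment has the length of its
    interval as its mean, so the cross terms vanish in the induction on [n]. *)
Lemma quadratic_variation_L2 (tau : nat -> R) (c : nat -> Omega -> R) (M : R) n :
  0 <= tau 0%N -> (forall k, tau k <= tau k.+1) ->
  (forall k, measurable_wrt (filt (tau k)) (c k)) ->
  (forall k w, `|c k w| <= M) ->
  (\int[P]_w ((\sum_(k < n) c k w * ((B (tau k.+1) w - B (tau k) w) ^+ 2
        - (tau k.+1 - tau k))) ^+ 2)%:E
   <= (\sum_(k < n) (130 * M ^+ 2 * (tau k.+1 - tau k) ^+ 2))%:E)%E.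
Proof.
move=> tau0 taui sc cM.
have tk k : 0 <= tau k.
  by elim: k => [//|k IH]; exact: le_trans (taui k).
pose Q k w := (B (tau k.+1) w - B (tau k) w) ^+ 2 - (tau k.+1 - tau k).
pose S n w := \sum_(k < n) c k w * Q k w.
have mc k := measurable_wrtW (@fb_measurable _ _ _ _ _ _ hfb (tau k)) (sc k).
have sQ k : measurable_wrt (filt (tau k.+1)) (Q k).
  apply/(measurable_wrtP _ (fb_sigma hfb _)); apply: measurable_funB => //.
  apply: measurable_funX; apply/(measurable_wrtP _ (fb_sigma hfb _)).
  exact: (fb_incr_wrt hfb).
have mQ k := measurable_wrtW (@fb_measurable _ _ _ _ _ _ hfb (tau k.+1)) (sQ k).
have icst (r : R) : P.-integrable setT (EFin \o cst r).
  exact: finite_measure_integrable_cst.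
(* A probability space is nonempty, so [M] bounds at least one absolute value. *)
have M0 : 0 <= M.
  have [w _] : [set: Omega] !=set0.
    apply/set0P/eqP => O0; have := probability_setT P.
    by rewrite O0 measure0 => /esym/eqP; rewrite eqe oner_eq0.
  exact: le_trans (cM 0%N w).
(* [130 = 2 * 64 + 2]: from [(x - y) ^+ 2 <= 2 * (x ^+ 2 + y ^+ 2)], with the fourth moment bound
   for [x] and a deterministic [y]. *)
have Q2 k : (\int[P]_w ((c k w * Q k w) ^+ 2)%:E
    <= (130 * M ^+ 2 * (tau k.+1 - tau k) ^+ 2)%:E)%E.
  apply: (@le_trans _ _ (\int[P]_w (2 * M ^+ 2 * (B (tau k.+1) w - B (tau k) w) ^+ 4
      + 2 * M ^+ 2 * (tau k.+1 - tau k) ^+ 2)%:E)%E).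
    apply: ge0_le_int.
    - by apply: measurable_funX; exact: measurable_funM.
    - apply: measurable_funD => //; apply: measurable_funM => //.
      by apply: measurable_funX; exact: (fb_incr_measurable hfb).
    - by move=> w; rewrite sqr_ge0.
    - move=> w; rewrite exprMn.
      pose x := (B (tau k.+1) w - B (tau k) w) ^+ 2; pose y := tau k.+1 - tau k.
      have h1 : c k w ^+ 2 <= M ^+ 2.
        by rewrite -(real_normK (num_real (c k w))) ler_sqr ?nnegrE.
      have h2 : (x - y) ^+ 2 <= 2 * (x ^+ 2 + y ^+ 2).
        by have : 0 <= (x + y) ^+ 2 := sqr_ge0 _; nra.
      rewrite [leRHS](_ : _ = M ^+ 2 * (2 * (x ^+ 2 + y ^+ 2))).
        by apply: ler_pM => //; rewrite sqr_ge0.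
      by rewrite /x /y; ring.
  have M20 : 0 <= 2 * M ^+ 2 by rewrite mulr_ge0// sqr_ge0.
  rewrite ge0_intD//.
  - rewrite ge0_intZl//.
    + rewrite prob_int_cst.
      apply: (@le_trans _ _ ((2 * M ^+ 2)%:E * (64 * (tau k.+1 - tau k) ^+ 2)%:E
        + (2 * M ^+ 2 * (tau k.+1 - tau k) ^+ 2)%:E)%E).
        apply: leeD2r; apply: lee_wpmul2l; first by rewrite lee_fin.
        exact: (fb_incr_4th hfb).
      by rewrite -EFinM -EFinD lee_fin le_eqVlt; apply/orP; left; apply/eqP; ring.
    + by apply: measurable_funX; exact: (fb_incr_measurable hfb).
    + by move=> w; rewrite exprn_even_ge0.
  - by apply: measurable_funM => //; apply: measurable_funX; exact: (fb_incr_measurable hfb).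
  - by move=> w; rewrite mulr_ge0// exprn_even_ge0.
  - by move=> w; rewrite mulr_ge0// sqr_ge0.
suff [_ _] : [/\ measurable_wrt (filt (tau n)) (S n),
   P.-integrable setT (EFin \o (fun w => S n w ^+ 2)) &
  (\int[P]_w (S n w ^+ 2)%:E
   <= (\sum_(k < n) (130 * M ^+ 2 * (tau k.+1 - tau k) ^+ 2))%:E)%E] by [].
elim: n => [|n [sS iS IH]].
  have S0 w : S 0%N w = 0 by rewrite /S big_ord0.
  split.
  - apply/(measurable_wrtP _ (fb_sigma hfb _)).
    by rewrite (_ : S 0%N = cst 0); [exact: measurable_cst|exact/funext].
  - rewrite (_ : (fun w => S 0%N w ^+ 2) = cst 0); first exact: icst.
    by apply/funext => w; rewrite S0 expr0n.
  - by under eq_integral do rewrite S0 expr0n/=; rewrite integral0 big_ord0.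
have SS w : S n.+1 w = S n w + c n w * Q n w by rewrite /S big_ord_recr.
have mS := measurable_wrtW (@fb_measurable _ _ _ _ _ _ hfb (tau n)) sS.
have iS1 : P.-integrable setT (EFin \o S n).
  apply: (@le_integrable _ _ _ _ _ _ _ (EFin \o (fun w => 1 + S n w ^+ 2))) => //.
  - exact: measurable_fun_EFin.
  - move=> w _ /=; rewrite lee_fin [leRHS]ger0_norm ?addr_ge0 ?sqr_ge0//.
    by rewrite -(real_normK (num_real (S n w))); have := normr_ge0 (S n w); nra.
  - exact: (integrable_realD (icst 1) iS).
have iSc : P.-integrable setT (EFin \o (fun w => c n w * S n w)).
  exact: (integrableMbounded (mc n) (cM n) iS1).
have sSc : measurable_wrt (filt (tau n)) (fun w => c n w * S n w).
  exact: (measurable_wrtM hfb).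
have [i1 e1] := fb_mul_incr_square hfb (tk n) (taui n) sSc iSc.
have iX : P.-integrable setT (EFin \o (fun w => (c n w * Q n w) ^+ 2)).
  apply/integrableP; split.
    by apply: measurable_fun_EFin; apply: measurable_funX; exact: measurable_funM.
  under eq_integral do rewrite /= ger0_norm ?sqr_ge0//.
  by apply: le_lt_trans (Q2 n) _; rewrite ltry.
have iC : P.-integrable setT (EFin \o (fun w => c n w * S n w * Q n w)).
  rewrite (_ : (fun w => c n w * S n w * Q n w) = (fun w => c n w * S n w *
    (B (tau n.+1) w - B (tau n) w) ^+ 2 + (- (tau n.+1 - tau n)) * (c n w * S n w))).
    by apply: integrable_realD => //; exact: integrable_realZl.
  by apply/funext => w; rewrite /Q; ring.
have eC : \int[P]_w (c n w * S n w * Q n w) = 0.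
  rewrite (_ : (fun w => c n w * S n w * Q n w) = (fun w => c n w * S n w *
    (B (tau n.+1) w - B (tau n) w) ^+ 2 - (tau n.+1 - tau n) * (c n w * S n w))).
    rewrite RintegralB//.
      by rewrite e1 RintegralZl// mulrC subrr.
    exact: integrable_realZl.
  by apply/funext => w; rewrite /Q; ring.
have iC2 : P.-integrable setT (EFin \o (fun w => 2 * (c n w * S n w * Q n w))).
  exact: integrable_realZl.
have E : (fun w => S n.+1 w ^+ 2) = (fun w => S n w ^+ 2
    + 2 * (c n w * S n w * Q n w) + (c n w * Q n w) ^+ 2).
  by apply/funext => w; rewrite SS; ring.
have iSS : P.-integrable setT (EFin \o (fun w => S n w ^+ 2
    + 2 * (c n w * S n w * Q n w))) by exact: integrable_realD.
split.
- apply/(measurable_wrtP _ (fb_sigma hfb _)).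
  rewrite (_ : S n.+1 = fun w => S n w + c n w * Q n w); last exact/funext.
  apply: measurable_funD.
    apply/(measurable_wrtP _ (fb_sigma hfb _)).
    exact: (measurable_wrt_mono hfb (taui n)).
  apply: measurable_funM; apply/(measurable_wrtP _ (fb_sigma hfb _)) => //.
  exact: (measurable_wrt_mono hfb (taui n)).
- by rewrite E; exact: integrable_realD.
have -> : (\int[P]_w (S n.+1 w ^+ 2)%:E)%E = (\int[P]_w (S n.+1 w ^+ 2))%:E%R.
  rewrite fineK//; have := integrable_realD iSS iX; rewrite -E.
  exact: integrable_fin_num.
rewrite E RintegralD// RintegralD// RintegralZl// eC mulr0 addr0 big_ord_recr/=.
rewrite EFinD [leRHS]EFinD; apply: leeD.
- by rewrite fineK//; exact: integrable_fin_num.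
- by rewrite fineK//; exact: integrable_fin_num.
Qed.

End isometry.

(** * Ito increments along uniform grids *)

Section convergence_in_probability.
Context d (Omega : measurableType d) (R : realType) (P : probability Omega R).
Implicit Types (Z : nat -> Omega -> R) (X Y : Omega -> R) (e : R).

Definition large X e : set Omega := [set w | e <= `|X w|].

(** Convergence to [0] in probability, in the epsilon form that avoids limits of extended reals. *)
Definition small_in_proba Z : Prop := forall e eta : R, 0 < e -> 0 < eta ->
  \forall n \near \oo, (P (large (Z n) e) <= eta%:E)%E.

Lemma measurable_fun_finsum (D : set Omega) (I : Type) (s : seq I)
    (F : I -> Omega -> R) : (forall i, measurable_fun D (F i)) ->
  measurable_fun D (fun w => \sum_(i <- s) F i w).
Proof.
move=> mF; elim: s => [|i s IH].
  by under eq_fun do rewrite big_nil; exact: measurable_cst.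
by under eq_fun do rewrite big_cons; exact: measurable_funD.
Qed.

Lemma measurable_large X e : measurable_fun setT X -> measurable (large X e).
Proof.
move=> mX; have mN : measurable_fun setT (fun w => `|X w|).
  by apply: measurableT_comp => //.
rewrite (_ : large X e = setT `&` (fun w => `|X w|) @^-1` `[e, +oo[).
  by apply: mN => //; exact: measurable_itv.
by rewrite setTI; apply/seteqP; split => w; rewrite /large/= in_itv/= andbT.
Qed.

Lemma le_proba (A C : set Omega) : measurable A -> measurable C -> A `<=` C ->
  (P A <= P C)%E.
Proof. by move=> mA mC AC; rewrite le_measure ?inE. Qed.

Lemma le_probaU (A C D : set Omega) :
  measurable A -> measurable C -> measurable D ->
  A `<=` C `|` D -> (P A <= P C + P D)%E.
Proof.
move=> mA mC mD AC; apply: le_trans (@measureU2 _ _ _ P _ _ mC mD).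
by apply: le_proba => //; exact: measurableU.
Qed.

Lemma markov_ge0 X (x e : R) : measurable_fun setT X -> (forall w, 0 <= X w) ->
  0 < e -> (\int[P]_w (X w)%:E <= x%:E)%E -> (P (large X e) <= (x / e)%:E)%E.
Proof.
move=> mX X0 e0 h.
have mA := measurable_large e mX.
have PL : P (large X e) \is a fin_num by exact: fin_num_measure.
rewrite -(fineK PL) lee_fin ler_pdivlMr// -lee_fin mulrC EFinM fineK//.
apply: le_trans h.
rewrite -[in leLHS](setIT (large X e)) -integral_indic//.
rewrite -ge0_intZl ?(ltW e0)//.
apply: ge0_le_int.
- by apply: measurable_funM => //; exact: measurable_indic.
- exact: mX.
- by move=> w; rewrite mulr_ge0// ltW.
- move=> w; rewrite indicE; case: (boolP (_ \in _)); last by rewrite mulr0.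
  by rewrite inE/= mulr1 /large/= ger0_norm.
Qed.

Lemma chebyshev_square X (x e : R) : measurable_fun setT X -> 0 < e ->
  (\int[P]_w (X w ^+ 2)%:E <= x%:E)%E ->
  (P (large X e) <= (x / e ^+ 2)%:E)%E.
Proof.
move=> mX e0 h; have mX2 : measurable_fun setT (fun w => X w ^+ 2).
  exact: measurable_funX.
apply: le_trans (markov_ge0 mX2 _ (exprn_gt0 2 e0) h); last by move=> w; exact: sqr_ge0.
apply: le_proba; [exact: measurable_large|exact: measurable_large|].
move=> w; rewrite /large/= normrX => ew.
by rewrite ler_sqr ?nnegrE// ltW.
Qed.

Lemma small_in_proba_le Z (Z' : nat -> Omega -> R) :
  (forall n, measurable_fun setT (Z n)) -> (forall n, measurable_fun setT (Z' n)) ->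
  (forall n w, `|Z n w| <= `|Z' n w|) -> small_in_proba Z' -> small_in_proba Z.
Proof.
move=> mZ mZ' ZZ' h e eta e0 eta0; have := h e eta e0 eta0.
apply: filterS => n; apply: le_trans; apply: le_proba.
- exact: measurable_large.
- exact: measurable_large.
- by move=> w; rewrite /large/= => /le_trans; apply.
Qed.

Lemma small_in_probaD Z (Z' : nat -> Omega -> R) :
  (forall n, measurable_fun setT (Z n)) -> (forall n, measurable_fun setT (Z' n)) ->
  small_in_proba Z -> small_in_proba Z' ->
  small_in_proba (fun n w => Z n w + Z' n w).
Proof.
move=> mZ mZ' h h' e eta e0 eta0.
have e20 : 0 < e / 2 by rewrite divr_gt0.
have eta20 : 0 < eta / 2 by rewrite divr_gt0.
apply: filterS2 (h _ _ e20 eta20) (h' _ _ e20 eta20) => n h1 h2.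
rewrite [eta]splitr EFinD; apply: le_trans (leeD h1 h2).
apply: le_probaU; try exact: measurable_large.
  by apply: measurable_large; exact: measurable_funD.
move=> w; rewrite /large/= => ew; apply: contrapT => /not_orP[/negP]; rewrite -ltNge => h3.
move=> /negP; rewrite -ltNge => h4; move: ew; apply/negP; rewrite -ltNge.
by rewrite (le_lt_trans (ler_normD _ _))// [e]splitr ltrD.
Qed.

Lemma small_in_probaZ Z (k : R) : (forall n, measurable_fun setT (Z n)) ->
  small_in_proba Z -> small_in_proba (fun n w => k * Z n w).
Proof.
move=> mZ h e eta e0 eta0; have k1 : 0 < `|k| + 1 by rewrite ltr_wpDl.
have ek : 0 < e / (`|k| + 1) by rewrite divr_gt0.
apply: filterS (h _ _ ek eta0) => n; apply: le_trans; apply: le_proba.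
- by apply: measurable_large; exact: measurable_funM.
- exact: measurable_large.
- move=> w; rewrite /large/= => ew; rewrite ler_pdivrMr//; apply: le_trans ew _.
  by rewrite normrM mulrC ler_wpM2l// lerDl.
Qed.

Lemma small_in_proba_sum (I : finType) (Z : I -> nat -> Omega -> R) :
  (forall i n, measurable_fun setT (Z i n)) -> (forall i, small_in_proba (Z i)) ->
  small_in_proba (fun n w => \sum_i Z i n w).
Proof.
move=> mZ h; elim: (index_enum I) => [|i s IH].
  move=> e eta e0 eta0; near=> n; rewrite (_ : large _ _ = set0) ?measure0 ?lee_fin ?ltW//.
  apply/seteqP; split => w //=; rewrite /large/= big_nil normr0; apply/negP.
  by rewrite -ltNge.
under [X in small_in_proba X]eq_fun do under eq_fun do rewrite big_cons.
apply: small_in_probaD => // n.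
exact: measurable_fun_finsum.
Unshelve. all: by end_near. Qed.

Lemma small_in_proba_L2 Z (x : nat -> R) : (forall n, measurable_fun setT (Z n)) ->
  (forall n, (\int[P]_w (Z n w ^+ 2)%:E <= (x n)%:E)%E) -> x n @[n --> \oo] --> 0 ->
  small_in_proba Z.
Proof.
move=> mZ h x0 e eta e0 eta0.
have ee : 0 < eta * e ^+ 2 by rewrite mulr_gt0// exprn_gt0.
apply: filterS (cvgr_le _ x0 _ ee) => n xn.
apply: le_trans (chebyshev_square (mZ n) e0 (h n)) _.
by rewrite lee_fin ler_pdivrMr// exprn_gt0.
Qed.

Lemma small_in_proba_sqr Z : (forall n, measurable_fun setT (Z n)) ->
  small_in_proba Z -> small_in_proba (fun n w => Z n w ^+ 2).
Proof.
move=> mZ h e eta e0 eta0; have e1 : 0 < Num.min 1 e by rewrite lt_min ltr01.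
apply: filterS (h _ _ e1 eta0) => n; apply: le_trans; apply: le_proba.
- by apply: measurable_large; exact: measurable_funX.
- exact: measurable_large.
- move=> w; rewrite /large/= normrX => ew; rewrite ge_min; apply/orP.
  have [z1|z1] := leP 1 `|Z n w|; [by left|right].
  by apply: le_trans ew _; rewrite expr2 ler_piMl// ltW.
Qed.

Lemma cvg_proba0_near (Z : nat -> Omega -> \bar R) (e eta : R) :
  cvg_proba0 P Z -> 0 < e -> 0 < eta ->
  \forall n \near \oo, (P [set w | (e%:E <= Z n w)%E] <= eta%:E)%E.
Proof.
move=> h e0 eta0; have /fine_cvgP[hf /cvgrPdist_le/(_ eta eta0) hc] := h e e0.
apply: filterS2 hf hc => n fn /=; rewrite sub0r normrN => hn.
by rewrite -(fineK fn) lee_fin (le_trans (ler_norm _)).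
Qed.

End convergence_in_probability.

(** * Intersections of intervals, clipping, and measurability of suprema *)

Section cut_intervals.
Context {R : realType}.
Implicit Types (c d u v s t : R) (f : R -> R).

(** [cut_lo] and [cut_hi] are the endpoints of the intersection of []c, d]] and []u, v]], arranged
    so that an empty intersection becomes an interval of length [0] and never a reversed one, as the
    isometry requires. The left end is at least [u], so a coefficient known at [u] is still known
    there. *)
Definition cut_lo c u : R := Num.max c u.
Definition cut_hi c d u v : R := Num.max (Num.max c u) (Num.min d v).

Lemma cut_le c d u v : cut_lo c u <= cut_hi c d u v.
Proof. by rewrite le_max lexx. Qed.

Lemma cut_indic c d u v s :
  \1_(`]cut_lo c u, cut_hi c d u v]%classic : set R) s
  = \1_(`]c, d]%classic : set R) s * \1_(`]u, v]%classic : set R) s :> R.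
Proof.
rewrite !indicE -natrM mulnb !mem_setE !in_itv/= gt_max le_max le_min; congr (_%:R).
by rewrite leNgt gt_max negb_and; case: (ltP c s); case: (ltP u s);
   rewrite /= ?orbF ?andbT ?andbF.
Qed.

(** The right-hand side is the increment between [c] and [d] of one term of [simple_integral], whose
    interval []u, v]] is stopped at the current time. *)
Lemma cut_incr c d u v f : c <= d -> u <= v ->
  f (cut_hi c d u v) - f (cut_lo c u)
  = f (Num.min d v) - f (Num.min d u) - (f (Num.min c v) - f (Num.min c u)).
Proof.
move=> cd uv; rewrite /cut_hi /cut_lo.
have [cu|uc] := leP c u.
  rewrite (min_l (le_trans cu uv)) subrr subr0.
  have [du|ud] := leP d u.
    by rewrite (min_l (le_trans du uv)) subrr max_l ?subrr.
  by rewrite max_r// le_min uv ltW.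
have [dv|vd] := leP d v.
  by rewrite (min_r (ltW (lt_le_trans uc cd))) (min_l (le_trans cd dv)) max_r//; ring.
rewrite (min_r (ltW (lt_le_trans uc cd))).
by have [cv|vc] := leP c v; ring.
Qed.

Lemma overlap_apart u v u' v' : v <= u' -> overlap u v u' v' = 0.
Proof.
move=> vu'; rewrite /overlap max_l// subr_le0.
by rewrite ge_min; apply/orP; left; rewrite le_max vu' orbT.
Qed.

Lemma overlap_same u v : u <= v -> overlap u v u v = v - u.
Proof. by move=> uv; rewrite /overlap minxx maxxx max_r// subr_ge0. Qed.

End cut_intervals.

Section ordered_steps.
Context {R : realType} (u : nat -> R).
Hypothesis u_nd : forall k, u k <= u k.+1.

Lemma nat_nondecreasing i j : (i <= j)%N -> u i <= u j.
Proof.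
move=> /subnK <-; elim: (j - i)%N => [|k IH]//.
by rewrite addSn; exact: le_trans (u_nd _).
Qed.

(** One alternative for all coefficient families at once: at [s], either the same cell is active for
    each of them or none is. Pointwise comparisons of step functions on a common partition thus
    reduce to one cell. *)
Lemma step_cases N s :
  (exists2 k, (k < N)%N & u k < s <= u k.+1 /\
     forall c : nat -> R,
       \sum_(i < N) c i * \1_(`]u i, u i.+1]%classic : set R) s = c k) \/
  (forall c : nat -> R,
     \sum_(i < N) c i * \1_(`]u i, u i.+1]%classic : set R) s = 0).
Proof.
elim: N => [|N IH]; first by right=> c; rewrite big_ord0.
have [/= sN|sN] := boolP (u N < s <= u N.+1).
  left; exists N => //; split => // c; rewrite big_ord_recr/=.
  rewrite big1 ?add0r.
    by rewrite indicE mem_setE in_itv/= sN mulr1.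
  move=> i _; rewrite indicE mem_setE in_itv/=.
  have := nat_nondecreasing (ltn_ord i) => ui.
  case/andP: sN => uNs _.
  by rewrite (leNgt s) (le_lt_trans ui uNs) andbF mulr0.
case: IH => [[k kN [ks h]]|h]; [left; exists k; first exact: ltnW|right] => [|c].
  by split=> // c; rewrite big_ord_recr/= h indicE mem_setE in_itv/= (negbTE sN) mulr0 addr0.
by rewrite big_ord_recr/= h indicE mem_setE in_itv/= (negbTE sN) mulr0 addr0.
Qed.

Lemma ordered_overlap (N : nat) (hi c : nat -> R) :
  (forall k, u k <= hi k) -> (forall k, hi k <= u k.+1) ->
  \sum_(i < N) \sum_(j < N) c i * c j * overlap (u i) (hi i) (u j) (hi j)
  = \sum_(i < N) c i ^+ 2 * (hi i - u i).
Proof.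
move=> uhi hiu; apply: eq_bigr => i _; rewrite (bigD1 i)//= big1 ?addr0.
  by rewrite overlap_same// expr2.
move=> j ji; have [ij|ji'|/val_inj ij] := ltngtP i j.
- by rewrite overlap_apart ?mulr0// (le_trans (hiu i))// nat_nondecreasing.
- by rewrite overlapC overlap_apart ?mulr0// (le_trans (hiu j))// nat_nondecreasing.
- by rewrite ij eqxx in ji.
Qed.

End ordered_steps.

Section clipping.
Context {R : realType}.
Implicit Types (V x h : R).

Definition clip V x : R := Num.max (- V) (Num.min V x).

Lemma clip_bound V x : 0 <= V -> `|clip V x| <= V.
Proof.
move=> V0; rewrite ler_norml /clip le_max lexx/= ge_max ge_min lexx/= andbT.
by rewrite (le_trans _ V0)// oppr_le0.
Qed.

(** [clip V x] is the point of [[- V, V]] closest to [x]. *)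
Lemma clip_near V x h : `|h| <= V -> `|x - clip V x| <= `|x - h|.
Proof.
rewrite ler_norml /clip => /andP[Vh hV].
have [Vx|xV] := leP V x.
  rewrite max_r ?(le_trans Vh)//.
  by rewrite !ger0_norm ?subr_ge0 ?(le_trans hV)//; lra.
have [xV'|Vx'] := leP (- V) x; first by rewrite subrr normr0.
by rewrite !ler0_norm ?subr_le0; lra.
Qed.

(** Projection onto an interval does not increase the distance to its points. *)
Lemma clip_dist V x h : `|h| <= V -> `|clip V x - h| <= `|x - h|.
Proof.
rewrite ler_norml /clip => /andP[Vh hV].
have [Vx|xV] := leP V x.
  rewrite max_r ?(le_trans Vh)//.
  by rewrite !ger0_norm ?subr_ge0 ?(le_trans hV)//; lra.
have [xV'|Vx'] := leP (- V) x; first by [].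
by rewrite !ler0_norm ?subr_le0; lra.
Qed.

End clipping.

Section sup_distance.
Context {R : realType}.

Lemma le_sup_dist (T : R) f g t : 0 <= t <= T ->
  (`|f t - g t|%:E <= sup_dist T f g)%E.
Proof. by move=> tT; apply: ereal_sup_ubound; exists t. Qed.

Definition clamp (T x : R) : R := Num.min T (Num.max 0 x).

Lemma clamp_in T x : 0 <= T -> 0 <= clamp T x <= T.
Proof. by move=> T0; rewrite /clamp le_min T0 le_max lexx/= ge_min lexx. Qed.

Lemma clamp_dist T x t : 0 <= t <= T -> `|clamp T x - t| <= `|x - t|.
Proof.
move=> /andP[t0 tT]; rewrite /clamp.
have [x0|x0] := leP x 0.
  rewrite min_r ?(le_trans t0)// !ler0_norm; lra.
have [Tx|xT] := leP T x; last by [].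
by rewrite !ger0_norm; lra.
Qed.

(** Clamping to [[0, T]] moves a rational no further away from [t], so rationals near an endpoint
    may be used even when they fall outside the interval. *)
Lemma rational_above (phi : R -> R) (T a t : R) : continuous_path phi ->
  0 <= t <= T -> a < phi t -> exists q : rat, a < phi (clamp T (ratr q)).
Proof.
move=> cphi tT at_; have /andP[t0 _] := tT.
have e0 : 0 < phi t - a by rewrite subr_gt0.
have [del del0 h] := continuous_path_at cphi t0 e0.
have dd : t - del < t + del by lra.
have [q] := rat_in_itvoo dd.
rewrite in_itv/= => /andP[q1 q2]; exists q.
have T0 : 0 <= T by case/andP: tT; exact: le_trans.
have /andP[c0 _] := clamp_in (ratr q) T0.
have := h (clamp T (ratr q)) c0.
have cd : `|clamp T (ratr q) - t| < del.
  by apply: le_lt_trans (clamp_dist _ tT) _; rewrite ltr_norml; apply/andP; split; lra.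
by move=> /(_ cd); rewrite ltr_norml => /andP[+ _]; lra.
Qed.

(** By continuity the supremum is seen at clamped rational times. The large inequality is the
    countable intersection over [m] of strict ones with threshold lowered by [m.+1%:R^-1], each of
    which holds at some rational. *)
Lemma sup_dist_measurable d (Omega : measurableType d) (X Y : R -> Omega -> R)
    (T c : R) : 0 <= T ->
  (forall t, 0 <= t -> measurable_fun setT (X t)) ->
  (forall w, continuous_path (X ^~ w)) ->
  (forall t, 0 <= t -> measurable_fun setT (Y t)) ->
  (forall w, continuous_path (Y ^~ w)) ->
  measurable [set w | (c%:E <= sup_dist T (X ^~ w) (Y ^~ w))%E].
Proof.
move=> T0 mX cX mY cY.
pose phi w t := `|X t w - Y t w|.
have cphi w : continuous_path (phi w).
  by move=> x; apply: cvg_norm; exact: (continuous_pathB (cX w) (cY w)).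
rewrite (_ : [set w | _] = \bigcap_(m : nat) \bigcup_(q : rat)
   [set w | c - m.+1%:R^-1 < phi w (clamp T (ratr q))]).
  apply: bigcapT_measurable => m; apply: bigcupT_measurable_rat => q.
  have /andP[c0 _] := clamp_in (ratr q) T0.
  rewrite (_ : [set w | _] = setT `&` (phi ^~ (clamp T (ratr q))) @^-1` `]c - m.+1%:R^-1, +oo[).
    have mphi : measurable_fun setT (phi ^~ (clamp T (ratr q))).
      by apply: measurableT_comp => //; apply: measurable_funB; [exact: mX|exact: mY].
    by apply: mphi => //; exact: measurable_itv.
  by rewrite setTI; apply/seteqP; split => w /=; rewrite in_itv/= andbT.
apply/seteqP; split => w /=.
  move=> cs m _.
  have : ((c - m.+1%:R^-1)%:E < sup_dist T (X ^~ w) (Y ^~ w))%E.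
    by apply: lt_le_trans cs; rewrite lte_fin ltrBlDr ltrDl.
  move=> /ereal_sup_gt[_ [t tT <-]]; rewrite lte_fin => h.
  have [|q qh] := @rational_above (phi w) T _ t (cphi w) _ h.
    by move: tT; rewrite /= in_itv.
  by exists q.
move=> h; apply/lee_addgt0Pr => e e0.
have [m me] : exists m : nat, m.+1%:R^-1 < e.
  have := @near_infty_natSinv_lt R (PosNum e0) => /= H.
  by have [m hm] := @filter_ex _ \oo _ _ H; exists m.
have [q _ hq] := h m I.
have /le_sup_dist hs := clamp_in (ratr q) T0.
have := hs (X ^~ w) (Y ^~ w) => hs'.
rewrite addeC -leeBlDl//; apply: le_trans hs'.
by rewrite -EFinB lee_fin; apply: le_trans (ltW hq); rewrite lerD2l lerN2 ltW.
Qed.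

End sup_distance.

(** * Approximation of the Ito integral by bounded simple processes *)

Section clipped_ito_integral.
Context d (Omega : measurableType d) (R : realType) (P : probability Omega R).
Context (filt : R -> set (set Omega)) (B : R -> Omega -> R).
Hypothesis hfb : filtered_brownian P filt B.
Local Notation mu := (@lebesgue_measure R).
Implicit Types (S : simple_process filt) (s t c e del : R).

Let fm t := @fb_measurable _ _ _ _ _ _ hfb t.

Lemma measurable_wrt_comp (G : set (set Omega)) (Z : Omega -> R) (g : R -> R) :
  measurable_fun setT g -> measurable_wrt G Z -> measurable_wrt G (fun w => g (Z w)).
Proof.
move=> mg GZ _ [U mU ->]; apply: GZ; exists (g @^-1` U) => //.
by rewrite -[_ @^-1` _]setTI; exact: mg.
Qed.

Lemma measurable_clip (V : R) : measurable_fun setT (clip V).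
Proof.
by apply: measurable_maxr => //; apply: measurable_minr.
Qed.

(* Lenglart's inequality for step integrands: the coefficients are switched off
   as soon as the accumulated energy exceeds [del], which the filtration sees
   at the left end of each interval. *)
Lemma lenglart (u hi : nat -> R) (eta : nat -> Omega -> R) (M : R) N e del :
  0 <= u 0%N -> (forall k, u k <= hi k) -> (forall k, hi k <= u k.+1) ->
  (forall k, measurable_wrt (filt (u k)) (eta k)) ->
  (forall k w, `|eta k w| <= M) -> 0 < e -> 0 <= del ->
  (P (large (fun w => (\sum_(i < N) eta i w * (B (hi i) w - B (u i) w))%R) e)
   <= P [set w | (del < \sum_(i < N) eta i w ^+ 2 * (hi i - u i))%R]
      + (del / e ^+ 2)%:E)%E.
Proof.
move=> u0 uhi hiu seta etaM e0 del0.
have u_nd k : u k <= u k.+1 by exact: le_trans (hiu k).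
have uk0 k : 0 <= u k by rewrite (le_trans u0)//; exact: (nat_nondecreasing u_nd).
have hi0 k : 0 <= hi k by exact: le_trans (uhi k).
pose q n w := \sum_(i < n) eta i w ^+ 2 * (hi i - u i).
have q_nd w n : q n w <= q n.+1 w.
  by rewrite /q big_ord_recr/= lerDl mulr_ge0 ?sqr_ge0// subr_ge0.
have sq n k : (n <= k.+1)%N -> measurable_wrt (filt (u k)) (q n).
  move=> nk; apply/(measurable_wrtP _ (fb_sigma hfb _)).
  apply: measurable_fun_finsum => i; apply: measurable_funM => //.
  apply: measurable_funX; apply/(measurable_wrtP _ (fb_sigma hfb _)).
  apply: (measurable_wrt_mono hfb _ (seta i)).
  by apply: (nat_nondecreasing u_nd); rewrite -ltnS (leq_trans _ nk).
pose ind (x : R) : R := \1_(`]-oo, del]%classic : set R) x.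
have mind : measurable_fun setT ind by exact: measurable_indic.
have ind01 x : 0 <= ind x <= 1.
  by rewrite /ind indicE; case: (_ \in _); rewrite ?lexx ?ler01.
(* Off by one on purpose: [q k.+1] includes cell [k], whose length is deterministic and whose
   coefficient is known at [u k]; hence the truncated energy stays within [del] without
   overshoot. *)
pose theta k w := ind (q k.+1 w).
have sth k : measurable_wrt (filt (u k)) (theta k).
  by apply: measurable_wrt_comp => //; exact: sq.
pose xi k w := eta k w * theta k w.
have sxi k : measurable_wrt (filt (u k)) (xi k) by exact: (measurable_wrtM hfb).
have xiM k w : `|xi k w| <= M.
  have /andP[t0 t1] := ind01 (q k.+1 w).
  rewrite normrM (ger0_norm t0); apply: le_trans (etaM k w).
  by rewrite ler_piMr.
have xiE k w : xi k w = if q k.+1 w <= del then eta k w else 0.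
  rewrite /xi /theta /ind indicE mem_setE in_itv/=.
  by case: ifP; rewrite (mulr1, mulr0).
have energy w n : \sum_(i < n) xi i w ^+ 2 * (hi i - u i) <= del /\
    \sum_(i < n) xi i w ^+ 2 * (hi i - u i) <= q n w.
  elim: n => [|n [IH1 IH2]]; first by rewrite /q !big_ord0.
  rewrite !big_ord_recr/= xiE.
  have [qd|qd] := leP (q n.+1 w) del.
    have h : \sum_(i < n) xi i w ^+ 2 * (hi i - u i)
      + eta n w ^+ 2 * (hi n - u n) <= q n.+1 w.
      by rewrite /q big_ord_recr/= lerD2r.
    by split => //; exact: le_trans qd.
  rewrite expr0n mul0r addr0; split => //.
  exact: le_trans (q_nd w n).
pose Y w := \sum_(i < N) eta i w * (B (hi i) w - B (u i) w).
pose Y' w := \sum_(i < N) xi i w * (B (hi i) w - B (u i) w).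
have mB k : measurable_fun setT (fun w => B (hi k) w - B (u k) w).
  exact: (fb_incr_measurable hfb).
have mY : measurable_fun setT Y.
  apply: measurable_fun_finsum => i; apply: measurable_funM => //.
  exact: (measurable_wrtW (@fm (u i))).
have mY' : measurable_fun setT Y'.
  apply: measurable_fun_finsum => i; apply: measurable_funM => //.
  exact: (measurable_wrtW (@fm (u i))).
have Y'2 : (\int[P]_w (Y' w ^+ 2)%:E <= del%:E)%E.
  rewrite /Y' (@ito_isometry _ _ _ P filt B hfb 'I_N (fun i => u i) (fun i => hi i)
    (fun=> M) (fun i => xi i))//.
  under eq_integral do rewrite integral_step_square
    (ordered_overlap u_nd N (fun k => xi k _) uhi hiu).
  rewrite -[leRHS](prob_int_cst P); apply: ge0_le_int => //.
  - apply: measurable_fun_finsum => i; apply: measurable_funM => //.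
    apply: measurable_funX; exact: (measurable_wrtW (@fm (u i))).
  - move=> w; apply: sumr_ge0 => i _.
    by rewrite mulr_ge0 ?sqr_ge0// subr_ge0.
  - by move=> w; have [] := energy w N.
have mq : measurable [set w | (del < q N w)%R].
  rewrite (_ : [set w | _] = setT `&` q N @^-1` `]del, +oo[).
    have h : measurable_fun setT (q N).
      by apply: (measurable_wrtW (@fm (u N))); exact: sq.
    by apply: h => //; exact: measurable_itv.
  by rewrite setTI; apply/seteqP; split => w /=; rewrite in_itv/= andbT.
apply: le_trans (leeD2l _ (chebyshev_square mY' e0 Y'2)).
apply: le_probaU => //; try exact: measurable_large.
move=> w; rewrite /large/= => ew.
have [qd|qd] := leP (q N w) del; [right|by left].
(* If the full energy is at most [del], no coefficient was ever switched off, since [q] is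
   nondecreasing. *)
suff -> : Y' w = Y w by [].
apply: eq_bigr => i _; rewrite xiE (le_trans _ qd)//.
exact: (nat_nondecreasing (q_nd w) (ltn_ord i)).
Qed.

Lemma simple_integralB S c t w : 0 <= c -> c <= t ->
  simple_integral B S t w - simple_integral B S c w
  = \sum_(k < sp_size S) sp_coef S k w *
     (B (cut_hi c t (sp_time S k) (sp_time S k.+1)) w
      - B (cut_lo c (sp_time S k)) w).
Proof.
move=> c0 ct; rewrite /simple_integral -sumrB; apply: eq_bigr => k _.
rewrite -mulrBr; congr *%R.
exact: esym (cut_incr (B ^~ w) ct (sp_time_le S k)).
Qed.

Lemma simple_time_ge0 S k : 0 <= sp_time S k.
Proof.
rewrite (le_trans (sp_time_ge0 S))//.
exact: (nat_nondecreasing (sp_time_le S)).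
Qed.

Lemma simple_integral0 S w : simple_integral B S 0 w = 0.
Proof.
rewrite /simple_integral big1// => k _.
by rewrite !min_l ?simple_time_ge0// subrr mulr0.
Qed.

Lemma simple_integral_measurable S t : 0 <= t ->
  measurable_fun setT (simple_integral B S t).
Proof.
move=> t0; apply: measurable_fun_finsum => k; apply: measurable_funM.
  exact: (measurable_wrtW (@fm _) (@sp_adapted _ _ _ _ S k)).
by apply: measurable_funB; apply: (fb_measurable_at hfb);
  rewrite le_min t0 simple_time_ge0.
Qed.

Lemma clip_adapted (V : R) S k :
  measurable_wrt (filt (sp_time S k)) (fun w => clip V (sp_coef S k w)).
Proof.
apply: measurable_wrt_comp; first exact: measurable_clip.
exact: sp_adapted.
Qed.

Lemma clip_process_bounded (V : R) (V0 : 0 <= V) S :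
  exists M : R, forall k w, `|clip V (sp_coef S k w)| <= M.
Proof. by exists V => k w; exact: clip_bound. Qed.

(** Truncated coefficients give a bound on the energy gap that is uniform along the approximating
    sequence. *)
Definition clip_process (V : R) (V0 : 0 <= V) S : simple_process filt :=
  @SimpleProcess _ _ _ filt (sp_size S) (sp_time S)
    (fun k w => clip V (sp_coef S k w)) (sp_time_ge0 S) (sp_time_le S)
    (fun k => @clip_adapted V S k) (clip_process_bounded V0 S).

Section integrand.
Variables (V T : R) (H : R -> Omega -> R).
Hypotheses (V0 : 0 <= V) (T0 : 0 <= T).
Hypothesis HV : forall s w, 0 <= s -> `|H s w| <= V.
Hypothesis mH : measurable_fun setT
  (fun p : measurableTypeR R * Omega => H (Num.max 0 p.1) p.2).

Lemma measurable_integral_time (F : R -> Omega -> R) :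
  measurable_fun setT (fun p : measurableTypeR R * Omega => F p.1 p.2) ->
  (forall s w, 0 <= F s w) ->
  measurable_fun setT (fun w => \int[mu]_s (F s w)%:E)%E.
Proof.
move=> mF F0.
apply: (@measurable_fun_fubini_tonelli_G _ _ (measurableTypeR R) Omega R mu
  (fun p => (F p.1 p.2)%:E)); last by move=> p; rewrite lee_fin.
exact: measurable_fun_EFin.
Qed.

Lemma measurable_pair_left (f : R -> R) : measurable_fun setT f ->
  measurable_fun setT (fun p : measurableTypeR R * Omega => f p.1).
Proof. by move=> mf; exact: (measurableT_comp mf measurable_fst). Qed.

Lemma measurable_pair_right (f : Omega -> R) : measurable_fun setT f ->
  measurable_fun setT (fun p : measurableTypeR R * Omega => f p.2).
Proof. by move=> mf; exact: (measurableT_comp mf measurable_snd). Qed.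

Lemma simple_val_measurable S : measurable_fun setT
  (fun p : measurableTypeR R * Omega => simple_val S p.1 p.2).
Proof.
apply: measurable_fun_finsum => k; apply: measurable_funM.
  apply: (@measurable_pair_right (sp_coef S k)).
  exact: (measurable_wrtW (@fm _) (@sp_adapted _ _ _ _ S k)).
by apply: (@measurable_pair_left (\1_(`]sp_time S k, sp_time S k.+1]%classic)));
  exact: measurable_indic.
Qed.

Definition energy_gap S w : \bar R :=
  (\int[mu]_(s in `[0%R, T]) ((simple_val S s w - H s w) ^+ 2)%:E)%E.

(** The interval becomes an indicator and the time is forced to be nonnegative, so that the
    integrand is jointly measurable on the whole product space. *)
Lemma energy_gapE S w : energy_gap S w = (\int[mu]_s
  (\1_(`[0%R, T]%classic : set R) s *
    (simple_val S s w - H (Num.max 0 s) w) ^+ 2)%:E)%E.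
Proof.
rewrite /energy_gap integral_mkcond; apply: eq_integral => s _.
rewrite patchE indicE; case: ifPn => sT; last by rewrite mul0r.
rewrite mul1r max_r//.
by move: sT; rewrite inE/= in_itv/= => /andP[].
Qed.

Lemma energy_gap_measurable S : measurable_fun setT (energy_gap S).
Proof.
rewrite (funext (energy_gapE S)).
apply: (@measurable_integral_time (fun s w => \1_(`[0%R, T]%classic : set R) s *
    (simple_val S s w - H (Num.max 0 s) w) ^+ 2)); last first.
  by move=> s w; rewrite mulr_ge0// sqr_ge0.
apply: measurable_funM.
  by apply: (@measurable_pair_left (\1_(`[0%R, T]%classic))); exact: measurable_indic.
apply: measurable_funX; apply: measurable_funB => //.
exact: simple_val_measurable.
Qed.

(** The intervals of a simple process are disjoint and [clip V 0 = 0], so clipping the coefficients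
    is clipping the values. *)
Lemma simple_val_clip S s w : simple_val (clip_process V0 S) s w
  = clip V (simple_val S s w).
Proof.
have c0 : clip V 0 = 0 :> R by rewrite /clip min_r// max_r// oppr_le0.
have [[k kN [ks h]]|h] := step_cases (sp_time_le S) (sp_size S) s.
  by rewrite /simple_val /= (h (fun k => clip V (sp_coef S k w)))
     (h (fun k => sp_coef S k w)).
by rewrite /simple_val /= (h (fun k => clip V (sp_coef S k w)))
   (h (fun k => sp_coef S k w)) c0.
Qed.

Let mgap S : measurable_fun setT (fun p : measurableTypeR R * Omega =>
  \1_(`[0%R, T]%classic : set R) p.1 *
  (simple_val S p.1 p.2 - H (Num.max 0 p.1) p.2) ^+ 2).
Proof.
apply: measurable_funM.
  by apply: (@measurable_pair_left (\1_(`[0%R, T]%classic))); exact: measurable_indic.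
apply: measurable_funX; apply: measurable_funB => //.
exact: simple_val_measurable.
Qed.

Let mgap1 S w : measurable_fun setT (fun s : measurableTypeR R =>
  \1_(`[0%R, T]%classic : set R) s *
  (simple_val S s w - H (Num.max 0 s) w) ^+ 2).
Proof.
have h : measurable_fun setT (fun s : measurableTypeR R => (s, w)).
  exact: measurable_fun_pair.
exact: (measurableT_comp (mgap S) h).
Qed.

Lemma HmaxV s w : `|H (Num.max 0 s) w| <= V.
Proof. by apply: HV; rewrite le_max lexx. Qed.

Lemma energy_gap_clip_le S w : (energy_gap (clip_process V0 S) w <= energy_gap S w)%E.
Proof.
rewrite !energy_gapE; apply: ge0_le_int.
- exact (mgap1 _ _).
- exact (mgap1 _ _).
- by move=> s; rewrite mulr_ge0// sqr_ge0.
- move=> s; rewrite ler_wpM2l// simple_val_clip -(real_normK (num_real (clip _ _ - _))).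
  rewrite -(real_normK (num_real (simple_val _ _ _ - _))) ler_sqr ?nnegrE//.
  by apply: clip_dist; exact: HmaxV.
Qed.

Lemma energy_gap_clip_bound S w :
  (energy_gap (clip_process V0 S) w <= (4 * V ^+ 2 * T)%:E)%E.
Proof.
rewrite energy_gapE; apply: (@le_trans _ _
  (\int[mu]_s (4 * V ^+ 2 * \1_(`[0%R, T]%classic : set R) s)%:E)%E).
  apply: ge0_le_int.
  - exact (mgap1 _ _).
  - by apply: measurable_funM => //; exact: measurable_indic.
  - by move=> s; rewrite mulr_ge0// sqr_ge0.
  - move=> s; rewrite mulrC ler_wpM2r// simple_val_clip.
    have := clip_bound (simple_val S s w) V0; have := HmaxV s w.
    rewrite !ler_norml => /andP[a1 a2] /andP[b1 b2].
    rewrite -subr_ge0 (_ : _ - _ = (2 * V - (clip V (simple_val S s w) - H (Num.max 0 s) w)) *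
      (2 * V + (clip V (simple_val S s w) - H (Num.max 0 s) w))); last ring.
    by apply: mulr_ge0; lra.
rewrite ge0_intZl//; last by rewrite mulr_ge0// sqr_ge0.
rewrite integral_indic//= setIT lebesgue_measure_itv/= lte_fin.
by case: (ltP 0 T) => hT; rewrite -?EFinB -EFinM lee_fin ?subr0// mulr0
  mulr_ge0// mulr_ge0// sqr_ge0.
Qed.

Variable S_ : nat -> simple_process filt.
Hypothesis gap0 : cvg_proba0 P (fun n w => energy_gap (S_ n) w).

Let mgapset S (c : R) : measurable [set w | (c%:E <= energy_gap S w)%E].
Proof.
rewrite -[X in measurable X]setTI.
by apply: emeasurable_fun_c_infty => //; exact: energy_gap_measurable.
Qed.

(** Bounded convergence: the clipped gap is at most [4 * V ^+ 2 * T] everywhere, hence the rare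
    event where the original gap reaches [e / 2] contributes little to the mean. *)
Lemma mean_energy_gap e : 0 < e ->
  \forall n \near \oo, (\int[P]_w energy_gap (clip_process V0 (S_ n)) w <= e%:E)%E.
Proof.
move=> e0; pose C := 4 * V ^+ 2 * T + 1.
have C0 : 0 < C by rewrite ltr_wpDl// mulr_ge0// mulr_ge0// sqr_ge0.
have e20 : 0 < e / 2 by rewrite divr_gt0.
have eC0 : 0 < e / 2 / C by rewrite divr_gt0.
apply: filterS (cvg_proba0_near gap0 e20 eC0) => n Pn.
set A := [set w | ((e / 2)%:E <= energy_gap (S_ n) w)%E] in Pn.
have mA : measurable A by exact: mgapset.
apply: (@le_trans _ _ (\int[P]_w (e / 2 + C * \1_A w)%:E)%E).
  apply: ge0_le_integral => //.
  - by move=> w _; apply: integral_ge0 => s _; rewrite lee_fin sqr_ge0.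
  - exact: energy_gap_measurable.
  - apply: measurable_fun_EFin; apply: measurable_funD => //.
    by apply: measurable_funM => //; exact: measurable_indic.
  - move=> w _; rewrite indicE; case: (boolP (w \in A)) => wA.
      apply: le_trans (energy_gap_clip_bound _ _) _.
      by rewrite lee_fin mulr1 /C; lra.
    rewrite mulr0 addr0; apply: le_trans (energy_gap_clip_le _ _) _.
    by move: wA; rewrite notin_setE/= => /negP; rewrite -ltNge => /ltW.
rewrite ge0_intD//; last 3 first.
- by apply: measurable_funM => //; exact: measurable_indic.
- by move=> w; exact: ltW.
- by move=> w; rewrite mulr_ge0// ltW.
rewrite prob_int_cst ge0_intZl ?(ltW C0)// integral_indic//= setIT.
apply: (@le_trans _ _ ((e / 2)%:E + C%:E * (e / 2 / C)%:E)%E).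
  by apply: leeD2l; apply: lee_wpmul2l => //; rewrite lee_fin ltW.
by rewrite -EFinM -EFinD lee_fin [C * _]mulrC divfK ?gt_eqF// -splitr.
Qed.

(** The difference is a step integral with coefficients [x - clip V x]. Its energy is at most that
    of [S_ n - H], because [H] takes values in [[- V, V]], and the latter is small in probability;
    [lenglart] turns this into smallness of the integral. *)
Lemma clip_integral_close t : 0 <= t <= T ->
  small_in_proba P (fun n w => simple_integral B (S_ n) t w
     - simple_integral B (clip_process V0 (S_ n)) t w).
Proof.
move=> /andP[t0 tT] e eta e0 eta0.
have eta20 : 0 < eta / 2 by rewrite divr_gt0.
(* Makes the second term [del / e ^+ 2] of [lenglart] equal to [eta / 2]. *)
have del0 : 0 < eta / 2 * e ^+ 2 by rewrite mulr_gt0// exprn_gt0.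
apply: filterS (cvg_proba0_near gap0 del0 eta20) => n Pn.
pose u := sp_time (S_ n); pose N := sp_size (S_ n).
pose hi k := cut_hi 0 t (u k) (u k.+1).
have lo k : cut_lo 0 (u k) = u k by rewrite /cut_lo max_r// simple_time_ge0.
have uhi k : u k <= hi k by rewrite -{1}lo cut_le.
have hiu k : hi k <= u k.+1.
  have := lo k; rewrite /hi /cut_hi /cut_lo => ->.
  by rewrite ge_max sp_time_le ge_min lexx orbT.
have [M SM] := sp_bounded (S_ n).
pose eta_ k w := sp_coef (S_ n) k w - clip V (sp_coef (S_ n) k w).
have seta k : measurable_wrt (filt (u k)) (eta_ k).
  apply/(measurable_wrtP _ (fb_sigma hfb _)); apply: measurable_funB.
    by apply/(measurable_wrtP _ (fb_sigma hfb _)); exact: sp_adapted.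
  by apply/(measurable_wrtP _ (fb_sigma hfb _)); exact: clip_adapted.
have etaM k w : `|eta_ k w| <= M + V.
  by apply: le_trans (ler_normB _ _) _; rewrite lerD// clip_bound.
have := lenglart N (simple_time_ge0 (S_ n) 0) uhi hiu seta etaM e0 (ltW del0).
have -> : (fun w => \sum_(i < N) eta_ i w * (B (hi i) w - B (u i) w)) =
   (fun w => simple_integral B (S_ n) t w
     - simple_integral B (clip_process V0 (S_ n)) t w).
  apply/funext => w.
  have h1 := simple_integralB (S_ n) w (lexx 0) t0.
  have h2 := simple_integralB (clip_process V0 (S_ n)) w (lexx 0) t0.
  rewrite simple_integral0 subr0 in h1; rewrite simple_integral0 subr0 in h2.
  rewrite h1 h2 -sumrB; apply: eq_bigr => i _ /=.
  by rewrite -mulrBl -/u -/(hi i) lo.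
move=> /le_trans; apply.
rewrite mulfK ?gt_eqF ?exprn_gt0// [eta in leRHS]splitr EFinD.
apply: leeD2r; apply: le_trans Pn; apply: le_proba.
- rewrite (_ : [set w | _] = setT `&` (fun w => \sum_(i < N) eta_ i w ^+ 2 * (hi i - u i))
     @^-1` `](eta / 2 * e ^+ 2), +oo[).
    have h : measurable_fun setT (fun w => \sum_(i < N) eta_ i w ^+ 2 * (hi i - u i)).
      apply: measurable_fun_finsum => i; apply: measurable_funM => //.
      by apply: measurable_funX; exact: (measurable_wrtW (@fm (u i))).
    by apply: h => //; exact: measurable_itv.
  by rewrite setTI; apply/seteqP; split => w /=; rewrite in_itv/= andbT.
- exact: mgapset.
- move=> w /= /ltW; rewrite -lee_fin => /le_trans; apply.
  have u_nd : forall k, u k <= u k.+1 by exact: sp_time_le.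
  rewrite -(ordered_overlap u_nd N (fun k => eta_ k w) uhi hiu).
  rewrite -(integral_step_square (fun i : 'I_N => u i) (fun i => hi i) (fun i => eta_ i w)).
  rewrite energy_gapE; apply: ge0_le_int.
  + apply: measurable_funX; apply: measurable_fun_finsum => i.
    by apply: measurable_funM => //; exact: measurable_indic.
  + exact (mgap1 _ _).
  + by move=> s; exact: sqr_ge0.
  + move=> s.
    have E : \sum_(i < N) eta_ i w * \1_(`]u i, hi i]%classic : set R) s =
      \1_(`]0, t]%classic : set R) s *
       (simple_val (S_ n) s w - clip V (simple_val (S_ n) s w)).
      rewrite -(simple_val_clip (S_ n)) /simple_val /= -sumrB mulr_sumr.
      apply: eq_bigr => i _; rewrite -mulrBl -[X in `]X, _]]lo cut_indic.
      by rewrite mulrCA.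
    rewrite E exprMn.
    have -> : \1_(`]0%R, t]%classic : set R) s ^+ 2 = \1_(`]0%R, t]%classic : set R) s :> R.
      by rewrite indicE -natrX; case: (_ \in _).
    apply: ler_pM => //; first exact: sqr_ge0.
      rewrite !indicE ler_nat !mem_setE !in_itv/=.
      case: (ltP 0 s) => //= s0; rewrite (ltW s0)/=.
      by case: (leP s t) => //= st; rewrite (le_trans st).
    rewrite -(real_normK (num_real (_ - clip _ _))).
    rewrite -(real_normK (num_real (simple_val _ _ _ - H _ _))) ler_sqr ?nnegrE//.
    by apply: clip_near; exact: HmaxV.
Qed.

End integrand.
End clipped_ito_integral.

(** * Residuals of the Ito integral along a uniform grid *)

Section grid_sums.
Context d (Omega : measurableType d) (R : realType) (P : probability Omega R).
Context (filt : R -> set (set Omega)) (B : R -> Omega -> R).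
Hypothesis hfb : filtered_brownian P filt B.
Hypothesis cB : forall w, continuous_path (B ^~ w).
Local Notation mu := (@lebesgue_measure R).
Variables (V T : R) (H I : R -> Omega -> R) (S_ : nat -> simple_process filt).
Hypotheses (V0 : 0 <= V) (T0 : 0 <= T).
Hypothesis HV : forall s w, 0 <= s -> `|H s w| <= V.
Hypothesis mH : measurable_fun setT
  (fun p : measurableTypeR R * Omega => H (Num.max 0 p.1) p.2).
Hypothesis sH : forall s, 0 <= s -> measurable_wrt (filt s) (H s).
Hypothesis Hleft : forall w, {ae mu, forall s : R, 0 < s -> forall e : R, 0 < e ->
  exists2 del : R, 0 < del & forall r, 0 <= r -> s - del < r -> r < s ->
    `|H r w - H s w| < e}.
Hypothesis gap0 : cvg_proba0 P (fun n w => energy_gap T H (S_ n) w).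
Hypothesis mI : forall t, 0 <= t -> measurable_fun setT (I t).
Hypothesis cI : forall w, continuous_path (I ^~ w).
Hypothesis sup0 : cvg_proba0 P
  (fun n w => sup_dist T (simple_integral B (S_ n) ^~ w) (I ^~ w)).

Let fm t := @fb_measurable _ _ _ _ _ _ hfb t.
Local Notation S' m := (clip_process V0 (S_ m)).

Lemma continuous_path_stop (f : R -> R) (v : R) : 0 <= v -> continuous_path f ->
  continuous_path (fun t => f (Num.min t v)).
Proof.
move=> v0 cf; apply: continuous_pathP => s e s0 e0.
have s1 : 0 <= Num.min s v by rewrite le_min s0.
have [del del0 h] := continuous_path_at cf s1 e0.
exists del => // r r0 rs; apply: h; first by rewrite le_min r0.
apply: le_lt_trans rs.
by have [|] := leP r v; have [|] := leP s v => h1 h2;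
   rewrite ?subrr ?normr0// ler_norml;
   have := ler_norm (r - s); have := ler_norm (s - r); rewrite distrC => ? ?;
   apply/andP; split; lra.
Qed.

Lemma simple_integral_continuous (S : simple_process filt) w :
  continuous_path (simple_integral B S ^~ w).
Proof.
rewrite /simple_integral; elim: (index_enum _) => [|k s IH].
  by under eq_fun do rewrite big_nil; move=> x; exact: cvg_cst.
under eq_fun do rewrite big_cons; apply: continuous_pathD => //.
apply: continuous_pathM; first by move=> x; exact: cvg_cst.
by apply: continuous_pathB; apply: (@continuous_path_stop (B ^~ w)) => //;
  exact (simple_time_ge0 _ _).
Qed.

(** Clipping error plus approximation error; the latter is controlled at the single time [t] by the
    supremum over [[0, T]]. *)
Lemma clip_integral_cvg t : 0 <= t <= T ->
  small_in_proba P (fun n w => simple_integral B (S' n) t w - I t w).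
Proof.
move=> tT; have /andP[t0 _] := tT.
have mS S := simple_integral_measurable hfb S t0.
have h1 := clip_integral_close hfb V0 HV mH gap0 tT.
have h2 : small_in_proba P (fun n w => simple_integral B (S_ n) t w - I t w).
  move=> e eta e0 eta0; apply: filterS (cvg_proba0_near sup0 e0 eta0) => n.
  apply: le_trans; apply: le_proba.
  - by apply: measurable_large; apply: measurable_funB; [exact: mS|exact: mI].
  - apply: sup_dist_measurable => //.
    + by move=> r r0; exact: (simple_integral_measurable hfb).
    + by move=> w; exact: simple_integral_continuous.
  - move=> w; rewrite /large/= => ew; apply: le_trans (le_sup_dist _ _ tT).
    by rewrite lee_fin.
have h3 := small_in_probaD _ _ (small_in_probaZ (-1) _ h1) h2.
rewrite (_ : (fun n w => _) = (fun n w => -1 * (simple_integral B (S_ n) t w -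
      simple_integral B (S' n) t w) + (simple_integral B (S_ n) t w - I t w))).
  apply: h3 => n; do ?[apply: measurable_funM|apply: measurable_funB];
    do ?[exact: mS|exact: mI|exact: measurable_cst].
by apply/funext => n; apply/funext => w; ring.
Qed.

Variables (a b : R).
Hypotheses (a0 : 0 <= a) (ab : a < b) (bT : b <= T).
Local Notation g := (grid a b).

Let g_nd n k : g n k <= g n k.+1. Proof. by apply: grid_le => //; exact: ltW. Qed.
Let g0 n k : 0 <= g n k.
Proof. by rewrite (le_trans a0)// -{1}(grid0 a b n) grid_le// ltW. Qed.

Definition cell n k (s : R) : R := \1_(`]g n k, g n k.+1]%classic : set R) s.

Lemma cell_cover n s : (0 < n)%N ->
  \sum_(k < n) cell n k s = \1_(`]a, b]%classic : set R) s.
Proof.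
move=> n0; have E (x y : R) : x <= y ->
    \1_(`]x, y]%classic : set R) s = (s <= y)%R%:R - (s <= x)%R%:R :> R.
  move=> xy; rewrite indicE mem_setE in_itv/= ltNge.
  have [sx|sx] := leP s x; first by rewrite (le_trans sx xy) subrr.
  by rewrite /= subr0.
rewrite E ?(ltW ab)// -(grid_sum a b (fun x => (s <= x)%R%:R) n0).
by apply: eq_bigr => k _; rewrite /cell E.
Qed.

Definition held n s w : R := \sum_(k < n) H (g n k) w * cell n k s.

Definition hold_gap n w : \bar R :=
  (\int[mu]_s (\1_(`]a, b]%classic : set R) s *
     (H (Num.max 0 s) w - held n s w) ^+ 2)%:E)%E.

Let mheld n : measurable_fun setT
  (fun p : measurableTypeR R * Omega => held n p.1 p.2).
Proof.
apply: measurable_fun_finsum => k; apply: measurable_funM.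
  apply: (@measurable_pair_right _ _ _ (H (g n k))).
  exact: (measurable_wrtW (@fm _) (sH (g0 n k))).
by apply: (@measurable_pair_left _ _ _ (cell n k)); exact: measurable_indic.
Qed.

Let mhold n : measurable_fun setT (fun p : measurableTypeR R * Omega =>
   \1_(`]a, b]%classic : set R) p.1 * (H (Num.max 0 p.1) p.2 - held n p.1 p.2) ^+ 2).
Proof.
apply: measurable_funM.
  by apply: (@measurable_pair_left _ _ _ (\1_(`]a, b]%classic))); exact: measurable_indic.
by apply: measurable_funX; apply: measurable_funB.
Qed.

Let section_measurable (F : measurableTypeR R * Omega -> R) w :
  measurable_fun setT F -> measurable_fun setT (fun s : measurableTypeR R => F (s, w)).
Proof.
move=> mF; have h : measurable_fun setT (fun s : measurableTypeR R => (s, w)).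
  exact: measurable_fun_pair.
exact: (measurableT_comp mF h).
Qed.

Let hold_ge0 n s w : 0 <= \1_(`]a, b]%classic : set R) s *
     (H (Num.max 0 s) w - held n s w) ^+ 2.
Proof. by rewrite mulr_ge0// sqr_ge0. Qed.

Lemma hold_gap_measurable n : measurable_fun setT (hold_gap n).
Proof. exact: (measurable_integral_time (mhold n)). Qed.

Let heldV n s w : `|held n s w| <= V.
Proof.
rewrite /held; have [[k kn [ks h]]|h] := step_cases (g_nd n) n s.
  by rewrite (h (fun k => H (g n k) w)); exact: HV.
by rewrite (h (fun k => H (g n k) w)) normr0.
Qed.

Let hold_bound n s w : \1_(`]a, b]%classic : set R) s *
     (H (Num.max 0 s) w - held n s w) ^+ 2 <=
   4 * V ^+ 2 * \1_(`]a, b]%classic : set R) s.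
Proof.
rewrite mulrC ler_wpM2r//.
have := heldV n s w; have := HmaxV HV s w.
rewrite !ler_norml => /andP[a1 a2] /andP[b1 b2].
rewrite -subr_ge0 (_ : _ - _ = (2 * V - (H (Num.max 0 s) w - held n s w)) *
      (2 * V + (H (Num.max 0 s) w - held n s w))); last ring.
by apply: mulr_ge0; lra.
Qed.

(** At almost every [s] the integrand is left-continuous along the path, and the grid point below
    [s] is strictly smaller and within one mesh: this is why cells are open on the left. Boundedness
    by [V] provides the dominating function. *)
Lemma hold_gap_cvg w : hold_gap n w @[n --> \oo] --> 0%E.
Proof.
have mE n : measurable_fun setT (fun s : measurableTypeR R =>
   (\1_(`]a, b]%classic : set R) s * (H (Num.max 0 s) w - held n s w) ^+ 2)%:E).
  by apply: measurable_fun_EFin; exact (section_measurable w (mhold n)).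
have [] // := @dominated_convergence _ (measurableTypeR R) R mu setT measurableT
  (fun n s => (\1_(`]a, b]%classic : set R) s *
     (H (Num.max 0 s) w - held n s w) ^+ 2)%:E) (fun=> 0%E)
  (fun s => (4 * V ^+ 2 * \1_(`]a, b]%classic : set R) s)%:E).
- have [A [mA A0 hA]] := Hleft w; exists A; split => // s /= ns; apply: hA => /= Hs.
  apply: ns => _.
  have [sab|sab] := boolP (a < s <= b); last first.
    apply: cvg_near_cst; near=> n.
    by rewrite indicE mem_setE in_itv/= (negbTE sab) mul0r.
  have /andP[as_ sb] := sab; have s0 : 0 < s by exact: le_lt_trans as_.
  apply: cvg_EFin; first by near=> n.
  apply/cvgrPdist_lt => e e0; rewrite /=.
  (* Below [1] as well as below [e], so that the square is also below [e]. *)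
  have e1 : 0 < Num.min 1 e by rewrite lt_min ltr01.
  have [del del0 hd] := Hs s0 _ e1.
  near=> n.
  have n0 : (0 < n)%N by near: n; exact: nbhs_infty_gt.
  have mesh : (b - a) / n%:R < del by near: n; exact: grid_mesh.
  rewrite sub0r normrN indicE mem_setE in_itv/= sab mul1r (max_r (ltW s0)).
  (* The cells cover []a, b]], so the alternative without an active cell is impossible; the constant
     coefficients [1] reveal this. *)
  have [[k kn [/andP[ks sk] h]]|h] := step_cases (g_nd n) n s; last first.
    have h1 : \sum_(k < n) cell n k s = 0.
      by apply: etrans (h (fun=> 1)); apply: eq_bigr => k _; rewrite mul1r.
    have := cell_cover s n0.
    by rewrite indicE mem_setE in_itv/= sab h1 => /eqP; rewrite eq_sym oner_eq0.
  rewrite /held /cell (h (fun k => H (g n k) w)).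
  have := hd (g n k) (g0 n k); rewrite distrC => /(_ _ ks).
  have sd : s - del < g n k by rewrite gridS in sk; lra.
  move=> /(_ sd); set x := _ - _; rewrite lt_min => /andP[x1 xe].
  rewrite normrX; apply: le_lt_trans xe; rewrite expr2 ler_piMl// ltW//.
- apply: integrable_realZl; apply/integrableP; split.
    by apply: measurable_fun_EFin; exact: measurable_indic.
  under eq_integral do rewrite gee0_abs ?lee_fin//.
  rewrite integral_indic//= setIT lebesgue_measure_itv/=.
  by case: ifP => _; rewrite ?ltry// -EFinB ltry.
- apply: aeW => s n _; rewrite gee0_abs ?lee_fin//.
by rewrite integral0.
Unshelve. all: by end_near. Qed.

Lemma hold_gap_bound n w : (hold_gap n w <= (4 * V ^+ 2 * (b - a))%:E)%E.
Proof.
apply: (@le_trans _ _ (\int[mu]_s (4 * V ^+ 2 * \1_(`]a, b]%classic : set R) s)%:E)%E).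
  apply: ge0_le_int.
  - exact (section_measurable w (mhold n)).
  - by apply: measurable_funM => //; exact: measurable_indic.
  - by move=> s.
  - by move=> s; exact: hold_bound.
rewrite ge0_intZl//; last by rewrite mulr_ge0// sqr_ge0.
by rewrite integral_indic//= setIT lebesgue_measure_itv/= lte_fin ab -EFinB -EFinM.
Qed.

Lemma mean_hold_gap e : 0 < e ->
  \forall n \near \oo, (\int[P]_w hold_gap n w <= e%:E)%E.
Proof.
move=> e0; have mh n := hold_gap_measurable n.
have h0 n w : (0 <= hold_gap n w)%E by apply: integral_ge0 => s _; rewrite lee_fin.
have [] // := @dominated_convergence _ Omega R P setT measurableT
  hold_gap (fun=> 0%E) (fun=> (4 * V ^+ 2 * (b - a))%:E).
- by apply: aeW => w _; exact: hold_gap_cvg.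
- exact: finite_measure_integrable_cst.
- by apply: aeW => w n _; rewrite gee0_abs//; exact: hold_gap_bound.
rewrite integral0 => _ _ /fine_cvgP[hf /cvgrPdist_le/(_ e e0) hc].
apply: filterS2 hf hc => n fn /=; rewrite sub0r normrN => hn.
have {}fn : (\int[P]_w hold_gap n w)%E \is a fin_num by exact: fn.
by rewrite -(fineK fn) lee_fin (le_trans (ler_norm _)).
Qed.

(** [X] stands for the Ito integral [I] or for one of the simple integrals approximating it; the two
    are compared at finitely many grid points. *)
Definition resid (X : R -> Omega -> R) n k w : R :=
  X (g n k.+1) w - X (g n k) w - H (g n k) w * (B (g n k.+1) w - B (g n k) w).

(** The weighted sum of residuals is itself the integral of one step integrand, so a single use of
    the isometry gives its second moment. *)
Lemma resid_isometry m n (wt : nat -> Omega -> R) (A : R) :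
  (forall k, measurable_wrt (filt (g n k)) (wt k)) ->
  (forall k w, `|wt k w| <= A) ->
  (\int[P]_w ((\sum_(k < n) wt k w * resid (simple_integral B (S' m)) n k w) ^+ 2)%:E
   = \int[P]_w \int[mu]_s ((\sum_(k < n)
        wt k w * (simple_val (S' m) s w - H (g n k) w) * cell n k s) ^+ 2)%:E)%E.
Proof.
move=> swt wtA; pose S := S' m; pose N := sp_size S; pose u := sp_time S.
pose lo (p : 'I_n * ('I_N + 'I_1)) := match p.2 with
  | inl j => cut_lo (g n p.1) (u j) | inr _ => g n p.1 end.
pose hi (p : 'I_n * ('I_N + 'I_1)) := match p.2 with
  | inl j => cut_hi (g n p.1) (g n p.1.+1) (u j) (u j.+1) | inr _ => g n p.1.+1 end.
pose cf (p : 'I_n * ('I_N + 'I_1)) w := match p.2 with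
  | inl j => sp_coef S j w | inr _ => - H (g n p.1) w end.
pose xi p w := wt (p.1 : 'I_n) w * cf p w.
have lo0 p : 0 <= lo p.
  by case: p => k [j|j]; rewrite /lo/= ?g0// le_max g0.
have lohi p : lo p <= hi p.
  by case: p => k [j|j]; rewrite /lo /hi/= ?cut_le.
have glo (p : 'I_n * ('I_N + 'I_1)) : g n p.1 <= lo p.
  by case: p => k [j|j]; rewrite /lo//= le_max lexx.
have scf p : measurable_wrt (filt (lo p)) (cf p).
  case: p => k [j|j]; rewrite /lo /cf/=.
    apply: (measurable_wrt_mono hfb _ (@sp_adapted _ _ _ _ S j)).
    by rewrite le_max lexx orbT.
  apply: (measurable_wrt_comp (g := -%R)); last exact: sH.
  exact: oppr_measurable.
have sxi p : measurable_wrt (filt (lo p)) (xi p).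
  apply: (measurable_wrtM hfb) => //.
  exact: (measurable_wrt_mono hfb (glo p) (swt _)).
have cfV p w : `|cf p w| <= V.
  by case: p => k [j|j]; rewrite /cf/= ?normrN ?HV//; exact: clip_bound.
have xiM p w : `|xi p w| <= A * V by rewrite normrM ler_pM.
transitivity (\int[P]_w ((\sum_p xi p w * (B (hi p) w - B (lo p) w)) ^+ 2)%:E)%E.
  apply: eq_integral => w _; congr (EFin (_ ^+ 2)).
  rewrite -(pair_bigA _ (fun k i => xi (k, i) w * (B (hi (k, i)) w - B (lo (k, i)) w)))/=.
  apply: eq_bigr => k _; rewrite big_sumType/= big_ord1 /resid.
  rewrite (simple_integralB B S w (g0 n k) (g_nd n k)) mulrDr mulr_sumr.
  congr (_ + _); first by apply: eq_bigr => j _; rewrite /xi /cf/= mulrA.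
  by rewrite /xi /cf /hi /lo/= -mulrA mulNr.
rewrite (@ito_isometry _ _ _ P filt B hfb _ lo hi (fun=> A * V) xi lo0 lohi sxi xiM).
apply: eq_integral => w _; apply: eq_integral => s _.
congr (EFin (_ ^+ 2)).
rewrite -(pair_bigA _ (fun k i => xi (k, i) w *
   \1_(`]lo (k, i), hi (k, i)]%classic : set R) s))/=.
apply: eq_bigr => k _; rewrite big_sumType/= big_ord1.
rewrite -mulrA mulrBl mulrBr; congr (_ + _); last first.
  by rewrite /xi /cf /hi /lo/= -mulrA mulNr mulrN.
rewrite /simple_val mulr_suml mulr_sumr; apply: eq_bigr => j _.
rewrite /xi /cf /hi /lo/= cut_indic -mulrA; congr *%R.
by rewrite /cell [in RHS]mulrAC mulrA.
Qed.

(** Majorant from [(x - z) ^+ 2 <= 2 * (x - y) ^+ 2 + 2 * (y - z) ^+ 2] with [y] the integrand: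
    approximation error and freezing error separate. *)
Let K m n s w : R := 2 * (\1_(`[0, T]%classic : set R) s *
    (simple_val (S' m) s w - H (Num.max 0 s) w) ^+ 2) +
  2 * (\1_(`]a, b]%classic : set R) s * (H (Num.max 0 s) w - held n s w) ^+ 2).

Let KE m n s w : a < s <= b -> K m n s w =
  2 * (simple_val (S' m) s w - H s w) ^+ 2 + 2 * (H s w - held n s w) ^+ 2.
Proof.
move=> /[dup] sab /andP[as_ sb].
have s0 : 0 <= s by rewrite (le_trans a0)// ltW.
rewrite /K !indicE !mem_setE !in_itv/= sab s0 (le_trans sb bT) !mul1r.
by rewrite max_r.
Qed.

Let K0 m n s w : 0 <= K m n s w.
Proof. by rewrite addr_ge0// mulr_ge0// mulr_ge0// sqr_ge0. Qed.

Let cell_in n k s : (k < n)%N -> g n k < s <= g n k.+1 -> a < s <= b.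
Proof.
move=> kn /andP[ks sk]; have /andP[ak _] := grid_in (ltW ab) (ltnW kn).
have /andP[_ kb] := grid_in (ltW ab) kn.
by rewrite (le_lt_trans ak ks) (le_trans sk kb).
Qed.

Let sum_bound m n (wt : nat -> Omega -> R) (A : R) s w :
  (forall k w, `|wt k w| <= A) ->
  (\sum_(k < n) wt k w * (simple_val (S' m) s w - H (g n k) w) * cell n k s) ^+ 2
    <= A ^+ 2 * K m n s w.
Proof.
move=> wtA; have A20 : 0 <= A ^+ 2 by exact: sqr_ge0.
have [[k kn [ks h]]|h] := step_cases (g_nd n) n s; last first.
  rewrite (h (fun k => wt k w * (simple_val (S' m) s w - H (g n k) w))).
  by rewrite expr0n mulr_ge0.
rewrite (h (fun k => wt k w * (simple_val (S' m) s w - H (g n k) w))).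
rewrite KE; last exact: cell_in kn ks.
rewrite /held (h (fun k => H (g n k) w)) exprMn.
apply: ler_pM; rewrite ?sqr_ge0//.
  rewrite -(real_normK (num_real (wt k w))) ler_sqr ?nnegrE//.
  exact: le_trans (wtA k w).
set x := simple_val _ _ _; set y := H s w; set z := H _ _.
by have : 0 <= ((x - y) - (y - z)) ^+ 2 := sqr_ge0 _; nra.
Qed.

Let mgap m : measurable_fun setT (fun p : measurableTypeR R * Omega =>
  \1_(`[0, T]%classic : set R) p.1 *
    (simple_val (S' m) p.1 p.2 - H (Num.max 0 p.1) p.2) ^+ 2).
Proof.
apply: measurable_funM.
  by apply: (@measurable_pair_left _ _ _ (\1_(`[0, T]%classic))); exact: measurable_indic.
apply: measurable_funX; apply: measurable_funB => //.
exact: (simple_val_measurable hfb).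
Qed.

Let mK m n : measurable_fun setT (fun p : measurableTypeR R * Omega => K m n p.1 p.2).
Proof.
apply: measurable_funD.
  exact: (measurable_funM (measurable_cst (2 : R)) (mgap m)).
exact: (measurable_funM (measurable_cst (2 : R)) (mhold n)).
Qed.

Let intK m n w : (\int[mu]_s (K m n s w)%:E =
  2%:E * energy_gap T H (S' m) w + 2%:E * hold_gap n w)%E.
Proof.
have m1 := section_measurable w (mgap m).
have m2 := section_measurable w (mhold n).
rewrite energy_gapE ge0_intD.
- by congr (_ + _)%E; apply: ge0_intZl => // s; rewrite mulr_ge0// sqr_ge0.
- exact: measurable_funM.
- exact: measurable_funM.
- by move=> s; rewrite mulr_ge0// mulr_ge0// sqr_ge0.
- by move=> s; rewrite mulr_ge0// mulr_ge0// sqr_ge0.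
Qed.

Let meanK m n x y : (\int[P]_w energy_gap T H (S' m) w <= x%:E)%E ->
  (\int[P]_w hold_gap n w <= y%:E)%E ->
  (\int[P]_w \int[mu]_s (K m n s w)%:E <= (2 * x + 2 * y)%:E)%E.
Proof.
move=> hx hy; under eq_integral do rewrite intK.
have e0 w : (0 <= energy_gap T H (S' m) w)%E.
  by apply: integral_ge0 => s _; rewrite lee_fin sqr_ge0.
have h0 w : (0 <= hold_gap n w)%E by apply: integral_ge0 => s _; rewrite lee_fin.
have me := energy_gap_measurable hfb T mH (S' m).
have mh := hold_gap_measurable n.
rewrite ge0_integralD//; last 4 first.
- by move=> w _; rewrite mule_ge0.
- exact: measurable_funeM.
- by move=> w _; rewrite mule_ge0.
- exact: measurable_funeM.
rewrite ge0_integralZl// ge0_integralZl//.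
rewrite [(2 * x + 2 * y)%:E]EFinD [(2 * x)%:E]EFinM [(2 * y)%:E]EFinM.
by apply: leeD; apply: lee_wpmul2l.
Qed.

Lemma resid_weighted_L2 m n (wt : nat -> Omega -> R) (A x y : R) :
  (forall k, measurable_wrt (filt (g n k)) (wt k)) ->
  (forall k w, `|wt k w| <= A) ->
  (\int[P]_w energy_gap T H (S' m) w <= x%:E)%E ->
  (\int[P]_w hold_gap n w <= y%:E)%E ->
  (\int[P]_w ((\sum_(k < n) wt k w * resid (simple_integral B (S' m)) n k w) ^+ 2)%:E
   <= (A ^+ 2 * (2 * x + 2 * y))%:E)%E.
Proof.
move=> swt wtA hx hy; rewrite (resid_isometry m swt wtA).
have mwt k := measurable_wrtW (@fm _) (swt k).
have A20 : 0 <= A ^+ 2 by exact: sqr_ge0.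
have mF : measurable_fun setT (fun p : measurableTypeR R * Omega => (\sum_(k < n)
   wt k p.2 * (simple_val (S' m) p.1 p.2 - H (g n k) p.2) * cell n k p.1) ^+ 2).
  apply: measurable_funX; apply: measurable_fun_finsum => k.
  apply: measurable_funM; last first.
    by apply: (@measurable_pair_left _ _ _ (cell n k)); exact: measurable_indic.
  apply: measurable_funM; first exact: (@measurable_pair_right _ _ _ (wt k)).
  apply: measurable_funB; first exact: (simple_val_measurable hfb).
  apply: (@measurable_pair_right _ _ _ (H (g n k))).
  exact: (measurable_wrtW (@fm _) (sH (g0 n k))).
apply: (@le_trans _ _ (\int[P]_w ((A ^+ 2)%:E * \int[mu]_s (K m n s w)%:E))%E).
  apply: ge0_le_integral => //.
  - by move=> w _; apply: integral_ge0 => s _; rewrite lee_fin sqr_ge0.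
  - apply: (measurable_integral_time mF).
    by move=> s w; exact: sqr_ge0.
  - apply: measurable_funeM; apply: (measurable_integral_time (mK m n)).
    by move=> s w; exact: K0.
  - move=> w _; rewrite -ge0_intZl//; last exact: (section_measurable w (mK m n)).
    apply: ge0_le_int.
    + exact: (section_measurable w mF).
    + by apply: measurable_funM => //; exact: (section_measurable w (mK m n)).
    + by move=> s; exact: sqr_ge0.
    + by move=> s; exact: sum_bound.
rewrite ge0_integralZl//.
- by rewrite [(A ^+ 2 * _)%:E]EFinM; apply: lee_wpmul2l => //; exact: meanK.
- apply: (measurable_integral_time (mK m n)).
  by move=> s w; exact: K0.
- by move=> w _; apply: integral_ge0 => s _; rewrite lee_fin K0.
Qed.

Let mresid X n k : (forall t, 0 <= t -> measurable_fun setT (X t)) ->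
  measurable_fun setT (resid X n k).
Proof.
move=> mX; apply: measurable_funB.
  by apply: measurable_funB; apply: mX; exact: g0.
apply: measurable_funM; first exact: (measurable_wrtW (@fm _) (sH (g0 n k))).
by apply: measurable_funB; apply: (fb_measurable_at hfb); exact: g0.
Qed.

Let msimple m t : 0 <= t -> measurable_fun setT (simple_integral B (S' m) t).
Proof. exact: (simple_integral_measurable hfb). Qed.

Lemma resid_square_mean m n (x y : R) :
  (\int[P]_w energy_gap T H (S' m) w <= x%:E)%E ->
  (\int[P]_w hold_gap n w <= y%:E)%E ->
  (\int[P]_w (\sum_(k < n) resid (simple_integral B (S' m)) n k w ^+ 2)%:E
   <= (2 * x + 2 * y)%:E)%E.
Proof.
move=> hx hy; pose X := simple_integral B (S' m).
pose f (k : 'I_n) s w := ((simple_val (S' m) s w - H (g n k) w) * cell n k s) ^+ 2.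
have f0 k s w : 0 <= f k s w by exact: sqr_ge0.
have mf k : measurable_fun setT (fun p : measurableTypeR R * Omega => f k p.1 p.2).
  apply: measurable_funX; apply: measurable_funM; last first.
    by apply: (@measurable_pair_left _ _ _ (cell n k)); exact: measurable_indic.
  apply: measurable_funB; first exact: (simple_val_measurable hfb).
  apply: (@measurable_pair_right _ _ _ (H (g n k))).
  exact: (measurable_wrtW (@fm _) (sH (g0 n k))).
have one (k : 'I_n) : (\int[P]_w (resid X n k w ^+ 2)%:E
    = \int[P]_w \int[mu]_s (f k s w)%:E)%E.
  (* A weight equal to [1] on cell [k] and to [0] elsewhere isolates one residual, to which the
     isometry for weighted sums applies. *)
  pose wt (j : nat) (_ : Omega) : R := (j == k)%:R.
  have swt j : measurable_wrt (filt (g n j)) (wt j).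
    by apply/(measurable_wrtP _ (fb_sigma hfb _)); exact: measurable_cst.
  have wt1 j w : `|wt j w| <= 1 by rewrite /wt; case: (_ == _); rewrite ?normr1 ?normr0.
  have pick (c : 'I_n -> R) (w : Omega) : \sum_(j < n) wt j w * c j = c k.
    rewrite (bigD1 k)//= big1 ?addr0; first by rewrite /wt eqxx mul1r.
    by move=> j jk; rewrite /wt -(inj_eq val_inj) /= in jk *; rewrite (negbTE jk) mul0r.
  transitivity (\int[P]_w ((\sum_(j < n) wt j w * resid X n j w) ^+ 2)%:E)%E.
    by apply: eq_integral => w _; rewrite (pick (fun j => resid X n j w)).
  rewrite (resid_isometry m swt wt1).
  apply: eq_integral => w _; apply: eq_integral => s _.
  under eq_bigr do rewrite -mulrA.
  by rewrite (pick (fun j => (simple_val (S' m) s w - H (g n j) w) * cell n j s)).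
under eq_integral do rewrite -sumEFin.
rewrite ge0_integral_sum//; last 2 first.
- move=> k; apply: measurable_fun_EFin; apply: measurable_funX.
  by apply: mresid => t t0; exact: msimple.
- by move=> k w _; rewrite lee_fin sqr_ge0.
under eq_bigr do rewrite one.
rewrite -ge0_integral_sum//; last 2 first.
- by move=> k; apply: (measurable_integral_time (mf k)) => s w; exact: f0.
- by move=> k w _; apply: integral_ge0 => s _; rewrite lee_fin.
apply: le_trans (meanK hx hy); apply: ge0_le_integral => //.
- move=> w _; apply: sume_ge0 => k _.
  by apply: integral_ge0 => s _; rewrite lee_fin.
- apply: emeasurable_sum => k.
  by apply: (measurable_integral_time (mf k)) => s w; exact: f0.
- by apply: (measurable_integral_time (mK m n)) => s w; exact: K0.
- move=> w _; rewrite -ge0_integral_sum//; last 2 first.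
  + by move=> k; apply: measurable_fun_EFin; exact (section_measurable w (mf k)).
  + by move=> k s _; rewrite lee_fin.
  under eq_integral do rewrite sumEFin.
  apply: ge0_le_int.
  + apply: measurable_fun_finsum => k; exact (section_measurable w (mf k)).
  + exact (section_measurable w (mK m n)).
  + by move=> s; apply: sumr_ge0.
  + move=> s; rewrite /f; under eq_bigr do rewrite exprMn.
    have cell2 k : cell n k s ^+ 2 = cell n k s.
      by rewrite /cell indicE -natrX; case: (_ \in _).
    under eq_bigr do rewrite cell2.
    have [[k kn [ks h]]|h] := step_cases (g_nd n) n s; last first.
      by rewrite (h (fun k => (simple_val (S' m) s w - H (g n k) w) ^+ 2)).
    rewrite (h (fun k => (simple_val (S' m) s w - H (g n k) w) ^+ 2)).
    rewrite KE; last exact: cell_in kn ks.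
    rewrite /held (h (fun k => H (g n k) w)).
    set x' := simple_val _ _ _; set y' := H s w; set z' := H _ _.
    by have : 0 <= ((x' - y') - (y' - z')) ^+ 2 := sqr_ge0 _; nra.
Qed.

Let close t : 0 <= t <= T ->
  small_in_proba P (fun n w => simple_integral B (S' n) t w - I t w).
Proof. exact: clip_integral_cvg. Qed.

Let residB m n k w : resid I n k w - resid (simple_integral B (S' m)) n k w =
  -1 * (simple_integral B (S' m) (g n k.+1) w - I (g n k.+1) w)
  + (simple_integral B (S' m) (g n k) w - I (g n k) w).
Proof. by rewrite /resid; ring. Qed.

Let gT n k : (k <= n)%N -> 0 <= g n k <= T.
Proof.
move=> kn; have /andP[_ kb] := grid_in (ltW ab) kn.
by rewrite g0 (le_trans kb bT).
Qed.

Let resid_close n (k : 'I_n) : small_in_proba P (fun m w =>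
  resid I n k w - resid (simple_integral B (S' m)) n k w).
Proof.
under [X in small_in_proba _ X]eq_fun do under eq_fun do rewrite residB.
have mD t m : 0 <= t -> measurable_fun setT (fun w =>
    simple_integral B (S' m) t w - I t w).
  by move=> t0; apply: measurable_funB; [exact: msimple|exact: mI].
apply: small_in_probaD => [m|m||].
- by apply: measurable_funM => //; exact: mD.
- exact: mD.
- by apply: small_in_probaZ => [m|]; [exact: mD|exact: close (gT (ltn_ord k))].
- exact: close (gT (ltnW (ltn_ord k))).
Qed.

(** Two limits in the right order: the mesh [n] is fixed first, making the freezing error small;
    then [m] is taken large depending on [n], which replaces [I] by a clipped simple integral at the
    finitely many grid points. The isometry is used for that [m] only. *)
Theorem ito_weighted_residuals (wt : R -> Omega -> R) (A : R) :
  (forall s, 0 <= s -> measurable_wrt (filt s) (wt s)) ->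
  (forall s w, 0 <= s -> `|wt s w| <= A) ->
  small_in_proba P (fun n w => \sum_(k < n) wt (g n k) w * resid I n k w).
Proof.
move=> swt wtA e eta e0 eta0.
have A0 : 0 <= A.
  have [w _] : [set: Omega] !=set0.
    apply/set0P/eqP => O0; have := probability_setT P.
    by rewrite O0 measure0 => /esym/eqP; rewrite eqe oner_eq0.
  exact: le_trans (wtA 0 w (lexx 0)).
have e20 : 0 < e / 2 by rewrite divr_gt0.
have eta20 : 0 < eta / 2 by rewrite divr_gt0.
(* Chosen so that [A ^+ 2 * (2 * c + 2 * c)] is at most [(e / 2) ^+ 2 * (eta / 2)]; the added [1]
   covers [A = 0]. *)
pose c := (e / 2) ^+ 2 * (eta / 2) / (4 * (A ^+ 2 + 1)).
have A1 : 0 < A ^+ 2 + 1 by rewrite ltr_wpDl// sqr_ge0.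
have c0 : 0 < c by rewrite divr_gt0 ?mulr_gt0 ?exprn_gt0.
apply: filterS (mean_hold_gap c0) => n hy.
pose W m w := \sum_(k < n) wt (g n k) w * resid (simple_integral B (S' m)) n k w.
pose D m w := \sum_(k < n) wt (g n k) w *
  (resid I n k w - resid (simple_integral B (S' m)) n k w).
have mwt k := measurable_wrtW (@fm _) (swt _ (g0 n k)).
have mRI k : measurable_fun setT (resid I n k) by apply: mresid => t t0; exact: mI.
have mRS m k : measurable_fun setT (resid (simple_integral B (S' m)) n k).
  by apply: mresid => t t0; exact: msimple.
have mW m : measurable_fun setT (W m).
  by apply: measurable_fun_finsum => k; exact: measurable_funM.
have mD m : measurable_fun setT (D m).
  apply: measurable_fun_finsum => k; apply: measurable_funM => //.
  exact: measurable_funB.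
have D0 : small_in_proba P D.
  apply: small_in_proba_sum => [k m|k].
    by apply: measurable_funM => //; exact: measurable_funB.
  apply: (@small_in_proba_le _ _ _ _ _ (fun m w =>
    A * (resid I n k w - resid (simple_integral B (S' m)) n k w))) => [m|m|m w|].
  - by apply: measurable_funM => //; exact: measurable_funB.
  - by apply: measurable_funM => //; exact: measurable_funB.
  - by rewrite !normrM (ger0_norm A0) ler_wpM2r// wtA// g0.
  - apply: small_in_probaZ => [m|]; first exact: measurable_funB.
    exact: resid_close.
have [m [hx hD]] := @filter_ex _ \oo _ _
  (filterI (mean_energy_gap hfb V0 T0 HV mH gap0 c0) (D0 _ _ e20 eta20)).
have hW := resid_weighted_L2 (fun k => swt _ (g0 n k)) (fun k w => wtA _ w (g0 n k)) hx hy.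
have hP := chebyshev_square (mW m) e20 hW.
rewrite [eta]splitr EFinD.
apply: (@le_trans _ _ (P (large (W m) (e / 2)) + P (large (D m) (e / 2)))%E).
  apply: le_probaU; try exact: measurable_large.
    by apply: measurable_large; apply: measurable_fun_finsum => k; exact: measurable_funM.
  have E w : \sum_(k < n) wt (g n k) w * resid I n k w = W m w + D m w.
    by rewrite -big_split; apply: eq_bigr => k _ /=; ring.
  move=> w; rewrite /large/= E => ew; apply: contrapT => /not_orP[/negP].
  rewrite -ltNge => h3 /negP; rewrite -ltNge => h4; move: ew; apply/negP.
  by rewrite -ltNge (le_lt_trans (ler_normD _ _))// [e]splitr ltrD.
apply: leeD => //; apply: le_trans hP _; rewrite lee_fin ler_pdivrMr ?exprn_gt0//.
have -> : A ^+ 2 * (2 * c + 2 * c) = (eta / 2 * (e / 2) ^+ 2) * (A ^+ 2 / (A ^+ 2 + 1)).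
  by rewrite /c; field; exact: lt0r_neq0.
rewrite ler_piMr//; first by rewrite mulr_ge0 ?sqr_ge0// ltW.
by rewrite ler_pdivrMr// mul1r lerDl.
Qed.

(** Same order of limits. Squares of sums cost a factor [2] on each part, so both parts are allowed
    [e / 4]. *)
Theorem ito_square_residuals :
  small_in_proba P (fun n w => \sum_(k < n) resid I n k w ^+ 2).
Proof.
move=> e eta e0 eta0.
have e40 : 0 < e / 4 by rewrite divr_gt0.
have eta20 : 0 < eta / 2 by rewrite divr_gt0.
pose c := (e / 4) * (eta / 2) / 4.
have c0 : 0 < c by rewrite divr_gt0 ?mulr_gt0.
apply: filterS (mean_hold_gap c0) => n hy.
pose W m w := \sum_(k < n) resid (simple_integral B (S' m)) n k w ^+ 2.
pose D m w := \sum_(k < n)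
  (resid I n k w - resid (simple_integral B (S' m)) n k w) ^+ 2.
have mRI k : measurable_fun setT (resid I n k) by apply: mresid => t t0; exact: mI.
have mRS m k : measurable_fun setT (resid (simple_integral B (S' m)) n k).
  by apply: mresid => t t0; exact: msimple.
have mW m : measurable_fun setT (W m).
  by apply: measurable_fun_finsum => k; exact: measurable_funX.
have mD m : measurable_fun setT (D m).
  apply: measurable_fun_finsum => k; apply: measurable_funX.
  exact: measurable_funB.
have D0 : small_in_proba P D.
  apply: small_in_proba_sum => [k m|k].
    by apply: measurable_funX; exact: measurable_funB.
  apply: small_in_proba_sqr => [m|]; first exact: measurable_funB.
  exact: resid_close.
have [m [hx hD]] := @filter_ex _ \oo _ _
  (filterI (mean_energy_gap hfb V0 T0 HV mH gap0 c0) (D0 _ _ e40 eta20)).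
have hW := resid_square_mean hx hy.
have W0 w : 0 <= W m w by apply: sumr_ge0 => k _; exact: sqr_ge0.
have Dm0 w : 0 <= D m w by apply: sumr_ge0 => k _; exact: sqr_ge0.
have hP := markov_ge0 (mW m) W0 e40 hW.
rewrite [eta]splitr EFinD.
apply: (@le_trans _ _ (P (large (W m) (e / 4)) + P (large (D m) (e / 4)))%E).
  apply: le_probaU; try exact: measurable_large.
    by apply: measurable_large; apply: measurable_fun_finsum => k; exact: measurable_funX.
  have E w : \sum_(k < n) resid I n k w ^+ 2 <= 2 * W m w + 2 * D m w.
    rewrite !mulr_sumr -big_split; apply: ler_sum => k _ /=.
    set x := resid I _ _ _; set y := resid _ _ _ _.
    by have : 0 <= (x - 2 * y) ^+ 2 := sqr_ge0 _; nra.
  move=> w; rewrite /large/= ger0_norm; last by apply: sumr_ge0 => k _; exact: sqr_ge0.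
  move=> ew; apply: contrapT => /not_orP[/negP].
  rewrite -ltNge => h3 /negP; rewrite -ltNge => h4; move: ew; apply/negP.
  rewrite ger0_norm// in h3; rewrite ger0_norm// in h4.
  by rewrite -ltNge (le_lt_trans (E w))//; lra.
apply: leeD => //; apply: le_trans hP _; rewrite lee_fin ler_pdivrMr//.
by rewrite /c; lra.
Qed.

End grid_sums.

Section grid_quadratic_variation.
Context d (Omega : measurableType d) (R : realType) (P : probability Omega R).
Context (filt : R -> set (set Omega)) (B : R -> Omega -> R).
Hypothesis hfb : filtered_brownian P filt B.
Variables (a b : R).
Hypotheses (a0 : 0 <= a) (ab : a < b).
Local Notation g := (grid a b).

(** The second moment is of order [(b - a) ^+ 2 / n], which is what the squared cell lengths add up
    to. *)
Theorem brownian_quadratic_variation (wt : R -> Omega -> R) (A : R) :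
  (forall s, 0 <= s -> measurable_wrt (filt s) (wt s)) ->
  (forall s w, 0 <= s -> `|wt s w| <= A) ->
  small_in_proba P (fun n w => \sum_(k < n) wt (g n k) w *
    ((B (g n k.+1) w - B (g n k) w) ^+ 2 - (g n k.+1 - g n k))).
Proof.
move=> swt wtA.
have g0 n k : 0 <= g n k.
  by rewrite (le_trans a0)// -{1}(grid0 a b n) grid_le// ltW.
have g_nd n k : g n k <= g n k.+1 by apply: grid_le => //; exact: ltW.
apply: (@small_in_proba_L2 _ _ _ _ _
  (fun n => 130 * A ^+ 2 * (b - a) ^+ 2 * n%:R^-1)).
- move=> n; apply: measurable_fun_finsum => k; apply: measurable_funM.
    apply: (measurable_wrtW (@fb_measurable _ _ _ _ _ _ hfb _)); exact: swt (g0 n k).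
  apply: measurable_funB => //; apply: measurable_funX.
  exact: (fb_incr_measurable hfb).
- move=> n; apply: le_trans.
    exact: (quadratic_variation_L2 hfb n (g0 n 0%N) (g_nd n)
      (fun k => swt _ (g0 n k)) (fun k w => wtA _ w (g0 n k))).
  rewrite lee_fin; case: n => [|n].
    by rewrite big_ord0 mulr_ge0 ?invr_ge0// mulr_ge0 ?sqr_ge0// mulr_ge0 ?sqr_ge0.
  under eq_bigr do rewrite gridS addrAC subrr add0r.
  rewrite sumr_const card_ord -[leLHS]mulr_natr.
  have : n.+1%:R != 0 :> R by rewrite pnatr_eq0.
  move: (n.+1%:R : R) => m m0.
  by rewrite le_eqVlt; apply/orP; left; apply/eqP; field.
- rewrite -[X in _ --> X](mulr0 (130 * A ^+ 2 * (b - a) ^+ 2)).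
  apply: cvgM; first exact: cvg_cst.
  rewrite -cvg_shiftS; exact: cvg_harmonic.
Qed.

End grid_quadratic_variation.

Section infinitely_often.
Context d (Omega : measurableType d) (R : realType) (P : probability Omega R).

(** The event that [Z n] stays large for all [n >= N] is no more likely than each single one of
    them, hence null. Recurrent smallness on one full event is all that the pathwise arguments need;
    no subsequence is extracted. *)
Lemma small_in_proba_often (Z : nat -> Omega -> R) :
  (forall n, measurable_fun setT (Z n)) -> small_in_proba P Z ->
  {ae P, forall w, forall (e : R) (N : nat), 0 < e ->
    exists2 n, (N <= n)%N & `|Z n w| < e}.
Proof.
move=> mZ h.
pose bad p N := \bigcap_(n in [set n | (N <= n)%N]) large (Z n) p.+1%:R^-1.
have mbad p N : measurable (bad p N).
  apply: bigcap_measurable; first by exists N => /=.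
  by move=> n _; exact: measurable_large.
have bad0 p N : P (bad p N) = 0%E.
  apply/eqP; rewrite eq_le measure_ge0 andbT; apply/lee_addgt0Pr => eta eta0.
  rewrite add0e.
  have p0 : 0 < p.+1%:R^-1 :> R by rewrite invr_gt0.
  have [n [Nn hn]] := @filter_ex _ \oo _ _
    (filterI (nbhs_infty_ge N) (h _ _ p0 eta0)).
  apply: le_trans hn; apply: le_proba => //; first exact: measurable_large.
  by move=> w; apply.
have : P.-negligible (\bigcup_p \bigcup_N bad p N).
  apply: negligible_bigcup => p; apply: negligible_bigcup => N.
  exists (bad p N); split; [exact: mbad|exact: bad0|by []].
apply: negligibleS => w /= /existsNP[e /existsNP[N /not_implyP[e0 nex]]].
have [p pe] : exists p : nat, p.+1%:R^-1 < e.
  have := @near_infty_natSinv_lt R (PosNum e0) => /= H.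
  by have [m hm] := @filter_ex _ \oo _ _ H; exists m.
exists p => //; exists N => // n /= Nn; rewrite /large/= leNgt.
by apply/negP => h1; apply: nex; exists n => //; exact: lt_trans pe.
Qed.

End infinitely_often.

(** * Change of variables along a path *)

Section change_of_variable.
Context {R : realType}.
Local Notation mu := (@lebesgue_measure R).

(* A pathwise change of variables in the manner of Foellmer: [Y] has a second
   order expansion along the path [x], with coefficients [tau], [p], [r]. *)
Lemma change_of_variable (Y x f tau p r beta c : R -> R) (a b L Q : R) :
  0 <= a -> a < b -> 0 <= L -> 0 <= Q ->
  continuous_path x -> continuous_path tau -> continuous_path p ->
  continuous_path r -> continuous_path beta -> continuous_path c ->
  (forall u v, a <= u <= b -> a <= v <= b ->
    `|Y v - Y u - tau u * (v - u) - p u * (x v - x u)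
      - 2^-1 * r u * (x v - x u) ^+ 2|
    <= L * ((v - u) ^+ 2 + `|x v - x u| * `|v - u| + `|x v - x u| ^+ 3)) ->
  (forall (e : R) (N : nat), 0 < e -> exists n, [/\ (N <= n)%N,
     `|\sum_(k < n) (p (grid a b n k) *
         (x (grid a b n k.+1) - x (grid a b n k)
          - beta (grid a b n k) * ((b - a) / n%:R))
         - (f (grid a b n k.+1) - f (grid a b n k)))| <= e,
     `|\sum_(k < n) r (grid a b n k) *
         ((x (grid a b n k.+1) - x (grid a b n k)) ^+ 2
          - c (grid a b n k) * ((b - a) / n%:R))| <= e &
     \sum_(k < n) (x (grid a b n k.+1) - x (grid a b n k)) ^+ 2 <= Q]) ->
  Y b - Y a = \int[mu]_(u in `[a, b])
      (tau u + p u * beta u + 2^-1 * (r u * c u)) + (f b - f a).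
Proof.
move=> a0 ab L0 Q0 cx ctau cp cr cbeta cc taylor approx.
pose phi u := tau u + p u * beta u + 2^-1 * (r u * c u).
have cphi : continuous_path phi.
  apply: continuous_pathD.
    by apply: continuous_pathD => //; exact: continuous_pathM.
  apply: continuous_pathM; last exact: continuous_pathM.
  by move=> u; exact: cvg_cst.
rewrite -/phi; apply/eqP; rewrite -subr_eq0 -normr_le0.
apply/ler_addgt0Pr => e0 e00; rewrite add0r.
(* Sum of the multiples of [e] in the final estimate: Taylor remainders, first-order sum,
   second-order sum and Riemann sum. *)
pose W := 1 + 2 * L * (b - a) + L * Q + (b - a) + 2.
have ba0 : 0 < b - a by rewrite subr_gt0.
have W0 : 0 < W.
  have h1 : 0 <= 2 * L * (b - a) by rewrite mulr_ge0 ?mulr_ge0// ltW.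
  by have h2 : 0 <= L * Q by [exact: mulr_ge0]; rewrite /W; lra.
pose e := e0 / W.
have e1 : 0 < e by rewrite divr_gt0.
have [del del0 hdel] := continuous_path_uniform b cx e1.
have ab' := ltW ab.
have [N _ HN] : \forall n \near \oo, [/\ (0 < n)%N, (b - a) / n%:R < del,
   (b - a) / n%:R < e &
   `|\int[mu]_(u in `[a, b]) phi u
      - \sum_(k < n) phi (grid a b n k) * ((b - a) / n%:R)| <= e * (b - a)].
  near=> n; split; near: n.
  - exact: nbhs_infty_gt.
  - exact: grid_mesh.
  - exact: grid_mesh.
  - exact: riemann_sum.
have [n [Nn hA hB hC]] := approx e N e1.
have [n0 mdel me hR] := HN n Nn.
pose g k := grid a b n k; pose D := (b - a) / n%:R; pose X k := x (g k.+1) - x (g k).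
have D0 : 0 <= D by rewrite divr_ge0// ltW.
have gS k : g k.+1 - g k = D by rewrite /g gridS addrAC subrr add0r.
have gin k : (k <= n)%N -> a <= g k <= b by exact: grid_in.
have gin0 k : (k <= n)%N -> 0 <= g k <= b.
  by move=> /gin/andP[ak ->]; rewrite (le_trans a0 ak).
have Xe k : (k < n)%N -> `|X k| < e.
  move=> kn; apply: hdel; [exact: gin0|exact: gin0 (ltnW kn)|].
  by rewrite gS ger0_norm.
pose err k := Y (g k.+1) - Y (g k) - tau (g k) * D - p (g k) * X k
      - 2^-1 * r (g k) * X k ^+ 2.
(* In each term of the remainder one factor is worth [e], by uniform continuity and the small mesh;
   what multiplies it has bounded sums. *)
have herr (k : 'I_n) : `|err k| <= L * (2 * e * D + e * X k ^+ 2).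
  have kn := ltn_ord k.
  have := taylor _ _ (gin _ (ltnW kn)) (gin _ kn); rewrite gS -/(X k) => h.
  apply: le_trans h _; rewrite ler_wpM2l// (ger0_norm D0).
  have h1 : D ^+ 2 <= e * D by rewrite expr2 ler_wpM2r// ltW.
  have h2 : `|X k| * D <= e * D by rewrite ler_wpM2r// ltW// Xe.
  have h3 : `|X k| ^+ 3 <= e * X k ^+ 2.
    by rewrite exprS real_normK ?num_real// ler_wpM2r ?sqr_ge0// ltW// Xe.
  by lra.
(* The expansion summed over the grid: remainder, first-order error, second-order error, drift sum
   and increment of [f]. *)
have YE : Y b - Y a = \sum_(k < n) err k
    + \sum_(k < n) (p (g k) * (X k - beta (g k) * D) - (f (g k.+1) - f (g k)))
    + 2^-1 * \sum_(k < n) r (g k) * (X k ^+ 2 - c (g k) * D)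
    + \sum_(k < n) phi (g k) * D + \sum_(k < n) (f (g k.+1) - f (g k)).
  rewrite -(grid_sum a b Y n0) mulr_sumr -!big_split; apply: eq_bigr => k _.
  by rewrite /= /err /phi /g; ring.
have -> : Y b - Y a - (\int[mu]_(u in `[a, b]) phi u + (f b - f a)) =
  \sum_(k < n) err k
    + \sum_(k < n) (p (g k) * (X k - beta (g k) * D) - (f (g k.+1) - f (g k)))
    + 2^-1 * \sum_(k < n) r (g k) * (X k ^+ 2 - c (g k) * D)
    - (\int[mu]_(u in `[a, b]) phi u - \sum_(k < n) phi (g k) * D).
  by rewrite YE (grid_sum a b f n0); ring.
have Serr : `|\sum_(k < n) err k| <= e * (2 * L * (b - a) + L * Q).
  apply: le_trans (ler_norm_sum _ _ _) _.
  apply: le_trans (ler_sum _ (fun k _ => herr k)) _.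
  rewrite -mulr_sumr big_split/= sumr_const card_ord -mulr_sumr.
  have -> : (2 * e * D) *+ n = 2 * e * (b - a).
    by rewrite -mulr_natr /D; field; rewrite pnatr_eq0 -lt0n.
  have : e * \sum_(i < n) X i ^+ 2 <= e * Q by rewrite ler_wpM2l// ltW.
  move=> h; rewrite [leRHS](_ : _ = L * (2 * e * (b - a) + e * Q)); last ring.
  by rewrite ler_wpM2l// lerD2l.
have -> : e0 = e * (2 * L * (b - a) + L * Q) + e + 2 * e + e * (b - a).
  by rewrite /e /W; field; rewrite /W in W0; exact: lt0r_neq0.
apply: le_trans (ler_normB _ _) _; apply: lerD => //.
apply: le_trans (ler_normD _ _) _; apply: lerD.
  by apply: le_trans (ler_normD _ _) _; apply: lerD.
rewrite normrM gtr0_norm ?invr_gt0//.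
have := normr_ge0 (\sum_(k < n) r (g k) * (X k ^+ 2 - c (g k) * D)).
move: hB; rewrite -/g -/D => hB h0.
by rewrite mulrC ler_pdivrMr//; apply: le_trans hB _; lra.
Unshelve. all: by end_near. Qed.

End change_of_variable.

(** * The Lamperti transform *)

Section calculus.
Context {R : realType}.
Local Notation mu := (@lebesgue_measure R).
Implicit Types (f g df : R -> R) (a b c k x y z e M : R).

Lemma is_derive_quotient f u k :
  (forall e, 0 < e -> exists2 del, 0 < del & forall s : R, s != u -> `|s - u| < del ->
     `|(f s - f u) / (s - u) - k| < e) -> is_derive u 1 f k.
Proof.
move=> h.
have H : (r^-1 *: ((f \o shift u) (r *: (1 : R)) - f u)) @[r --> 0^'] --> k.
  apply/cvgrPdist_lt => e /h[del del0 hd].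
  apply/nbhs_ballP; exists del => // r; rewrite /ball/= sub0r normrN => rd r0.
  have -> : r%:A = r :> R by rewrite /GRing.scale/= mulr1.
  rewrite distrC /GRing.scale/= mulrC.
  by have := hd (r + u); rewrite addrK -subr_eq0 addrK; apply.
by apply: DeriveDef; [apply/cvg_ex; exists k|apply: cvg_lim].
Qed.

Lemma mean_value_bound f df a b k M : a <= b ->
  (forall z, a < z < b -> is_derive z 1 f (df z)) ->
  {within `[a, b], continuous f} ->
  (forall z, a <= z <= b -> `|df z - k| <= M) ->
  `|f b - f a - k * (b - a)| <= M * (b - a).
Proof.
move=> ab fd fc h.
have fd' z : z \in `]a, b[ -> is_derive z 1 f (df z) by rewrite in_itv; exact: fd.
have [c cab ->] := MVT_segment ab fd' fc.
rewrite -mulrBl normrM (ger0_norm (x := b - a)) ?subr_ge0//.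
by rewrite ler_wpM2r ?subr_ge0// h//; move: cab; rewrite in_itv.
Qed.

Lemma within_continuousW f (A : set R) : continuous f -> {within A, continuous f}.
Proof. exact: continuous_subspaceT. Qed.

Lemma mean_value_bound_line f df x y k M : (forall z, is_derive z 1 f (df z)) ->
  (forall z, `|z - x| <= `|y - x| -> `|df z - k| <= M) ->
  `|f y - f x - k * (y - x)| <= M * `|y - x|.
Proof.
move=> fd h.
have fc : continuous f.
  by move=> z; apply/differentiable_continuous/derivable1_diffP; case: (fd z).
have [xy|/ltW yx] := leP x y.
  rewrite (ger0_norm (x := y - x)) ?subr_ge0//.
  apply: mean_value_bound => // [|z /andP[xz zy]].
  - exact: within_continuousW.
  - by apply: h; rewrite !ger0_norm ?subr_ge0// lerD2r.
rewrite (ler0_norm (x := y - x)) ?subr_le0// opprB -normrN.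
have -> : - (f y - f x - k * (y - x)) = f x - f y - k * (x - y) by ring.
apply: mean_value_bound => // [|z /andP[yz zx]].
- exact: within_continuousW.
- by apply: h; rewrite !ler0_norm ?subr_le0//; lra.
Qed.

(** Mean value estimate for [f] minus its second-order polynomial, whose derivative is the
    first-order remainder of [df]. *)
Lemma taylor2_line f df ddf x y k M : (forall z, is_derive z 1 f (df z)) ->
  (forall z, `|z - x| <= `|y - x| -> `|df z - df x - ddf * (z - x)| <= M) ->
  k = 2^-1 * ddf ->
  `|f y - f x - df x * (y - x) - k * (y - x) ^+ 2| <= M * `|y - x|.
Proof.
move=> fd h ->.
pose phi z := f z - df x * (z - x) - 2^-1 * ddf * (z - x) ^+ 2.
have phid z : is_derive z 1 phi (df z - df x - ddf * (z - x)).
  have h0 := fd z.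
  rewrite /phi; apply: is_derive_eq; rewrite /GRing.scale/=.
  by rewrite !(subr0, addr0, mulr1, mulr0, add0r); field.
have := mean_value_bound_line (k := 0) phid (x := x) (y := y) (M := M).
rewrite mul0r subr0; have -> : phi y - phi x
  = f y - f x - df x * (y - x) - 2^-1 * ddf * (y - x) ^+ 2 by rewrite /phi; ring.
by apply => z zx; rewrite subr0; exact: h.
Qed.

Lemma continuous_itv_integrable f a b : continuous f ->
  mu.-integrable `[a, b] (EFin \o f).
Proof.
move=> cf; apply: continuous_compact_integrable; first exact: segment_compact.
exact: within_continuousW.
Qed.

(** With a common lower point [m], oriented integrals become differences and their sign cases
    disappear. *)
Lemma oriented_integralE f m a b : continuous f -> m <= a -> m <= b ->
  oriented_integral a b f
    = \int[mu]_(x in `[m, b]) f x - \int[mu]_(x in `[m, a]) f x.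
Proof.
move=> cf ma mb; rewrite /oriented_integral; case: ifPn => [ab|].
  rewrite (Rintegral_itv_split ma ab); last exact: continuous_itv_integrable.
  by rewrite addrAC subrr add0r.
rewrite -ltNge => /ltW ba.
rewrite (Rintegral_itv_split mb ba); last exact: continuous_itv_integrable.
by rewrite opprD addrA subrr add0r.
Qed.

Lemma oriented_integral_chasles f a b c : continuous f ->
  oriented_integral a b f + oriented_integral b c f = oriented_integral a c f.
Proof.
move=> cf; pose m := Num.min a (Num.min b c).
have ma : m <= a by rewrite ge_min lexx.
have mb : m <= b by rewrite !ge_min lexx orbT.
have mc : m <= c by rewrite !ge_min lexx !orbT.
by rewrite !(oriented_integralE (m := m))//; ring.
Qed.

Lemma oriented_integral_close f a b c e : continuous f ->
  (forall z, `|z - a| <= `|b - a| -> `|f z - c| <= e) ->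
  `|oriented_integral a b f - c * (b - a)| <= e * `|b - a|.
Proof.
move=> cf h; rewrite /oriented_integral; case: ifPn => [ab|].
  rewrite (ger0_norm (x := b - a)) ?subr_ge0//.
  apply: Rintegral_itv_close => //; first exact: continuous_itv_integrable.
  by move=> z /andP[az zb]; apply: h; rewrite !ger0_norm ?subr_ge0// lerD2r.
rewrite -ltNge => /ltW ba.
rewrite (ler0_norm (x := b - a)) ?subr_le0// opprB -normrN.
have -> (s : R) : - (- s - c * (b - a)) = s - c * (a - b) by ring.
apply: Rintegral_itv_close => //; first exact: continuous_itv_integrable.
by move=> z /andP[bz za]; apply: h; rewrite !ler0_norm ?subr_le0//; lra.
Qed.

Lemma oriented_integral_bound f a b e : continuous f ->
  (forall z, `|z - a| <= `|b - a| -> `|f z| <= e) ->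
  `|oriented_integral a b f| <= e * `|b - a|.
Proof.
move=> cf h; have := @oriented_integral_close f a b 0 e cf.
by rewrite mul0r subr0; apply => z /h; rewrite subr0.
Qed.

Lemma oriented_integral_comb f g k a b : continuous f -> continuous g ->
  oriented_integral a b (fun x => f x - k * g x)
    = oriented_integral a b f - k * oriented_integral a b g.
Proof.
move=> cf cg; have H c c' : \int[mu]_(x in `[c, c']) (f x - k * g x)
    = \int[mu]_(x in `[c, c']) f x - k * \int[mu]_(x in `[c, c']) g x.
  rewrite RintegralB//; first by rewrite RintegralZl//; exact: continuous_itv_integrable.
    exact: continuous_itv_integrable.
  apply: (@continuous_itv_integrable (fun x => k * g x)) => x.
  by apply: cvgM; [exact: cvg_cst|exact: cg].
by rewrite /oriented_integral; case: ifP => _; rewrite !H//; ring.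
Qed.

Lemma is_derive_oriented_integral f a x : continuous f ->
  is_derive x 1 (fun z => oriented_integral a z f) (f x).
Proof.
move=> cf; apply: is_derive_quotient => e e0.
have e20 : 0 < e / 2 by rewrite divr_gt0.
have /cvgrPdist_lt/(_ _ e20)/nbhs_ballP[del /= del0 h] := cf x.
exists del => // s sx sd.
rewrite -(oriented_integral_chasles a x s cf) addrAC subrr add0r.
have sx0 : 0 < `|s - x| by rewrite normr_gt0 subr_eq0.
rewrite -(@ltr_pM2r _ `|s - x|)// -normrM mulrBl mulfVK ?subr_eq0//.
apply: le_lt_trans (@oriented_integral_close f x s (f x) (e / 2) cf _) _.
  move=> z zx; rewrite distrC; apply/ltW/h; rewrite /ball/= distrC.
  exact: le_lt_trans sd.
by rewrite ltr_pM2r// ltr_pdivrMr// ltr_pMr// ltr1n.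
Qed.

End calculus.

Section box_lipschitz.
Context {R : realType}.
Implicit Types (g h : R -> R -> R) (t s x y T C : R).

Lemma box_lipschitz_bounded g T C : box_lipschitz g ->
  exists2 M, 0 < M & forall t x, 0 <= t <= T -> `|x| <= C -> `|g t x| <= M.
Proof.
move=> lg; have [M M0 h] := lg T C.
exists (`|g 0 0| + M * (`|T| + `|C|) + 1).
  by rewrite ltr_wpDl// addr_ge0// mulr_ge0// ltW.
move=> t x tT xC; have C0 : 0 <= C := le_trans (normr_ge0 x) xC.
have [t0 tT'] := andP tT.
have H := h t 0 x 0 tT _ xC _.
have {}H : `|g t x - g 0 0| <= M * (`|t - 0| + `|x - 0|).
  by apply: H; rewrite ?normr0// lexx (le_trans t0 tT').
rewrite !subr0 in H; have := ler_distD (g 0 0) (g t x) 0; rewrite !subr0 => H1.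
have H2 : M * (`|t| + `|x|) <= M * (`|T| + `|C|).
  rewrite ler_pM2l//; apply: lerD; last by rewrite (ger0_norm C0).
  by rewrite !ger0_norm// (le_trans t0).
lra.
Qed.

Lemma box_lipschitz_cst (k : R) : box_lipschitz (fun _ _ => k).
Proof.
move=> T C; exists 1 => // *; rewrite subrr normr0 mul1r.
by rewrite addr_ge0.
Qed.

Lemma box_lipschitzD g h : box_lipschitz g -> box_lipschitz h ->
  box_lipschitz (fun t x => g t x + h t x).
Proof.
move=> lg lh T C; have [M M0 gM] := lg T C; have [M' M'0 hM] := lh T C.
exists (M + M'); first exact: addr_gt0.
move=> t s x y tT sT xC yC; rewrite mulrDl.
have -> : g t x + h t x - (g s y + h s y) = (g t x - g s y) + (h t x - h s y).
  by ring.
by apply: le_trans (ler_normD _ _) _; apply: lerD; [exact: gM|exact: hM].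
Qed.

Lemma box_lipschitzM g h : box_lipschitz g -> box_lipschitz h ->
  box_lipschitz (fun t x => g t x * h t x).
Proof.
move=> lg lh T C; have [M M0 gM] := lg T C; have [M' M'0 hM] := lh T C.
have [A A0 gA] := box_lipschitz_bounded T C lg.
have [A' A'0 hA] := box_lipschitz_bounded T C lh.
exists (A * M' + A' * M); first by rewrite addr_gt0// mulr_gt0.
move=> t s x y tT sT xC yC; rewrite mulrDl.
have -> : g t x * h t x - g s y * h s y
  = g t x * (h t x - h s y) + h s y * (g t x - g s y) by ring.
apply: le_trans (ler_normD _ _) _; rewrite !normrM -!mulrA.
by apply: lerD; apply: ler_pM => //; [exact: gA|exact: hM|exact: hA|exact: gM].
Qed.

Lemma box_lipschitzZ (k : R) g : box_lipschitz g -> box_lipschitz (fun t x => k * g t x).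
Proof. exact/box_lipschitzM/box_lipschitz_cst. Qed.

Lemma box_lipschitzV g (v : R) : 0 < v -> (forall t x, 0 <= t -> v < g t x) ->
  box_lipschitz g -> box_lipschitz (fun t x => (g t x)^-1).
Proof.
move=> v0 vg lg T C; have [M M0 gM] := lg T C.
exists (M / v ^+ 2); first by rewrite divr_gt0// exprn_gt0.
move=> t s x y /[dup] /andP[t0 _] tT /[dup] /andP[s0 _] sT xC yC.
have gt := vg t x t0; have gs := vg s y s0.
have gt0 := lt_trans v0 gt; have gs0 := lt_trans v0 gs.
have -> : (g t x)^-1 - (g s y)^-1 = (g s y - g t x) / (g t x * g s y).
  by field; rewrite !lt0r_neq0.
rewrite normrM distrC normfV (gtr0_norm (mulr_gt0 gt0 gs0)) mulrAC.
apply: ler_pM => //; first by rewrite invr_ge0 mulr_ge0 ?ltW.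
  exact: gM.
rewrite lef_pV2 ?posrE ?mulr_gt0 ?exprn_gt0// expr2.
by apply: ler_pM; exact: ltW.
Qed.

Lemma box_lipschitz_continuous g t : box_lipschitz g -> 0 <= t -> continuous (g t).
Proof.
move=> lg t0 x; apply/cvgrPdist_lt => e e0.
have [M M0 gM] := lg t (`|x| + 1).
apply/nbhs_ballP; exists (Num.min 1 (e / M)).
  by rewrite /= lt_min ltr01 divr_gt0.
move=> y; rewrite /ball/= lt_min => /andP[xy1 xyM].
have tt : 0 <= t <= t by rewrite t0 lexx.
apply: le_lt_trans (gM t t x y tt tt _ _) _.
- by rewrite lerDl.
- have := ler_distD x y 0; rewrite !subr0 distrC => H; rewrite (le_trans H)// addrC lerD2l.
  exact: ltW.
- by rewrite subrr normr0 add0r mulrC -ltr_pdivlMr.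
Qed.

(** A change of the upper limit costs [A] times its length, a change of time [M] times the length of
    the integration interval. *)
Lemma box_lipschitz_integral (x0 : R) g : box_lipschitz g ->
  box_lipschitz (fun t x => oriented_integral x0 x (g t)).
Proof.
(* Doubled, this bounds all points between [y] and [x] and between [x0] and [y]. *)
move=> lg T C; pose C' := 2 * `|C| + 2 * `|x0|.
have [M M0 gM] := lg T (C' + C'); have [A A0 gA] := box_lipschitz_bounded T (C' + C') lg.
exists (A + M * (C' + 1)).
  by rewrite ltr_pwDl// mulr_ge0 ?addr_ge0 ?mulr_ge0// ltW.
move=> t s x y /[dup] /andP[t0 _] tT /[dup] /andP[s0 _] sT xC yC.
have ct := box_lipschitz_continuous lg t0; have cs := box_lipschitz_continuous lg s0.
have C0 : 0 <= C := le_trans (normr_ge0 x) xC.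
have inC z : `|z| <= C -> `|z| <= C' + C'.
  by move=> zC; have := normr_ge0 x0; rewrite /C' (ger0_norm C0); lra.
rewrite -(oriented_integral_chasles x0 y x ct).
have -> : oriented_integral x0 y (g t) + oriented_integral y x (g t)
   - oriented_integral x0 y (g s)
 = oriented_integral y x (g t) + oriented_integral x0 y (fun z => g t z - 1 * g s z).
  by rewrite oriented_integral_comb//; ring.
apply: le_trans (ler_normD _ _) _.
have xyz z : `|z - y| <= `|x - y| -> `|z| <= C' + C'.
  move=> zy; have := ler_normB x y; have := ler_normD (z - y) y; rewrite subrK => *.
  by have := normr_ge0 x0; rewrite /C' (ger0_norm C0); lra.
have x0z z : `|z - x0| <= `|y - x0| -> `|z| <= C' + C'.
  move=> zy; have := ler_normB y x0; have := ler_normD (z - x0) x0; rewrite subrK => *.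
  by have := normr_ge0 x0; rewrite /C' (ger0_norm C0); lra.
have H1 : `|oriented_integral y x (g t)| <= A * `|x - y|.
  by apply: oriented_integral_bound => // z /xyz; exact: gA.
have H2 : `|oriented_integral x0 y (fun z => g t z - 1 * g s z)| <= M * `|t - s| * `|y - x0|.
  apply: oriented_integral_bound.
    by move=> z; apply: cvgB; [exact: ct|apply: cvgM; [exact: cvg_cst|exact: cs]].
  move=> z /x0z zC; rewrite mul1r; have := gM t s z z tT sT zC zC.
  by rewrite subrr normr0 addr0.
have H3 : M * `|t - s| * `|y - x0| <= M * `|t - s| * (C' + 1).
  rewrite ler_wpM2l ?mulr_ge0// ?ltW//; have := ler_normB y x0.
  by have := normr_ge0 x0; rewrite /C' (ger0_norm C0); lra.
have H4 : 0 <= M * (C' + 1) * `|x - y|.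
  by rewrite !mulr_ge0// ?ltW// ltr_pwDr// addr_ge0// mulr_ge0//.
have H5 : 0 <= A * `|t - s| by rewrite mulr_ge0// ltW.
nra.
Qed.

End box_lipschitz.

Section lamperti.
Context {R : realType}.
Local Notation leb := (@lebesgue_measure R).
Implicit Types (t s x y T C a b h k e M L : R).

(** Second-order expansion of the inverse: the remainder of [b] is divided by [a ^+ 2], and the new
    quadratic term is [(b - a) ^+ 2 / (a ^+ 2 * b)]; both are bounded through [v]. *)
Lemma inv_taylor a b k h L M (v : R) : 0 < v -> v < a -> v < b ->
  `|b - a - h * k| <= L * h ^+ 2 -> `|b - a| <= M * `|h| ->
  `|b^-1 - a^-1 - h * (- k / a ^+ 2)| <= (L / v ^+ 2 + M ^+ 2 / v ^+ 3) * h ^+ 2.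
Proof.
move=> v0 va vb hL hM.
have a0 := lt_trans v0 va; have b0 := lt_trans v0 vb.
have -> : b^-1 - a^-1 - h * (- k / a ^+ 2)
  = - ((b - a - h * k) / a ^+ 2) + (b - a) ^+ 2 / (a ^+ 2 * b).
  by field; rewrite !lt0r_neq0.
apply: le_trans (ler_normD _ _) _; rewrite [leRHS]mulrDl normrN.
have a20 : 0 < a ^+ 2 by rewrite exprn_gt0.
apply: lerD.
  rewrite normrM normfV (gtr0_norm a20) mulrAC; apply: ler_pM => //.
    by rewrite invr_ge0 ltW.
  by rewrite lef_pV2 ?posrE ?exprn_gt0// lerXn2r ?nnegrE ?ltW.
rewrite ger0_norm; last by rewrite divr_ge0 ?sqr_ge0// ltW// mulr_gt0.
rewrite [leRHS]mulrAC; apply: ler_pM; rewrite ?sqr_ge0//.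
- by rewrite invr_ge0 ltW// mulr_gt0.
- rewrite -[X in X <= _]real_normK ?num_real// -(real_normK (num_real h)) -exprMn.
  by rewrite lerXn2r ?nnegrE// (le_trans _ hM).
- rewrite lef_pV2 ?posrE ?mulr_gt0 ?exprn_gt0// exprSr.
  apply: ler_pM; rewrite ?sqr_ge0 ?ltW//.
  by rewrite ltrXn2r// ltW.
Qed.

Lemma derivable_time_derive (g : R -> R -> R) t x : 0 < t -> derivable_time g t x ->
  is_derive t 1 (g ^~ x) (partial1 g t x).
Proof.
move=> t0 /cvgrPdist_lt gt; apply: is_derive_quotient => e /gt.
rewrite /time_nbhs near_withinE /= => /nbhs_ballP[del /= del0 h].
exists (Num.min del t); first by rewrite lt_min del0.
move=> s st; rewrite lt_min => /andP[sd]; rewrite ltr_norml => /andP[sm _].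
rewrite distrC; apply: h => //=; first by rewrite /ball/= distrC.
by apply: ltW; move: sm; lra.
Qed.

Lemma time_nbhs_proper t : 0 <= t -> ProperFilter (time_nbhs t).
Proof.
move=> t0; apply: Build_ProperFilter_ex => Q.
rewrite /time_nbhs /within/= => /nbhs_ballP[e /= e0 h].
exists (t + e / 2); have e2 : 0 < e / 2 by rewrite divr_gt0.
apply: h => /=; last by rewrite addr_ge0// ltW.
  rewrite /ball/= opprD addrA subrr add0r normrN gtr0_norm//.
  by rewrite ltr_pdivrMr// ltr_pMr// ltr1n.
by rewrite -subr_eq0 addrAC subrr add0r lt0r_neq0.
Qed.

(** A quadratic remainder identifies the limit of the difference quotient, including the one-sided
    one at [t = 0]. *)
Lemma partial1E (g : R -> R -> R) t x k L : 0 <= t -> 0 <= L ->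
  (forall s, 0 <= s <= t + 1 -> `|g s x - g t x - (s - t) * k| <= L * (s - t) ^+ 2) ->
  partial1 g t x = k.
Proof.
move=> t0 L0 h; have := time_nbhs_proper t0 => PF.
apply: cvg_lim => //; apply/cvgrPdist_lt => e e0.
rewrite /time_nbhs near_withinE /=; apply/nbhs_ballP.
exists (Num.min 1 (e / (L + 1))).
  by rewrite /= lt_min ltr01 divr_gt0// ltr_pwDr.
move=> s; rewrite /ball/= distrC lt_min => /andP[s1 se] st s0.
have st0 : 0 < `|s - t| by rewrite normr_gt0 subr_eq0.
rewrite distrC /quotient_time -(ltr_pM2r st0) -normrM mulrBl mulfVK ?subr_eq0//.
rewrite (mulrC k); apply: le_lt_trans (h s _) _.
  by rewrite s0/=; move: s1; rewrite ltr_norml => /andP[_]; lra.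
rewrite -real_normK ?num_real// expr2 mulrA ltr_pM2r//.
rewrite ltr_pdivlMr in se; last by rewrite ltr_pwDr.
by move: se; lra.
Qed.

Variables (sigma mu : R -> R -> R) (x0 v V : R).
Hypotheses (v0 : 0 < v) (sb : forall t x, 0 <= t -> v < sigma t x < V)
  (sC : C11 sigma) (ls : box_lipschitz sigma) (ls1 : box_lipschitz (partial1 sigma))
  (ls2 : box_lipschitz (partial2 sigma)) (lmu : box_lipschitz mu).

Let q t x := (sigma t x)^-1.
Let q1 t x := - partial1 sigma t x / sigma t x ^+ 2.
Let q2 t x := - partial2 sigma t x / sigma t x ^+ 2.

Local Notation F := (lamperti x0 sigma).

(** The time derivative of [lamperti] taken under the integral sign; [partial1_lamperti] confirms
    it. *)
Definition lamperti_time t x : R :=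
  oriented_integral x0 x (fun y => - partial1 sigma t y / sigma t y ^+ 2).

(** [mu_star] written in the original coordinate, so that the inverse of the transform appears in
    [mu_star_lamperti] only. *)
Definition lamperti_drift t x : R :=
  lamperti_time t x + mu t x / sigma t x - 2^-1 * partial2 sigma t x.

Let sv t x : 0 <= t -> v < sigma t x. Proof. by move/(sb x) => /andP[]. Qed.
Let s0 t x : 0 <= t -> 0 < sigma t x. Proof. by move/(sv x); exact: lt_trans. Qed.

Lemma box_lipschitz_inv_sigma : box_lipschitz q.
Proof. exact: box_lipschitzV v0 _ ls. Qed.

Let lq := box_lipschitz_inv_sigma.

Let lquot (g : R -> R -> R) : box_lipschitz g ->
  box_lipschitz (fun t x => - g t x / sigma t x ^+ 2).
Proof.
move=> lg; have := box_lipschitzZ (-1) (box_lipschitzM lg (box_lipschitzM lq lq)).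
congr box_lipschitz; apply/funext => t; apply/funext => x.
by rewrite /q expr2 invfM; ring.
Qed.

Lemma box_lipschitz_q1 : box_lipschitz q1. Proof. exact: lquot. Qed.
Lemma box_lipschitz_q2 : box_lipschitz q2. Proof. exact: lquot. Qed.
Let lq1 := box_lipschitz_q1.

Lemma box_lipschitz_lamperti : box_lipschitz F.
Proof. exact: box_lipschitz_integral. Qed.

Lemma box_lipschitz_drift : box_lipschitz lamperti_drift.
Proof.
have l2 : box_lipschitz (fun t x => - 2^-1 * partial2 sigma t x).
  exact: box_lipschitzZ.
have := box_lipschitzD (box_lipschitzD (box_lipschitz_integral x0 lq1)
  (box_lipschitzM lmu lq)) l2.
by congr box_lipschitz; apply/funext => t; apply/funext => x; rewrite mulNr.
Qed.

(** Lipschitz continuity of [partial1 sigma] makes the mean value remainder quadratic. The mean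
    value theorem only differentiates at interior times, which are positive, so the one-sided
    derivative at [0] causes no trouble. *)
Lemma inv_sigma_time T C : exists2 L, 0 < L & forall s t x, 0 <= s <= T -> 0 <= t <= T ->
  `|x| <= C -> `|q s x - q t x - (s - t) * q1 t x| <= L * (s - t) ^+ 2.
Proof.
have [M M0 sM] := ls T C; have [L L0 sL] := ls1 T C.
exists (L / v ^+ 2 + M ^+ 2 / v ^+ 3).
  by rewrite addr_gt0// divr_gt0 ?exprn_gt0.
move=> s t x sT tT xC; have [[t0 tT'] [s00 sT']] := (andP tT, andP sT).
apply: inv_taylor => //; first exact: sv.
- exact: sv.
- have cg : continuous_path (fun u => sigma u x).
    by apply: (@box_lipschitz_path _ _ (fun=> x) ls) => u; exact: cvg_cst.
  have der (z : R) : 0 < z -> is_derive z (1 : R) (sigma ^~ x) (partial1 sigma z x).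
    by move=> z0; apply: derivable_time_derive => //; case: sC => _ + _ _ _; apply; exact: ltW.
  rewrite mulrC -real_normK ?num_real// expr2 mulrA.
  have [ts|/ltW st] := leP t s.
    rewrite (ger0_norm (x := s - t)) ?subr_ge0//.
    apply: (mean_value_bound (f := sigma ^~ x) (df := partial1 sigma ^~ x)) => //
      [z /andP[tz _]||z /andP[tz zs]].
    - by apply: der; exact: le_lt_trans tz.
    - exact: continuous_path_within.
    - have zT : 0 <= z <= T by rewrite (le_trans t0 tz) (le_trans zs).
      apply: le_trans (sL _ _ _ _ zT tT xC xC) _; rewrite subrr normr0 addr0.
      by rewrite ler_wpM2l ?(ltW L0)// ger0_norm ?subr_ge0//; lra.
  rewrite (ler0_norm (x := s - t)) ?subr_le0// opprB -normrN.
  have -> : - (sigma s x - sigma t x - partial1 sigma t x * (s - t))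
    = sigma t x - sigma s x - partial1 sigma t x * (t - s) by ring.
  apply: (mean_value_bound (f := sigma ^~ x) (df := partial1 sigma ^~ x)) => //
      [z /andP[tz _]||z /andP[tz zs]].
  - by apply: der; exact: le_lt_trans tz.
  - exact: continuous_path_within.
  - have zT : 0 <= z <= T by rewrite (le_trans s00 tz) (le_trans zs).
    apply: le_trans (sL _ _ _ _ zT tT xC xC) _; rewrite subrr normr0 addr0.
    by rewrite ler_wpM2l ?(ltW L0)// ler0_norm ?subr_le0//; lra.
- by apply: le_trans (sM _ _ _ _ sT tT xC xC) _; rewrite subrr normr0 addr0.
Qed.

Lemma inv_sigma_space T C : exists2 L, 0 < L & forall t x y, 0 <= t <= T ->
  `|x| <= C -> `|y| <= C -> `|q t y - q t x - (y - x) * q2 t x| <= L * (y - x) ^+ 2.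
Proof.
have [M M0 sM] := ls T C; have [L L0 sL] := ls2 T (C + C + C).
exists (L / v ^+ 2 + M ^+ 2 / v ^+ 3).
  by rewrite addr_gt0// divr_gt0 ?exprn_gt0.
move=> t x y tT xC yC; have [t0 tT'] := andP tT.
have C0 : 0 <= C := le_trans (normr_ge0 x) xC.
apply: inv_taylor => //; [exact: sv|exact: sv| |].
- rewrite mulrC -real_normK ?num_real// expr2 mulrA.
  apply: (mean_value_bound_line (f := sigma t) (df := partial2 sigma t)).
    move=> z; rewrite /partial2 derive1E; apply: derivableP.
    by case: sC => _ _ + _ _; apply.
  move=> z zx; have zC : `|z| <= C + C + C.
    have := ler_normD (z - x) x; have := ler_normB y x; rewrite subrK => *; lra.
  apply: le_trans (sL _ _ _ _ tT tT zC _) _; first by lra.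
  by rewrite subrr normr0 add0r ler_wpM2l// ltW.
- by apply: le_trans (sM _ _ _ _ tT tT yC xC) _; rewrite subrr normr0 add0r.
Qed.

Let cq t : 0 <= t -> continuous (q t).
Proof. exact: box_lipschitz_continuous. Qed.
Let cq1 t : 0 <= t -> continuous (q1 t).
Proof. exact: box_lipschitz_continuous. Qed.

Lemma lamperti_time_taylor T C : exists2 L, 0 < L & forall s t x,
  0 <= s <= T -> 0 <= t <= T -> `|x| <= C ->
  `|F s x - F t x - (s - t) * lamperti_time t x| <= L * (s - t) ^+ 2.
Proof.
have [L L0 h] := inv_sigma_time T (`|C| + `|x0| + `|x0|).
exists (L * (`|C| + `|x0| + 1)); first by rewrite mulr_gt0// ltr_pwDr// addr_ge0.
move=> s t x sT tT xC; have [[t0 tT'] [s00 sT']] := (andP tT, andP sT).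
have C0 : 0 <= C := le_trans (normr_ge0 x) xC.
rewrite /lamperti /lamperti_time -/(q s) -/(q t) -/(q1 t).
have cqq : continuous (fun z => q s z - 1 * q t z).
  by move=> z; apply: cvgB; [exact: cq|apply: cvgM; [exact: cvg_cst|exact: cq]].
have -> : oriented_integral x0 x (q s) - oriented_integral x0 x (q t)
    - (s - t) * oriented_integral x0 x (q1 t)
  = oriented_integral x0 x (fun z => q s z - 1 * q t z - (s - t) * q1 t z).
  rewrite (oriented_integral_comb _ _ _ cqq (cq1 t0)).
  by rewrite (oriented_integral_comb _ _ _ (cq s00) (cq t0)) mul1r.
apply: le_trans (oriented_integral_bound (e := L * (s - t) ^+ 2) _ _) _.
- move=> z; apply: cvgB; first exact: cqq.
  by apply: cvgM; [exact: cvg_cst|exact: cq1].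
- move=> z zx; rewrite mul1r; apply: h => //.
  have := ler_normD (z - x0) x0; have := ler_normB x x0; rewrite subrK (ger0_norm C0) => *.
  lra.
- have -> : L * (`|C| + `|x0| + 1) * (s - t) ^+ 2
    = L * (s - t) ^+ 2 * (`|C| + `|x0| + 1) by ring.
  apply: ler_wpM2l; first by apply: mulr_ge0; [exact: ltW|exact: sqr_ge0].
  by have := ler_normB x x0; rewrite (ger0_norm C0); lra.
Qed.

Lemma partial1_lamperti t x : 0 <= t -> partial1 F t x = lamperti_time t x.
Proof.
move=> t0; have [L L0 h] := lamperti_time_taylor (t + 1) `|x|.
by apply: (partial1E t0 (ltW L0)) => s sT; apply: h => //; rewrite t0 lerDl /= ler01.
Qed.

(** [q] is the space derivative of the transform, and its first-order remainder is quadratic; one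
    more integration makes it cubic. *)
Lemma lamperti_space_taylor T C : exists2 L, 0 < L & forall t x y,
  0 <= t <= T -> `|x| <= C -> `|y| <= C ->
  `|F t y - F t x - q t x * (y - x) - 2^-1 * q2 t x * (y - x) ^+ 2|
    <= L * `|y - x| ^+ 3.
Proof.
have [L L0 h] := inv_sigma_space T (C + C + C).
exists L => // t x y tT xC yC; have [t0 tT'] := andP tT.
have C0 : 0 <= C := le_trans (normr_ge0 x) xC.
have -> : L * `|y - x| ^+ 3 = L * `|y - x| ^+ 2 * `|y - x| by ring.
apply: (taylor2_line (f := F t) (df := q t) (ddf := q2 t x)) => // [z|z zx].
  exact/is_derive_oriented_integral/cq.
rewrite mulrC; apply: le_trans (h _ _ _ tT _ _) _; first by lra.
  have := ler_normD (z - x) x; have := ler_normB y x; rewrite subrK => *; lra.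
rewrite ler_wpM2l ?(ltW L0)// -(real_normK (num_real (z - x))).
by rewrite lerXn2r ?nnegrE.
Qed.

(** The integrand [q t] lies between [V^-1] and [v^-1], so the transform is bi-Lipschitz uniformly
    in time. *)
Lemma lamperti_dist t x y : 0 <= t ->
  `|F t y - F t x| <= `|y - x| / v /\ `|y - x| / V <= `|F t y - F t x|.
Proof.
move=> t0; have FE : F t y - F t x = oriented_integral x y (q t).
  by rewrite /lamperti -(oriented_integral_chasles x0 x y (cq t0)) addrAC subrr add0r.
have V0 : 0 < V by have /andP[_] := sb 0 t0; exact: lt_trans (s0 0 t0).
rewrite FE; split.
  rewrite mulrC; apply: oriented_integral_bound; first exact: cq.
  move=> z _; rewrite /q ger0_norm ?invr_ge0 ?(ltW (s0 _ _))//.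
  by rewrite lef_pV2 ?posrE ?s0// ltW// sv.
(* Comparison with the midpoint of [[V^-1, v^-1]], from which [q t] deviates by at most half the
   width, gives the lower bound without separating the signs of [y - x]. *)
have := @oriented_integral_close _ (q t) x y ((v^-1 + V^-1) / 2) ((v^-1 - V^-1) / 2) (cq t0) _.
have H z : V^-1 <= q t z <= v^-1.
  have /andP[/ltW h1 /ltW h2] := sb z t0.
  by rewrite /q !lef_pV2 ?posrE ?s0// h1 h2.
have vV : V^-1 <= v^-1 by have /andP[] := H 0; exact: le_trans.
move=> {}/(_ _) h.
have {h} : `|oriented_integral x y (q t) - (v^-1 + V^-1) / 2 * (y - x)|
    <= (v^-1 - V^-1) / 2 * `|y - x|.
  by apply: h => z _; have /andP[? ?] := H z; rewrite ler_norml; apply/andP; split; lra.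
have := ler_distD (oriented_integral x y (q t)) ((v^-1 + V^-1) / 2 * (y - x)) 0.
rewrite !subr0 normrM (ger0_norm (x := (v^-1 + V^-1) / 2)); last first.
  by rewrite divr_ge0// addr_ge0// invr_ge0 ltW.
rewrite distrC => h1 h2.
have : V^-1 * `|y - x| = (v^-1 + V^-1) / 2 * `|y - x| - (v^-1 - V^-1) / 2 * `|y - x|.
  by rewrite -mulrBl; congr (_ * _); field; rewrite !lt0r_neq0.
lra.
Qed.

Lemma lamperti_inj t x y : 0 <= t -> F t x = F t y -> x = y.
Proof.
move=> t0 Fxy; have V0 : 0 < V by have /andP[_] := sb 0 t0; exact: lt_trans (s0 0 t0).
have [_] := lamperti_dist y x t0; rewrite Fxy subrr normr0 ler_pdivrMr// mul0r.
by rewrite normr_le0 subr_eq0 => /eqP.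
Qed.

(** At a value attained by [F t], injectivity makes [pinv] return the point. *)
Lemma mu_star_lamperti t x : 0 <= t -> mu_star x0 mu sigma t (F t x) = lamperti_drift t x.
Proof.
move=> t0; have E : lamperti_inv x0 sigma t (F t x) = x.
  have Fi : {in [set: R] &, injective (F t)} by move=> a b _ _; exact: lamperti_inj.
  by apply: (lamperti_inj t0); rewrite /lamperti_inv pinvK// inE; exists x.
by rewrite /mu_star E partial1_lamperti.
Qed.

(** Serves both equations: [beta] is the drift density of [x] and [c] the density of its quadratic
    variation. With drift [mu] and [c] the square of [sigma] this is the Ito case; with the
    corrected drift and [c = 0] it is the finite variation case. In both, the transformed drift is
    [lamperti_drift]. *)
Lemma lamperti_path (x f beta c : R -> R) a b (Q : R) :
  0 <= a -> a < b -> 0 <= Q ->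
  continuous_path x -> continuous_path beta -> continuous_path c ->
  (forall u, 0 <= u -> lamperti_drift u (x u) = lamperti_time u (x u)
     + (sigma u (x u))^-1 * beta u
     + 2^-1 * (- partial2 sigma u (x u) / sigma u (x u) ^+ 2 * c u)) ->
  (forall e (N : nat), 0 < e -> exists n, [/\ (N <= n)%N,
     `|\sum_(k < n) ((sigma (grid a b n k) (x (grid a b n k)))^-1 *
         (x (grid a b n k.+1) - x (grid a b n k)
          - beta (grid a b n k) * ((b - a) / n%:R))
         - (f (grid a b n k.+1) - f (grid a b n k)))| <= e,
     `|\sum_(k < n) (- partial2 sigma (grid a b n k) (x (grid a b n k))
           / sigma (grid a b n k) (x (grid a b n k)) ^+ 2) *
         ((x (grid a b n k.+1) - x (grid a b n k)) ^+ 2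
          - c (grid a b n k) * ((b - a) / n%:R))| <= e &
     \sum_(k < n) (x (grid a b n k.+1) - x (grid a b n k)) ^+ 2 <= Q]) ->
  F b (x b) - F a (x a)
    = \int[leb]_(u in `[a, b]) lamperti_drift u (x u) + (f b - f a).
Proof.
move=> a0 ab Q0 cx cbeta cc drift approx.
have [C C0 xC] := continuous_path_bounded b cx.
have [L1 L10 h1] := lamperti_time_taylor b C.
have [L2 L20 h2] := lamperti_space_taylor b C.
have [M M0 hM] := box_lipschitz_integral x0 lq1 b C.
rewrite (@change_of_variable _ (fun u => F u (x u)) x f
  (fun u => lamperti_time u (x u)) (fun u => q u (x u)) (fun u => q2 u (x u))
  beta c a b (L1 + L2 + M) Q) //.
- congr (_ + _); apply: eq_Rintegral => u; rewrite inE/= in_itv/= => /andP[au _].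
  by rewrite drift// (le_trans a0).
- by rewrite !addr_ge0// ltW.
- exact: box_lipschitz_path (box_lipschitz_integral x0 lq1) cx.
- exact: box_lipschitz_path lq cx.
- exact: box_lipschitz_path box_lipschitz_q2 cx.
(* Time is moved first, at the new position, then space at the old time; comparing [lamperti_time]
   at the two positions accounts for the mixed term. *)
- move=> u w uab wab; have inT z : a <= z <= b -> 0 <= z <= b.
    by move=> /andP[az ->]; rewrite (le_trans a0 az).
  have [uT wT] := (inT _ uab, inT _ wab).
  have [uC wC] := (xC _ uT, xC _ wT).
  have H1 := h1 w u (x w) wT uT wC.
  have H2 := h2 u (x u) (x w) uT uC wC.
  have H3 := hM u u (x w) (x u) uT uT wC uC.
  rewrite subrr normr0 add0r -/(q1 u) in H3.
  rewrite -/(lamperti_time u (x w)) -/(lamperti_time u (x u)) in H3.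
  have -> : F w (x w) - F u (x u) - lamperti_time u (x u) * (w - u) - q u (x u) * (x w - x u)
      - 2^-1 * q2 u (x u) * (x w - x u) ^+ 2
    = (F w (x w) - F u (x w) - (w - u) * lamperti_time u (x w))
    + (F u (x w) - F u (x u) - q u (x u) * (x w - x u)
        - 2^-1 * q2 u (x u) * (x w - x u) ^+ 2)
    + (w - u) * (lamperti_time u (x w) - lamperti_time u (x u)) by ring.
  apply: le_trans (ler_normD _ _) _.
  have H4 : `|(w - u) * (lamperti_time u (x w) - lamperti_time u (x u))|
    <= M * (`|x w - x u| * `|w - u|).
    by rewrite normrM mulrC mulrA ler_wpM2r.
  apply: le_trans (lerD (le_trans (ler_normD _ _) (lerD H1 H2)) H4) _.
  have A1 : 0 <= (w - u) ^+ 2 by exact: sqr_ge0.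
  have A2 : 0 <= `|x w - x u| * `|w - u| by rewrite mulr_ge0.
  have A3 : 0 <= `|x w - x u| ^+ 3 by rewrite exprn_ge0.
  have B1 := mulr_ge0 (ltW L20) A1; have B2 := mulr_ge0 (ltW M0) A1.
  have B3 := mulr_ge0 (ltW L10) A2; have B4 := mulr_ge0 (ltW L20) A2.
  have B5 := mulr_ge0 (ltW L10) A3; have B6 := mulr_ge0 (ltW M0) A3.
  lra.
Qed.

End lamperti.

(** * Paths of regime-switching processes *)

Section joint_measurability.
Context {R : realType} {d : measure_display} {Omega : measurableType d}.

(** Strictly to the right of [Num.max 0 s], even at mesh points, because right limits along [t^'+]
    exclude the point itself. *)
Definition next_mesh_point (n : nat) (s : R) : R :=
  (Num.trunc (n.+1%:R * Num.max 0 s)).+1%:R / n.+1%:R.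

Lemma next_mesh_point_gt n s : Num.max 0 s < next_mesh_point n s <= Num.max 0 s + n.+1%:R^-1.
Proof.
have m0 : 0 <= n.+1%:R * Num.max 0 s by rewrite mulr_ge0// le_max lexx.
have /andP[h1 h2] := truncn_itv m0.
rewrite /next_mesh_point ltr_pdivlMr ?ltr0n// mulrC h2/=.
rewrite ler_pdivrMr ?ltr0n// mulrDl mulVf ?pnatr_eq0//.
by rewrite -[leLHS]natr1; move: h1; lra.
Qed.

Lemma measurable_trunc (n k : nat) :
  measurable [set s : R | Num.trunc (n.+1%:R * Num.max 0 s) = k].
Proof.
have mf : measurable_fun [set: R] (fun s : R => n.+1%:R * Num.max 0 s).
  by apply: measurable_funM => //; apply: measurable_maxr.
have := mf measurableT `[k%:R, k.+1%:R[%classic (measurable_itv _).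
rewrite setTI; congr measurable; apply/seteqP; split => s /=.
  rewrite in_itv/= => h; exact: truncn_def.
move=> <-; rewrite in_itv/=; apply: truncn_itv.
by rewrite mulr_ge0// le_max lexx.
Qed.

(** Sampling at the next mesh point gives a process that is constant in time on countably many
    measurable sets of times, hence jointly measurable; right-continuity passes this to the
    limit. *)
Lemma right_continuous_measurable (Z : R -> Omega -> R) :
  (forall t, 0 <= t -> measurable_fun setT (Z t)) ->
  (forall w t, 0 <= t -> Z r w @[r --> t^'+] --> Z t w) ->
  measurable_fun setT (fun p : measurableTypeR R * Omega => Z (Num.max 0 p.1) p.2).
Proof.
move=> mZ cZ.
apply: (@measurable_fun_cvg _ _ _ _ (fun n (p : measurableTypeR R * Omega) =>
  Z (next_mesh_point n p.1) p.2)).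
- move=> n _ U mU; rewrite setTI.
  have -> : (fun p : measurableTypeR R * Omega => Z (next_mesh_point n p.1) p.2) @^-1` U
    = \bigcup_k ([set s | Num.trunc (n.+1%:R * Num.max 0 s) = k]
        `*` (Z (k.+1%:R / n.+1%:R) @^-1` U)).
    apply/seteqP; split => [[s w] /= h|[s w] [k _ [/= <-]]] //.
    by exists (Num.trunc (n.+1%:R * Num.max 0 s)).
  apply: bigcupT_measurable => k; apply: measurableX.
    exact: measurable_trunc.
  have k0 : 0 <= k.+1%:R / n.+1%:R :> R by rewrite divr_ge0.
  by have := mZ _ k0 measurableT U mU; rewrite setTI.
- move=> [s w] _ /=.
  have s0 : 0 <= Num.max 0 s by rewrite le_max lexx.
  apply/cvgrPdist_lt => e e0.
  have /cvgrPdist_lt/(_ e e0) := cZ w _ s0.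
  rewrite near_withinE => /nbhs_ballP[del /= del0 h].
  near=> n; have /andP[n1 n2] := next_mesh_point_gt n s.
  apply: h => //; rewrite /ball/= distrC gtr0_norm ?subr_gt0//.
  rewrite ltrBlDl (le_lt_trans n2)// ltrD2l.
  by near: n; exact: (near_infty_natSinv_lt (PosNum del0)).
Unshelve. all: by end_near. Qed.

Lemma continuous_process_measurable (Z : R -> Omega -> R) : continuous_process Z ->
  measurable_fun setT (fun p : measurableTypeR R * Omega => Z (Num.max 0 p.1) p.2).
Proof.
move=> [mZ cZ]; apply: right_continuous_measurable => // w t t0.
apply/cvgrPdist_lt => e e0; have [del del0 h] := continuous_path_at (cZ w) t0 e0.
near=> r; have tr : t < r by near: r; exact: nbhs_right_gt.
rewrite distrC; apply: h; first exact: le_trans (ltW tr).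
rewrite gtr0_norm ?subr_gt0// ltrBlDl.
by near: r; apply: nbhs_right_lt; rewrite ltrDl.
Unshelve. all: by end_near. Qed.

Context {E : finType}.
Variable J : R -> Omega -> E.
Hypothesis hJ : jump_process J.

Lemma jump_process_measurable (i : E) : measurable_fun setT
  (fun p : measurableTypeR R * Omega => (J (Num.max 0 p.1) p.2 == i)%:R : R).
Proof.
have [mJ cJ _] := hJ.
apply: (right_continuous_measurable (Z := fun t w => (J t w == i)%:R)).
- move=> t t0; have -> : (fun w => (J t w == i)%:R) = \1_(J t @^-1` [set i]) :> (Omega -> R).
    apply/funext => w; rewrite indicE; congr (nat_of_bool _)%:R.
    by apply/eqP/idP; rewrite inE.
  exact/measurable_indic/mJ.
- move=> w t t0; apply: cvg_near_cst; have [/(_ t t0) + _] := cJ w.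
  by apply: filterS => r ->.
Qed.

Lemma switched_measurable (g : E -> R -> Omega -> R) :
  (forall i, continuous_process (g i)) -> measurable_fun setT
  (fun p : measurableTypeR R * Omega =>
    g (J (Num.max 0 p.1) p.2) (Num.max 0 p.1) p.2).
Proof.
move=> cg; have -> : (fun p : measurableTypeR R * Omega =>
    g (J (Num.max 0 p.1) p.2) (Num.max 0 p.1) p.2) = (fun p =>
    \sum_i (J (Num.max 0 p.1) p.2 == i)%:R * g i (Num.max 0 p.1) p.2).
  apply/funext => p; rewrite (bigD1 (J (Num.max 0 p.1) p.2))//= eqxx mul1r.
  by rewrite big1 ?addr0// => i; rewrite eq_sym => /negbTE ->; rewrite mul0r.
apply: measurable_fun_finsum => i; apply: measurable_funM.
  exact: jump_process_measurable.
exact: continuous_process_measurable.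
Qed.

Lemma switched_path_measurable (g : E -> R -> R) w (a b : R) : 0 <= a ->
  (forall i, continuous_path (g i)) ->
  measurable_fun `[a, b] (fun s : R => g (J s w) s).
Proof.
move=> a0 cg; have := @switched_measurable (fun i t _ => g i t) _.
move=> /(_ _) h; have {}h := h (fun i => conj (fun t _ => measurable_cst _) (fun=> cg i)).
apply: (eq_measurable_fun (fun s : measurableTypeR R => g (J (Num.max 0 s) w) (Num.max 0 s))).
  move=> s; rewrite inE/= in_itv/= => /andP[as_ _].
  by rewrite (max_idPr _)// (le_trans a0).
apply: measurable_funTS.
by have := measurableT_comp h (pair2_measurable w); apply.
Qed.

Lemma switched_path_bounded (g : E -> R -> R) w (T : R) : (forall i, continuous_path (g i)) ->
  exists2 C, 0 < C & forall s, 0 <= s <= T -> `|g (J s w) s| <= C.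
Proof.
move=> cg; pose C i := projT1 (cid2 (continuous_path_bounded T (cg i))).
have CP i : 0 < C i /\ forall s, 0 <= s <= T -> `|g i s| <= C i.
  by rewrite /C; case: cid2.
exists (1 + \sum_i C i).
  by rewrite ltr_pwDl// sumr_ge0// => i _; case: (CP i) => /ltW.
move=> s sT; apply: le_trans ((CP (J s w)).2 _ sT) _.
rewrite (bigD1 (J s w))//= addrCA lerDl addr_ge0// sumr_ge0// => i _.
by case: (CP i) => /ltW.
Qed.

Lemma switched_path_integrable (g : E -> R -> R) w (a b : R) : 0 <= a ->
  (forall i, continuous_path (g i)) ->
  lebesgue_measure.-integrable `[a, b] (EFin \o (fun s => g (J s w) s)).
Proof.
move=> a0 cg; have [C C0 hC] := switched_path_bounded w b cg.
apply: measurable_bounded_integrable; first exact: measurable_itv.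
- by rewrite /= lebesgue_measure_itv/=; case: ifP => // _; rewrite -EFinB ltry.
- exact: switched_path_measurable.
- exists C; split; first by rewrite num_real.
  move=> M CM s /=; rewrite in_itv/= => /andP[as_ sb].
  by rewrite (le_trans _ (ltW CM))// hC// sb (le_trans a0).
Qed.

End joint_measurability.

(** * Lebesgue-Stieltjes integral equations *)

Lemma Rintegral_close d (T : measurableType d) (R : realType) (m : {measure set T -> \bar R})
    (D : set T) (f : T -> R) (c e y : R) :
  measurable D -> m D = y%:E -> m.-integrable D (EFin \o f) ->
  (forall x, D x -> `|f x - c| <= e) ->
  `|\int[m]_(x in D) f x - c * y| <= e * y.
Proof.
move=> mD mDy intf h.
have icst k : m.-integrable D (EFin \o (fun=> k)).
  apply: measurable_bounded_integrable => //; first by rewrite mDy ltry.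
  by exists `|k|; split; [rewrite num_real|move=> M kM s _; exact: ltW].
have cstE k : \int[m]_(x in D) k = k * y by rewrite Rintegral_cst// mDy.
rewrite -!cstE -RintegralB//.
have ifc : m.-integrable D (EFin \o (fun x => f x - c)).
  exact: (integrableB _ intf (icst c)).
apply: le_trans (le_normr_Rintegral _ ifc) _ => //.
apply: le_Rintegral => //.
exact: (integrable_abse ifc).
Qed.

Section stieltjes.
Context {R : realType}.
Local Notation leb := (@lebesgue_measure R).
Local Notation LS := (@lebesgue_stieltjes_measure R).
Implicit Types (G H : cumulative R R) (phi : R -> R) (a b s t u w : R).

Let fine_swap (x y z t : \bar R) : x \is a fin_num -> y \is a fin_num ->
  z \is a fin_num -> t \is a fin_num -> (x + y = z + t)%E ->
  fine x - fine t = fine z - fine y.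
Proof.
by move: x y z t => [x| |] [y| |] [z| |] [t| |]// _ _ _ _ [] /=; lra.
Qed.

Let sub_sum (p q r t : R) : p + q - (r + t) - (p - r) = q - t.
Proof. by ring. Qed.

Let sub_shift (p q r i j z : R) : p - r - (i + j) - (q - r - i) = z -> p - q = j + z.
Proof. by move=> <-; ring. Qed.

Let close_sum (i1 i2 i3 c c' e w u gw gu hw hu : R) :
  `|i1 - c * (w - u)| <= e * (w - u) -> `|i2 - c' * (gw - gu)| <= e * (gw - gu) ->
  `|i3 - c' * (hw - hu)| <= e * (hw - hu) ->
  `|i1 + (i2 - i3) - c * (w - u) - c' * (gw - hw - (gu - hu))|
    <= e * (w + gw + hw - (u + gu + hu)).
Proof.
rewrite !ler_norml.
by move=> /andP[? ?] /andP[? ?] /andP[? ?]; apply/andP; split; lra.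
Qed.

Lemma stieltjes_itv G a b : a <= b -> LS G `]a, b] = (G b - G a)%:E.
Proof.
move=> ab; rewrite /lebesgue_stieltjes_measure /measure_extension measurable_mu_extE/=.
  by rewrite wlength_itv_bnd.
exact: is_ocitv.
Qed.

(** From [G - H = G' - H'] the sums [G + H'] and [G' + H] have equal increments, so their measures
    agree inside []0, u]]; finiteness of all four integrals allows rearranging. *)
Lemma stieltjes_split_unique G H G' H' phi u : 0 <= u ->
  (forall s, 0 <= s -> G s - H s = G' s - H' s) ->
  (LS G).-integrable `]0, u] (EFin \o phi) -> (LS H).-integrable `]0, u] (EFin \o phi) ->
  (LS G').-integrable `]0, u] (EFin \o phi) -> (LS H').-integrable `]0, u] (EFin \o phi) ->
  \int[LS G]_(s in `]0, u]) phi s - \int[LS H]_(s in `]0, u]) phi s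
  = \int[LS G']_(s in `]0, u]) phi s - \int[LS H']_(s in `]0, u]) phi s.
Proof.
move=> u0 GH iG iH iG' iH'.
pose D : set (measurableTypeR R) := `]0, u]%classic.
have mD : measurable D by exact: measurable_itv.
pose m1 := measure_add (LS G) (LS H'); pose m2 := measure_add (LS G') (LS H).
have addE (K K' : cumulative R R) p q : p <= q ->
    measure_add (LS K) (LS K') `]p, q]%classic = (K q - K p + (K' q - K' p))%:E.
  move=> pq; rewrite measure_addE EFinD.
  by apply: (congr2 (fun y z => y + z)%E); exact: stieltjes_itv.
(* Intervals are cut down to [D] because the two splittings agree at nonnegative times only. *)
have on_itv c e : m1 (`]c, e]%classic `&` D) = m2 (`]c, e]%classic `&` D).
  have -> : `]c, e]%classic `&` D = `]Num.max c 0, Num.min e u]%classic.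
    rewrite /D; apply/seteqP; split => s /=; rewrite !in_itv/= gt_max le_min.
      by move=> [/andP[-> ->] /andP[-> ->]].
    by move=> /andP[/andP[-> ->] /andP[-> ->]].
  have [ce|/ltW ce] := leP (Num.max c 0) (Num.min e u); last first.
    rewrite set_itv_ge; first by rewrite /m1 /m2 !measure_addE !measure0.
    by rewrite -leNgt bnd_simp.
  apply: etrans (addE _ _ _ _ ce) (esym (etrans (addE _ _ _ _ ce) _)); congr (_%:E).
  have c0 : 0 <= Num.max c 0 by rewrite le_max lexx orbT.
  by have := GH _ c0; have := GH _ (le_trans c0 ce); lra.
have m12 A : measurable A -> A `<=` D -> m1 A = m2 A.
  move=> mA AD.
  suff : mrestr m1 mD A = mrestr m2 mD A by rewrite /mrestr (setIidl AD).
  apply: (@measure_unique _ R (measurableTypeR R) (@ocitv R)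
    (fun k : nat => `]- k%:R, k%:R]%classic) erefl (@ocitvI R) _ _
    (mrestr m1 mD) (mrestr m2 mD) _ _ A mA).
  - by move=> k; exact: is_ocitv.
  - apply/seteqP; split => // s _.
    exists (Num.bound `|s|) => //=; rewrite in_itv/=.
    have := archi_boundP (normr_ge0 s); rewrite ltr_norml => /andP[h1 h2].
    by rewrite h1 ltW.
  - by move=> X [[c e] _ <-]; exact: on_itv.
  - move=> k; apply: (@le_lt_trans _ _ (m1 D)).
      by apply: le_measure; rewrite ?inE//; apply: measurableI => //; exact: measurable_itv.
    by have := addE G H' 0 u u0; rewrite -/m1 -/D => ->; rewrite ltry.
have := @eq_measure_integral _ _ R D m2 m1 (EFin \o phi) m12.
rewrite (integral_measure_add mD iG iH') (integral_measure_add mD iG' iH).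
by apply: fine_swap; exact: integrable_fin_num.
Qed.

(** [is_LS_integral] allows a new splitting for each upper limit. Uniqueness lets the splitting
    chosen at [b] serve all earlier times, and then integrals subtract. *)
Lemma LS_increments (f phi I : R -> R) b : 0 <= b ->
  (forall t, 0 <= t -> is_LS_integral f phi t (I t)) ->
  exists G H, [/\ forall s, 0 <= s -> f s = G s - H s,
    (LS G).-integrable `]0, b] (EFin \o phi), (LS H).-integrable `]0, b] (EFin \o phi) &
    forall u w, 0 <= u -> u <= w -> w <= b ->
      I w - I u = \int[LS G]_(s in `]u, w]) phi s - \int[LS H]_(s in `]u, w]) phi s].
Proof.
move=> b0 hI; have [G [H [fGH iG iH _]]] := hI b b0.
exists G, H; split => //.
have sub c e : 0 <= c -> e <= b -> `]c, e]%classic `<=` `]0, b]%classic.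
  move=> c0 eb s /=; rewrite !in_itv/= => /andP[cs se].
  by rewrite (le_lt_trans c0 cs) (le_trans se eb).
have iS (m : {measure set (measurableTypeR R) -> \bar R}) c e : 0 <= c -> e <= b ->
    m.-integrable `]0, b] (EFin \o phi) -> m.-integrable `]c, e] (EFin \o phi).
  move=> c0 eb; apply: integrableS; [exact: measurable_itv|exact: measurable_itv|].
  exact: sub.
have IE u : 0 <= u -> u <= b ->
    I u = \int[LS G]_(s in `]0, u]) phi s - \int[LS H]_(s in `]0, u]) phi s.
  move=> u0 ub; have [G' [H' [fGH' iG' iH' ->]]] := hI u u0.
  apply: stieltjes_split_unique => //.
  - by move=> s s0; rewrite -fGH' -?fGH.
  - exact: iS.
  - exact: iS.
have split (m : {measure set (measurableTypeR R) -> \bar R}) u w :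
    0 <= u -> u <= w -> w <= b -> m.-integrable `]0, b] (EFin \o phi) ->
    \int[m]_(s in `]0, w]) phi s
      = \int[m]_(s in `]0, u]) phi s + \int[m]_(s in `]u, w]) phi s.
  move=> u0 uw wb im; rewrite -Rintegral_setU.
  - congr (Rintegral m _ phi); apply/seteqP; split => s /=; rewrite !in_itv/=.
      by move=> /andP[-> ->]/=; rewrite andbT; case: (leP s u); [left|right].
    by move=> [|] /andP[h1 h2]; rewrite ?h1 ?h2 ?(le_trans h2)// (le_lt_trans u0).
  - exact: measurable_itv.
  - exact: measurable_itv.
  - apply: integrableS im; [exact: measurable_itv| |].
      by apply: measurableU; exact: measurable_itv.
    move=> s [|]; apply: sub => //; exact: le_trans uw wb.
  - apply/disj_setPS => s [] /=; rewrite !in_itv/= => /andP[_ su] /andP[us _].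
    by move: us; rewrite ltNge su.
move=> u w u0 uw wb; rewrite (IE w (le_trans u0 uw) wb) (IE u u0 (le_trans uw wb)).
by rewrite (split _ _ _ u0 uw wb iG) (split _ _ _ u0 uw wb iH) sub_sum.
Qed.

(** The increments of [x] are controlled by those of a nondecreasing function [W]. Continuity of [x]
    then makes the sum of squares tend to [0]: a driver of finite variation contributes no quadratic
    variation, hence the coefficient [0] in front of the mesh. *)
Lemma LS_path_approx (x f phi psi bj beta r : R -> R) (x0 v : R) a b :
  0 < v -> 0 <= a -> a < b -> continuous_path x ->
  continuous_path psi -> continuous_path beta -> continuous_path r ->
  (forall s, 0 <= s -> v < psi s) ->
  leb.-integrable `[0, b] (EFin \o bj) ->
  (forall s, a <= s <= b -> bj s = beta s) ->
  (forall s, a <= s <= b -> phi s = psi s) ->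
  (forall t, 0 <= t ->
    is_LS_integral f phi t (x t - x0 - \int[leb]_(s in `[0, t]) bj s)) ->
  exists2 Q, 0 <= Q & forall e (N : nat), 0 < e -> exists n, [/\ (N <= n)%N,
     `|\sum_(k < n) ((psi (grid a b n k))^-1 *
         (x (grid a b n k.+1) - x (grid a b n k)
          - beta (grid a b n k) * ((b - a) / n%:R))
         - (f (grid a b n k.+1) - f (grid a b n k)))| <= e,
     `|\sum_(k < n) r (grid a b n k) *
         ((x (grid a b n k.+1) - x (grid a b n k)) ^+ 2
          - 0 * ((b - a) / n%:R))| <= e &
     \sum_(k < n) (x (grid a b n k.+1) - x (grid a b n k)) ^+ 2 <= Q].
Proof.
move=> v0 a0 ab cx cpsi cbeta cr vpsi ibj bjE phiE hI.
have b0 : 0 <= b := le_trans a0 (ltW ab).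
have [G [H [fGH iG iH IE]]] := LS_increments b0 hI.
have ndG := cumulative_is_nondecreasing G; have ndH := cumulative_is_nondecreasing H.
(* Dominates time and the variation of the driver together. *)
pose W s := s + G s + H s.
have ndW s t : s <= t -> W s <= W t.
  by move=> st; rewrite /W !lerD//; [exact: ndG|exact: ndH].
have incr u w : a <= u -> u <= w -> w <= b -> x w - x u =
    \int[leb]_(s in `[u, w]) beta s
    + (\int[LS G]_(s in `]u, w]) phi s - \int[LS H]_(s in `]u, w]) phi s).
  move=> au uw wb; have u0 := le_trans a0 au.
  have := IE u w u0 uw wb.
  have iw : leb.-integrable `[0, w] (EFin \o bj).
    by apply: integrableS ibj => //; apply: subset_itv; rewrite bnd_simp.
  rewrite (Rintegral_itv_split u0 uw iw).
  have -> : \int[leb]_(s in `[u, w]) bj s = \int[leb]_(s in `[u, w]) beta s.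
    apply: eq_Rintegral => s; rewrite inE/= in_itv/= => /andP[us sw].
    by apply: bjE; rewrite (le_trans au us) (le_trans sw wb).
  exact: sub_shift.
have close u w c c' e : a <= u -> u <= w -> w <= b ->
    (forall s, u <= s <= w -> `|beta s - c| <= e /\ `|psi s - c'| <= e) ->
    `|x w - x u - c * (w - u) - c' * (f w - f u)| <= e * (W w - W u).
  move=> au uw wb h; have u0 := le_trans a0 au; rewrite (incr u w au uw wb).
  rewrite (fGH w) ?(le_trans u0)// (fGH u)//.
  have H1 : `|\int[leb]_(s in `[u, w]) beta s - c * (w - u)| <= e * (w - u).
    apply: Rintegral_itv_close => //; first exact: continuous_path_integrable.
    by move=> s /h[].
  have HG K : (LS K).-integrable `]0, b] (EFin \o phi) ->
      `|\int[LS K]_(s in `]u, w]) phi s - c' * (K w - K u)| <= e * (K w - K u).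
    move=> iK; apply: Rintegral_close; first exact: measurable_itv.
    - exact: stieltjes_itv.
    - apply: integrableS iK; [exact: measurable_itv|exact: measurable_itv|].
      by apply: subset_itv; rewrite bnd_simp.
    - move=> s; rewrite /= in_itv/= => /andP[/ltW us sw].
      rewrite phiE; first by apply: (h s _).2; rewrite us.
      by rewrite (le_trans au us) (le_trans sw wb).
  have [H2 H3] := (HG G iG, HG H iH).
  exact: close_sum.
have [Cb Cb0 hCb] := continuous_path_bounded b cbeta.
have [Cp Cp0 hCp] := continuous_path_bounded b cpsi.
have [Cr Cr0 hCr] := continuous_path_bounded b cr.
pose C := Cb + Cp; have C0 : 0 < C by exact: addr_gt0.
have size u w : a <= u -> u <= w -> w <= b -> `|x w - x u| <= C * (W w - W u).
  move=> au uw wb; have := close u w 0 0 C au uw wb; rewrite !mul0r !subr0; apply.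
  move=> s /andP[us sw]; rewrite !subr0; have sb : 0 <= s <= b.
    by rewrite (le_trans a0 (le_trans au us)) (le_trans sw wb).
  by split; [apply: le_trans (hCb _ sb) _|apply: le_trans (hCp _ sb) _]; rewrite /C; lra.
have Wab : 0 < W b - W a.
  by have := ndG _ _ (ltW ab); have := ndH _ _ (ltW ab); rewrite /W; lra.
exists (C * (W b - W a)); first by rewrite mulr_ge0 ?ltW.
(* [v^-1] is for the first-order sum and [Cr * C] for the weighted squares; [e'] is chosen so that
   [e' * Z] is at most [e]. *)
move=> e N e0; pose Z := (v^-1 + Cr * C) * (W b - W a).
have Z0 : 0 < Z by rewrite mulr_gt0// addr_gt0 ?invr_gt0// mulr_gt0.
pose e' := Num.min 1 (e / Z).
have e'0 : 0 < e' by rewrite lt_min ltr01 divr_gt0.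
have e'1 : e' <= 1 by rewrite ge_min lexx.
have e'Z : e' * Z <= e by rewrite -ler_pdivlMr// ge_min lexx orbT.
have [d1 d10 h1] := continuous_path_uniform b cbeta e'0.
have [d2 d20 h2] := continuous_path_uniform b cpsi e'0.
have [d3 d30 h3] := continuous_path_uniform b cx e'0.
pose del := Num.min d1 (Num.min d2 d3).
have del0 : 0 < del by rewrite !lt_min d10 d20.
have [n [[nN n0] mesh]] := @filter_ex _ \oo _ _ (filterI
  (filterI (nbhs_infty_ge N) (nbhs_infty_gt 0)) (grid_mesh a b del0)).
rewrite /= in nN n0 mesh; exists n.
have cell (k : 'I_n) : let u := grid a b n k in let w := grid a b n k.+1 in
  [/\ a <= u, u <= w, w <= b, w - u = (b - a) / n%:R &
   forall s, u <= s <= w -> [/\ `|beta s - beta u| <= e', `|psi s - psi u| <= e' &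
     `|x s - x u| <= e']].
  have /andP[k1 _] := grid_in (ltW ab) (ltnW (ltn_ord k)).
  have /andP[_ k2] := grid_in (ltW ab) (ltn_ord k).
  have kk : grid a b n k <= grid a b n k.+1 by apply: grid_le => //; exact: ltW.
  have kd : grid a b n k.+1 - grid a b n k = (b - a) / n%:R.
    by rewrite gridS addrAC subrr add0r.
  split => // s /andP[us sw].
  have sb : 0 <= s <= b by rewrite (le_trans a0 (le_trans k1 us)) (le_trans sw k2).
  have ub : 0 <= grid a b n k <= b by rewrite (le_trans a0 k1) (le_trans kk k2).
  have : `|s - grid a b n k| < del.
    by rewrite ger0_norm ?subr_ge0// (le_lt_trans _ mesh)// -kd lerD2r.
  rewrite !lt_min => /and3P[? ? ?].
  by split; apply: ltW; [exact: h1|exact: h2|exact: h3].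
have sumW c : \sum_(k < n) c * (W (grid a b n k.+1) - W (grid a b n k)) = c * (W b - W a).
  by rewrite -mulr_sumr (grid_sum a b W n0).
have sq (k : 'I_n) : (x (grid a b n k.+1) - x (grid a b n k)) ^+ 2
    <= e' * C * (W (grid a b n k.+1) - W (grid a b n k)).
  have [k1 k2 k3 _ hk] := cell k.
  have [|_ _ xk] := hk (grid a b n k.+1); first by rewrite k2 lexx.
  rewrite -real_normK ?num_real// expr2 -mulrA; apply: ler_pM => //.
  exact: size.
split => //.
- apply: le_trans (ler_norm_sum _ _ _) _.
  apply: (@le_trans _ _ (\sum_(k < n) v^-1 * e' * (W (grid a b n k.+1) - W (grid a b n k)))).
    apply: ler_sum => k _; have [k1 k2 k3 kd hk] := cell k.
    have psi0 : v < psi (grid a b n k) by apply: vpsi; exact: le_trans k1.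
    have psi00 := lt_trans v0 psi0.
    have -> : (psi (grid a b n k))^-1 * (x (grid a b n k.+1) - x (grid a b n k)
        - beta (grid a b n k) * ((b - a) / n%:R)) - (f (grid a b n k.+1) - f (grid a b n k))
      = (psi (grid a b n k))^-1 * (x (grid a b n k.+1) - x (grid a b n k)
        - beta (grid a b n k) * (grid a b n k.+1 - grid a b n k)
        - psi (grid a b n k) * (f (grid a b n k.+1) - f (grid a b n k))).
      by rewrite kd; field; rewrite pnatr_eq0 -lt0n n0 lt0r_neq0.
    rewrite normrM -mulrA ger0_norm ?invr_ge0 ?(ltW psi00)//.
    apply: ler_pM => //; first by rewrite invr_ge0 ltW.
      by rewrite lef_pV2 ?posrE// ltW.
    by apply: close => // s /hk[].
  rewrite sumW; apply: le_trans e'Z; rewrite /Z [leRHS]mulrA ler_pM2r//.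
  by rewrite [leRHS]mulrDr [leLHS]mulrC lerDl !mulr_ge0 ?ltW.
- apply: le_trans (ler_norm_sum _ _ _) _.
  apply: (@le_trans _ _ (\sum_(k < n) Cr * (e' * C) *
      (W (grid a b n k.+1) - W (grid a b n k)))).
    apply: ler_sum => k _; have [k1 k2 k3 kd hk] := cell k.
    rewrite mul0r subr0 normrM -mulrA; apply: ler_pM => //.
      apply: hCr; rewrite (le_trans a0 k1)/=; exact: le_trans k2 k3.
    by rewrite ger0_norm ?sqr_ge0.
  rewrite sumW; apply: le_trans e'Z; rewrite /Z [leRHS]mulrA ler_pM2r//.
  by rewrite [leRHS]mulrDr [leLHS]mulrCA lerDr mulr_ge0 ?invr_ge0 ?ltW.
- apply: (@le_trans _ _ (\sum_(k < n) C * (W (grid a b n k.+1) - W (grid a b n k)))).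
    apply: ler_sum => k _; apply: le_trans (sq k) _; have [_ k2 _ _ _] := cell k.
    rewrite ler_wpM2r ?subr_ge0 ?ndW//.
    by rewrite ger_pMl.
  by rewrite sumW.
Qed.

End stieltjes.

(** * Ito equations *)

Section ito_paths.
Context {R : realType}.
Local Notation leb := (@lebesgue_measure R).

(** A deterministic statement: on each cell the increment of [x] is [psi] times that of [B], plus
    the Ito residual [res], plus the drift part [dr]. The sums of [res ^+ 2] and [dr ^+ 2] are small
    and that of [dB ^+ 2] is bounded, for infinitely many meshes. *)
Lemma ito_path_approx (x B I psi beta m : R -> R) (v V a b : R) :
  0 < v -> 0 < V -> 0 <= a -> a < b -> continuous_path x ->
  continuous_path psi -> continuous_path beta -> continuous_path m ->
  (forall s, 0 <= s -> v < psi s < V) ->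
  (forall u w, a <= u -> u <= w -> w <= b ->
    x w - x u = \int[leb]_(s in `[u, w]) beta s + (I w - I u)) ->
  (forall (e : R) (N : nat), 0 < e -> exists2 n, (N <= n)%N &
    let g := grid a b n in
    `|\sum_(k < n) (psi (g k))^-1 * (I (g k.+1) - I (g k)
        - psi (g k) * (B (g k.+1) - B (g k)))|
    + \sum_(k < n) (I (g k.+1) - I (g k) - psi (g k) * (B (g k.+1) - B (g k))) ^+ 2
    + `|\sum_(k < n) m (g k) * ((B (g k.+1) - B (g k)) ^+ 2 - (b - a) / n%:R)|
    + `|\sum_(k < n) ((B (g k.+1) - B (g k)) ^+ 2 - (b - a) / n%:R)| < e) ->
  exists2 Q, 0 <= Q & forall (e : R) (N : nat), 0 < e -> exists n, [/\ (N <= n)%N,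
     `|\sum_(k < n) ((psi (grid a b n k))^-1 *
         (x (grid a b n k.+1) - x (grid a b n k)
          - beta (grid a b n k) * ((b - a) / n%:R))
         - (B (grid a b n k.+1) - B (grid a b n k)))| <= e,
     `|\sum_(k < n) m (grid a b n k) / psi (grid a b n k) ^+ 2 *
         ((x (grid a b n k.+1) - x (grid a b n k)) ^+ 2
          - psi (grid a b n k) ^+ 2 * ((b - a) / n%:R))| <= e &
     \sum_(k < n) (x (grid a b n k.+1) - x (grid a b n k)) ^+ 2 <= Q].
Proof.
move=> v0 V0 a0 ab cx cpsi cbeta cm psib incr often.
have ba0 : 0 < b - a by rewrite subr_gt0.
have [C C0 hC] := continuous_path_bounded b cbeta.
have [A A0 hA] := continuous_path_bounded b cm.
have C20 : 0 < C ^+ 2 * (b - a) by rewrite mulr_gt0 ?exprn_gt0.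
exists (2 * V ^+ 2 * (b - a + 1) + 4 + 4 * (C ^+ 2 * (b - a))).
  have h1 : 0 <= V ^+ 2 * (b - a + 1) by rewrite mulr_ge0 ?sqr_ge0//; lra.
  by move: h1 C20; lra.
move=> e N e0; pose r0 := A / v ^+ 2.
have r00 : 0 < r0 by rewrite divr_gt0// exprn_gt0.
pose K1 := r0 * V * (b - a + 1).
have K10 : 0 < K1 by apply: mulr_gt0; [exact: mulr_gt0|lra].
(* Weight in Young's inequality for the cross term: the part in [dB ^+ 2] costs [K1 * eta = e / 4],
   while the part in [(res + dr) ^+ 2] pays with [K2] and [K3]. *)
pose eta := e / (4 * K1).
have eta0 : 0 < eta by rewrite divr_gt0// mulr_gt0.
pose K2 := r0 * (V / eta + 1) * 2.
have Ve0 : 0 < V / eta + 1 by rewrite ltr_wpDl// divr_ge0// ltW.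
have K20 : 0 < K2 by apply: mulr_gt0 => //; exact: mulr_gt0.
pose K3 := K2 * (C ^+ 2 * (b - a)).
have K30 : 0 < K3 by exact: mulr_gt0.
pose e' := Num.min (Num.min 1 (e / 2)) (e / (4 * (1 + K2))).
have e'0 : 0 < e' by rewrite !lt_min ltr01 !divr_gt0// mulr_gt0// addr_gt0.
have e'1 : e' <= 1 by rewrite !ge_min lexx.
have e'2 : e' <= e / 2 by rewrite !ge_min lexx orbT.
have e'K : e' * (1 + K2) <= e / 4.
  rewrite -ler_pdivlMr ?addr_gt0//; have -> : e / 4 / (1 + K2) = e / (4 * (1 + K2)).
    by field; rewrite lt0r_neq0// addr_gt0.
  by rewrite !ge_min lexx orbT.
(* Tolerance for the drift: after division by [psi > v] and summation the error is at most
   [e / 2]. *)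
pose e1 := v * e / (2 * (b - a)).
have e10 : 0 < e1 by rewrite divr_gt0 ?mulr_gt0.
have [del del0 hdel] := continuous_path_uniform b cbeta e10.
pose del' := Num.min (Num.min 1 (e / (4 * K3))) del.
have del'0 : 0 < del' by rewrite !lt_min ltr01 del0 divr_gt0// mulr_gt0.
have [N' _ mesh] := @filterI _ \oo _ _ _ (nbhs_infty_ge 1%N) (grid_mesh a b del'0).
have [n nN] := often e' (maxn N N') e'0.
have {mesh} /= [n0 mesh] : (0 < n)%N /\ (b - a) / n%:R < del'.
  by apply: mesh => /=; rewrite (leq_trans _ nN)// leq_maxr.
have {}nN : (N <= n)%N by rewrite (leq_trans _ nN)// leq_maxl.
set g := grid a b n; pose D := (b - a) / n%:R; rewrite -/D in mesh *.
have D0 : 0 < D by rewrite divr_gt0// ltr0n.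
have D1 : D <= 1 by move: mesh; rewrite !lt_min => /andP[/andP[/ltW]].
have DK : D * K3 <= e / 4.
  move: mesh; rewrite !lt_min => /andP[/andP[_ /ltW h] _].
  rewrite -ler_pdivlMr//; apply: le_trans h _; rewrite le_eqVlt; apply/orP; left.
  by apply/eqP; field; rewrite lt0r_neq0.
have Ddel : D < del by move: mesh; rewrite !lt_min => /andP[].
have sumD (c : R) : \sum_(k < n) c * D = c * (b - a).
  rewrite sumr_const card_ord -[LHS]mulr_natr /D; field.
  by rewrite pnatr_eq0 -lt0n.
pose dB (k : 'I_n) := B (g k.+1) - B (g k).
pose res (k : 'I_n) := I (g k.+1) - I (g k) - psi (g k) * dB k.
pose dr (k : 'I_n) := \int[leb]_(s in `[g k, g k.+1]) beta s.
rewrite /= => small.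
have {}small : `|\sum_(k < n) (psi (g k))^-1 * res k| + \sum_(k < n) res k ^+ 2
    + `|\sum_(k < n) m (g k) * (dB k ^+ 2 - D)| + `|\sum_(k < n) (dB k ^+ 2 - D)| < e'
  := small.
have p1 := normr_ge0 (\sum_(k < n) (psi (g k))^-1 * res k).
have p2 : 0 <= \sum_(k < n) res k ^+ 2 by apply: sumr_ge0 => k _; exact: sqr_ge0.
have p3 := normr_ge0 (\sum_(k < n) m (g k) * (dB k ^+ 2 - D)).
have p4 := normr_ge0 (\sum_(k < n) (dB k ^+ 2 - D)).
have s1 : `|\sum_(k < n) (psi (g k))^-1 * res k| < e' by lra.
have s2 : \sum_(k < n) res k ^+ 2 < e' by lra.
have s3 : `|\sum_(k < n) m (g k) * (dB k ^+ 2 - D)| < e' by lra.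
have s4 : \sum_(k < n) dB k ^+ 2 < b - a + 1.
  have : `|\sum_(k < n) (dB k ^+ 2 - D)| < e' by lra.
  rewrite sumrB; have := sumD 1; under eq_bigr do rewrite mul1r.
  by move=> ->; rewrite ltr_norml => /andP[_]; lra.
have cell (k : 'I_n) : [/\ a <= g k, g k <= g k.+1, g k.+1 <= b & g k.+1 - g k = D].
  have /andP[k1 _] := grid_in (ltW ab) (ltnW (ltn_ord k)).
  have /andP[_ k2] := grid_in (ltW ab) (ltn_ord k).
  have kk : g k <= g k.+1 by apply: grid_le => //; exact: ltW.
  by split => //; rewrite /g gridS addrAC subrr add0r.
have inb (k : 'I_n) s : g k <= s <= g k.+1 -> 0 <= s <= b.
  by move=> /andP[ks sk]; have [k1 k2 k3 _] := cell k;
    rewrite (le_trans a0 (le_trans k1 ks)) (le_trans sk k3).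
have gk (k : 'I_n) : 0 <= g k <= b.
  by apply: (inb k); have [_ k2 _ _] := cell k; rewrite lexx.
have dr_close (k : 'I_n) : `|dr k - beta (g k) * D| <= e1 * D.
  have [k1 k2 k3 <-] := cell k; apply: Rintegral_itv_close => //.
    by apply: continuous_path_integrable => //; exact: le_trans k1.
  move=> s ks; apply/ltW/hdel; [exact: inb ks|exact: gk|].
  have /andP[ks1 ks2] := ks; rewrite ger0_norm ?subr_ge0// (le_lt_trans _ Ddel)//.
  by have [_ _ _ <-] := cell k; rewrite lerD2r.
have dr_size (k : 'I_n) : `|dr k| <= C * D.
  have := @Rintegral_itv_close _ beta (g k) (g k.+1) 0 C.
  have [k1 k2 k3 <-] := cell k; rewrite mul0r subr0; apply => //.
    by apply: continuous_path_integrable => //; exact: le_trans k1.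
  by move=> s /inb /hC; rewrite subr0.
have dr2 (k : 'I_n) : dr k ^+ 2 <= C ^+ 2 * D * D.
  rewrite -real_normK ?num_real// -mulrA -expr2 -exprMn lerXn2r ?nnegrE//.
  by rewrite mulr_ge0 ?ltW.
have dxE (k : 'I_n) : x (g k.+1) - x (g k) = psi (g k) * dB k + (res k + dr k).
  have [k1 k2 k3 _] := cell k; rewrite incr// -/(dr k) /res; ring.
have psik (k : 'I_n) : [/\ 0 < psi (g k), v < psi (g k) & psi (g k) < V].
  have /andP[k1 k2] := psib _ (proj1 (andP (gk k))).
  by split => //; exact: lt_trans k1.
have psiV (k : 'I_n) : 0 < (psi (g k))^-1 <= v^-1.
  have [k1 k2 _] := psik k; rewrite invr_gt0 k1 lef_pV2 ?posrE//; exact: ltW.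
have rk (k : 'I_n) : `|m (g k) / psi (g k) ^+ 2| <= r0.
  have [k1 k2 _] := psik k; rewrite normrM; apply: ler_pM => //; first exact: hA.
  rewrite ger0_norm ?invr_ge0 ?sqr_ge0// lef_pV2 ?posrE ?exprn_gt0//.
  by rewrite lerXn2r ?nnegrE ?ltW.
have rd (k : 'I_n) : (res k + dr k) ^+ 2 <= 2 * res k ^+ 2 + 2 * (C ^+ 2 * D * D).
  have := sqr_ge0 (res k - dr k); have := dr2 k; nra.
have sumrd : \sum_(k < n) (res k + dr k) ^+ 2 <= 2 * e' + 2 * (C ^+ 2 * (b - a)) * D.
  apply: (@le_trans _ _ (\sum_(k < n) (2 * res k ^+ 2 + 2 * (C ^+ 2 * D * D)))).
    by apply: ler_sum => k _.
  rewrite big_split/= -mulr_sumr.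
  have -> : \sum_(k < n) 2 * (C ^+ 2 * D * D) = 2 * (C ^+ 2 * (b - a)) * D.
    transitivity (2 * (C ^+ 2 * D) * (b - a)); last by ring.
    by rewrite -sumD; apply: eq_bigr => k _; rewrite !mulrA.
  by rewrite lerD2r ler_pM2l// ltW.
exists n; split => //.
- have -> : \sum_(k < n) ((psi (g k))^-1 * (x (g k.+1) - x (g k) - beta (g k) * D)
      - (B (g k.+1) - B (g k)))
    = \sum_(k < n) (psi (g k))^-1 * res k + \sum_(k < n) (psi (g k))^-1 * (dr k - beta (g k) * D).
    rewrite -big_split/=; apply: eq_bigr => k _; rewrite dxE -/(dB k).
    by have [k1 _ _] := psik k; field; exact: lt0r_neq0.
  apply: le_trans (ler_normD _ _) _; rewrite [leRHS]splitr; apply: lerD.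
    exact: le_trans (ltW s1) _.
  apply: le_trans (ler_norm_sum _ _ _) _.
  apply: (@le_trans _ _ (\sum_(k < n) v^-1 * e1 * D)).
    apply: ler_sum => k _; have /andP[k1 k2] := psiV k.
    by rewrite normrM gtr0_norm// -mulrA; apply: ler_pM => //; exact: ltW.
  rewrite sumD /e1 le_eqVlt; apply/orP; left; apply/eqP; field.
  by rewrite !lt0r_neq0.
(* The factor [psi ^+ 2] cancels against the denominator, which is why [often] weighs the quadratic
   variation by [m] alone. *)
- have -> : \sum_(k < n) m (g k) / psi (g k) ^+ 2
      * ((x (g k.+1) - x (g k)) ^+ 2 - psi (g k) ^+ 2 * D)
    = \sum_(k < n) m (g k) * (dB k ^+ 2 - D) + \sum_(k < n) m (g k) / psi (g k) ^+ 2
        * (2 * psi (g k) * dB k * (res k + dr k) + (res k + dr k) ^+ 2).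
    rewrite -big_split/=; apply: eq_bigr => k _; rewrite dxE.
    by have [k1 _ _] := psik k; field; exact: lt0r_neq0.
  apply: le_trans (ler_normD _ _) _.
  have cross : `|\sum_(k < n) m (g k) / psi (g k) ^+ 2
        * (2 * psi (g k) * dB k * (res k + dr k) + (res k + dr k) ^+ 2)|
      <= r0 * (V * eta * (b - a + 1) + (V / eta + 1) *
           (2 * e' + 2 * (C ^+ 2 * (b - a)) * D)).
    apply: le_trans (ler_norm_sum _ _ _) _.
    apply: (@le_trans _ _ (\sum_(k < n) r0 * (V * eta * dB k ^+ 2
        + (V / eta + 1) * (res k + dr k) ^+ 2))).
      apply: ler_sum => k _; rewrite normrM; apply: ler_pM => //.
      apply: le_trans (ler_normD _ _) _; rewrite (ger0_norm (sqr_ge0 _)).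
      rewrite [(V / eta + 1) * _]mulrDl mul1r addrA lerD2r.
      have [k1 _ k2] := psik k.
      have -> : V * eta * dB k ^+ 2 + V / eta * (res k + dr k) ^+ 2
        = V * (eta * dB k ^+ 2 + (res k + dr k) ^+ 2 / eta) by ring.
      have -> : 2 * psi (g k) * dB k * (res k + dr k)
        = psi (g k) * (2 * dB k * (res k + dr k)) by ring.
      rewrite normrM gtr0_norm//; apply: ler_pM => //; [exact: ltW|exact: ltW|].
      have sq1 := sqr_ge0 (eta * dB k - (res k + dr k)).
      have sq2 := sqr_ge0 (eta * dB k + (res k + dr k)).
      have -> : eta * dB k ^+ 2 + (res k + dr k) ^+ 2 / eta
        = ((eta * dB k) ^+ 2 + (res k + dr k) ^+ 2) / eta.
        by field; exact: lt0r_neq0.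
      rewrite ler_pdivlMr// -(gtr0_norm eta0) -normrM ler_norml (gtr0_norm eta0).
      by apply/andP; split; nra.
    rewrite -mulr_sumr ler_pM2l// big_split/= -!mulr_sumr; apply: lerD.
      by apply: ler_wpM2l; [apply/ltW; exact: mulr_gt0|exact: ltW].
    by apply: ler_wpM2l => //; exact: ltW.
  apply: le_trans (lerD (ltW s3) cross) _.
  have -> : r0 * (V * eta * (b - a + 1) + (V / eta + 1) *
           (2 * e' + 2 * (C ^+ 2 * (b - a)) * D)) = K1 * eta + K2 * e' + D * K3.
    by rewrite /K1 /K3 /K2; ring.
  have K1e : K1 * eta = e / 4 by rewrite /eta; field; exact: lt0r_neq0.
  rewrite K1e; move: e'K DK; lra.
- apply: (@le_trans _ _ (\sum_(k < n) (2 * V ^+ 2 * dB k ^+ 2 + 2 * (res k + dr k) ^+ 2))).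
    apply: ler_sum => k _; rewrite dxE; have [k1 _ k2] := psik k.
    have h1 : (psi (g k) * dB k) ^+ 2 <= V ^+ 2 * dB k ^+ 2.
      by rewrite exprMn ler_wpM2r ?sqr_ge0// lerXn2r ?nnegrE ?ltW.
    have := sqr_ge0 (psi (g k) * dB k - (res k + dr k)); nra.
  rewrite big_split/= -!mulr_sumr.
  have h1 : 2 * V ^+ 2 * \sum_(k < n) dB k ^+ 2 <= 2 * V ^+ 2 * (b - a + 1).
    by rewrite ler_pM2l ?mulr_gt0 ?exprn_gt0// ltW.
  have h2 : C ^+ 2 * (b - a) * D <= C ^+ 2 * (b - a) * 1 by rewrite ler_pM2l.
  move: sumrd h1 h2; lra.
Qed.

End ito_paths.

(** * Primitives, rational endpoints and Gronwall's inequality *)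

Section primitive_paths.
Context {R : realType}.
Local Notation leb := (@lebesgue_measure R).

Lemma primitive_continuous (f : R -> R) : continuous_path f ->
  continuous_path (fun t => \int[leb]_(s in `[0, t]) f s).
Proof.
move=> cf; apply: continuous_pathP => s e s0 e0.
have [C C0 hC] := continuous_path_bounded (s + 1) cf.
have int (a b : R) : 0 <= a -> leb.-integrable `[a, b] (EFin \o f).
  by move=> a0; exact: continuous_path_integrable.
have bnd a b : 0 <= a -> a <= b -> b <= s + 1 ->
    `|\int[leb]_(u in `[0, b]) f u - \int[leb]_(u in `[0, a]) f u| <= C * (b - a).
  move=> a0 ab bs; rewrite (Rintegral_itv_split a0 ab (int _ _ (lexx 0))).
  rewrite addrAC subrr add0r; have := @Rintegral_itv_close _ f a b 0 C ab (int _ _ a0).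
  rewrite mul0r subr0; apply => u /andP[au ub]; rewrite subr0; apply: hC.
  by rewrite (le_trans a0 au) (le_trans ub bs).
exists (Num.min 1 (e / C)); first by rewrite lt_min ltr01 divr_gt0.
move=> r r0; rewrite lt_min => /andP[rs1 rse].
rewrite ltr_pdivlMr// in rse.
have rs : r <= s + 1 by move: rs1; rewrite ltr_norml => /andP[_]; lra.
have [sr|/ltW rs'] := leP s r.
  apply: le_lt_trans (bnd _ _ s0 sr rs) _.
  by rewrite mulrC -[X in X * _]ger0_norm ?subr_ge0.
rewrite distrC; apply: le_lt_trans (bnd _ _ r0 rs' _) _; first by lra.
by rewrite mulrC -[X in X * _]ger0_norm ?subr_ge0// distrC.
Qed.

Lemma Rintegral_primitive (f : R -> R) a b : 0 <= a -> a <= b -> continuous_path f ->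
  \int[leb]_(s in `[a, b]) f s
    = \int[leb]_(s in `[0, b]) f s - \int[leb]_(s in `[0, a]) f s.
Proof.
move=> a0 ab cf; rewrite (Rintegral_itv_split a0 ab); first by rewrite addrAC subrr add0r.
exact: continuous_path_integrable.
Qed.

(** Equality at rationals close to both ends passes to the ends by continuity; in this way an
    identity proved for rational times reaches random ones. *)
Lemma constant_on_rationals (phi : R -> R) (a b : R) :
  continuous_path phi -> 0 <= a -> a < b ->
  (forall p q : rat, a < ratr p -> (ratr p : R) < ratr q -> ratr q < b ->
    phi (ratr p) = phi (ratr q)) -> phi a = phi b.
Proof.
move=> cphi a0 ab h; apply/eqP; rewrite -subr_eq0 -normr_le0.
apply/ler_addgt0Pr => e e0; rewrite add0r.
have e20 : 0 < e / 2 by rewrite divr_gt0.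
have b0 := le_trans a0 (ltW ab).
have [d1 d10 h1] := continuous_path_at cphi a0 e20.
have [d2 d20 h2] := continuous_path_at cphi b0 e20.
pose c := (a + b) / 2; have [ac cb] : a < c /\ c < b by rewrite /c; split; lra.
have [|p] := @rat_in_itvoo R a (Num.min c (a + d1)).
  by rewrite lt_min ac ltrDl.
rewrite in_itv/= lt_min => /andP[ap /andP[pc pd]].
have [|q] := @rat_in_itvoo R (Num.max c (b - d2)) b.
  by rewrite gt_max cb ltrBlDr ltrDl.
rewrite in_itv/= gt_max => /andP[/andP[cq dq] qb].
have H1 : `|phi (ratr p) - phi a| < e / 2.
  by apply: h1; [exact: le_trans (ltW ap)|rewrite gtr0_norm ?subr_gt0//; lra].
have H2 : `|phi (ratr q) - phi b| < e / 2.
  apply: h2; first by apply: ltW; exact: le_lt_trans (lt_trans ac cq).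
  by rewrite ltr0_norm ?subr_lt0//; lra.
rewrite (h p q ap (lt_trans pc cq) qb) in H1.
apply: le_trans (ler_distD (phi (ratr q)) _ _) _.
by rewrite [leRHS]splitr distrC; apply: lerD; exact: ltW.
Qed.

(* Gronwall's inequality by steps of length [1 / (2 * M)], on each of which the
   supremum of [`|z|] is absorbed by the left-hand side. *)
Lemma gronwall_steps (z : R -> R) (a b M Phi : R) (n : nat) :
  0 <= a -> 0 < M -> 0 <= Phi -> continuous_path z ->
  (forall s t S : R, a <= s -> s <= t -> t < b ->
    (forall u, s <= u <= t -> `|z u| <= S) ->
    `|z t - z s| <= M * S * (t - s) + 2 * Phi) ->
  forall t, a <= t -> t < b -> t <= a + n%:R / (2 * M) ->
    `|z t| + 4 * Phi <= 2 ^+ n * (`|z a| + 4 * Phi).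
Proof.
move=> a0 M0 Phi0 cz h.
have step s t : a <= s -> s <= t -> t < b -> t - s <= (2 * M)^-1 ->
    `|z t| + 4 * Phi <= 2 * (`|z s| + 4 * Phi).
  move=> as_ st tb ts.
  have s0 := le_trans a0 as_.
  have czs : {within `[s, t], continuous (fun u => `|z u|)}.
    move=> u; apply: continuous_comp; last exact: norm_continuous.
    exact: (continuous_path_within s0 cz).
  (* At the maximum point [c] the step length makes the integral term at most half of [|z c|], so
     [|z c| <= 2 * |z s| + 4 * Phi]; adding [4 * Phi] on both sides turns this into a doubling. *)
  have [c] := EVT_max st czs; rewrite in_itv/= => /andP[sc ct] hc.
  have zc := h s c `|z c| as_ sc (le_lt_trans ct tb).
  have {}zc : `|z c - z s| <= M * `|z c| * (c - s) + 2 * Phi.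
    by apply: zc => u /andP[su uc]; apply: hc; rewrite in_itv/= su (le_trans uc).
  have small : M * `|z c| * (c - s) <= `|z c| / 2.
    apply: (@le_trans _ _ (M * `|z c| * (2 * M)^-1)).
      rewrite ler_wpM2l ?mulr_ge0// ?(ltW M0)//; apply: le_trans ts.
      by rewrite lerD2r.
    rewrite le_eqVlt; apply/orP; left; apply/eqP; field; exact: lt0r_neq0.
  have := ler_normD (z c - z s) (z s); rewrite subrK => tri.
  have : `|z t| <= `|z c| by apply: hc; rewrite in_itv/= st lexx.
  lra.
elim: n => [|n IHn] t at_ tb tn.
  rewrite mul0r addr0 in tn; have -> : t = a by apply/eqP; rewrite eq_le tn.
  by rewrite expr0 mul1r.
have [tn'|/ltW tn'] := leP t (a + n%:R / (2 * M)).
  apply: le_trans (IHn _ at_ tb tn') _; rewrite exprS -mulrA ler_peMl ?ler1n//.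
  by rewrite mulr_ge0 ?exprn_ge0// addr_ge0// mulr_ge0.
have st : a <= a + n%:R / (2 * M) by rewrite lerDl divr_ge0// mulr_ge0// ltW.
apply: le_trans (step _ _ st tn' tb _) _.
  by move: tn; rewrite -natr1 mulrDl mul1r; lra.
rewrite exprS -mulrA ler_pM2l//; apply: IHn => //.
exact: le_lt_trans tb.
Qed.

End primitive_paths.

Section lamperti_stability.
Context {R : realType}.
Local Notation leb := (@lebesgue_measure R).
Variables (sigma mu : R -> R -> R) (x0 v V M : R).
Hypotheses (v0 : 0 < v) (sb : forall t x, 0 <= t -> v < sigma t x < V)
  (ls : box_lipschitz sigma) (ls1 : box_lipschitz (partial1 sigma))
  (ls2 : box_lipschitz (partial2 sigma)) (lmu : box_lipschitz mu) (M0 : 0 < M).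
Local Notation F := (lamperti x0 sigma).
Local Notation D := (lamperti_drift sigma mu x0).
Hypothesis DM : forall t x y, 0 <= t -> `|D t x - D t y| <= M * `|F t x - F t y|.

Definition lamperti_equation (x f : R -> R) (a b : R) : Prop :=
  F b (x b) - F a (x a) = \int[leb]_(u in `[a, b]) D u (x u) + (f b - f a).

(** The equations are assumed strictly before [b], since [J] may jump at [b]; the bound reaches [b]
    by continuity. In the constant, [v^-1] is the cost of passing to the transform, [V] of coming
    back, and [2 ^+ n] of Gronwall's inequality. *)
Lemma lamperti_stability (x y f g : R -> R) (a b T Phi : R) (n : nat) :
  0 <= a -> a < b -> b <= T -> T <= n%:R / (2 * M) -> 0 <= Phi ->
  continuous_path x -> continuous_path y ->
  (forall t, 0 <= t <= T -> `|f t - g t| <= Phi) ->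
  (forall s t, a <= s -> s < t -> t < b -> lamperti_equation x f s t) ->
  (forall s t, a <= s -> s < t -> t < b -> lamperti_equation y g s t) ->
  forall t, a <= t <= b ->
  `|x t - y t| <= V * 2 ^+ n * (v^-1 + 4) * (`|x a - y a| + Phi).
Proof.
move=> a0 ab bT Tn Phi0 cx cy fg eqx eqy.
have V0 : 0 < V by have /andP[h1 h2] := sb 0 (lexx 0); exact: lt_trans (lt_trans v0 h1) h2.
pose z t := F t (x t) - F t (y t).
have lF : box_lipschitz F by exact: box_lipschitz_lamperti v0 sb ls.
have lD : box_lipschitz D by exact: box_lipschitz_drift v0 sb ls ls1 ls2 lmu.
have cz : continuous_path z.
  by apply: continuous_pathB; [exact: box_lipschitz_path lF cx|exact: box_lipschitz_path lF cy].
have cDx := box_lipschitz_path lD cx; have cDy := box_lipschitz_path lD cy.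
have incr s t S : a <= s -> s <= t -> t < b -> (forall u, s <= u <= t -> `|z u| <= S) ->
    `|z t - z s| <= M * S * (t - s) + 2 * Phi.
  move=> as_; rewrite le_eqVlt => /predU1P[<-|st] tb zS.
    by rewrite !subrr normr0 mulr0 add0r mulr_ge0.
  have s0 := le_trans a0 as_; have sb' := lt_trans st tb.
  have -> : z t - z s = \int[leb]_(u in `[s, t]) (D u (x u) - D u (y u))
      + ((f t - g t) - (f s - g s)).
    rewrite RintegralB//; try exact: continuous_path_integrable.
    have := eqx s t as_ st tb; have := eqy s t as_ st tb.
    rewrite /lamperti_equation /z; move: (\int[_]_(_ in _) _) (\int[_]_(_ in _) _).
    by move=> ? ?; lra.
  apply: le_trans (ler_normD _ _) _; apply: lerD.
    have := @Rintegral_itv_close _ (fun u => D u (x u) - D u (y u)) s t 0 (M * S) (ltW st).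
    rewrite mul0r subr0; apply.
      by apply: continuous_path_integrable => //; exact: continuous_pathB.
    move=> u /[dup] sut /andP[su _]; rewrite subr0; apply: le_trans (DM _ _ _) _.
      exact: le_trans su.
    by rewrite ler_pM2l//; exact: zS.
  apply: le_trans (ler_normB _ _) _; rewrite mulr_natl mulr2n; apply: lerD; apply: fg.
    by rewrite (le_trans s0 (ltW st)) (le_trans (ltW tb) bT).
  by rewrite s0 (le_trans (ltW sb') bT).
have bound t : a <= t -> t < b ->
    `|x t - y t| <= V * 2 ^+ n * (v^-1 + 4) * (`|x a - y a| + Phi).
  move=> at_ tb; have tn : t <= a + n%:R / (2 * M).
    by apply: le_trans (ltW tb) (le_trans bT (le_trans Tn _)); rewrite lerDr.
  have zt := gronwall_steps a0 M0 Phi0 cz incr at_ tb tn.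
  have [_ low] := lamperti_dist x0 v0 sb ls (y t) (x t) (le_trans a0 at_).
  have [up _] := lamperti_dist x0 v0 sb ls (y a) (x a) a0.
  rewrite ler_pdivrMr// in low; apply: le_trans low _.
  have -> : V * 2 ^+ n * (v^-1 + 4) * (`|x a - y a| + Phi)
    = 2 ^+ n * ((v^-1 + 4) * (`|x a - y a| + Phi)) * V by ring.
  rewrite ler_pM2r//; have h : `|z t| <= `|z t| + 4 * Phi by rewrite lerDl mulr_ge0.
  apply: le_trans (le_trans h zt) _; rewrite ler_pM2l ?exprn_gt0//.
  apply: (@le_trans _ _ (`|x a - y a| / v + 4 * Phi)); first by rewrite lerD2r.
  have h1 : 0 <= v^-1 * Phi by rewrite mulr_ge0// invr_ge0 ltW.
  by have h2 := normr_ge0 (x a - y a); move: h1 h2; lra.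
move=> t /andP[at_]; rewrite le_eqVlt => /predU1P[->|]; last exact: bound.
have cxy : continuous_path (fun s => x s - y s) by exact: continuous_pathB.
apply/ler_addgt0Pr => e e0; have b0 := le_trans a0 (ltW ab).
have [del del0 h] := continuous_path_at cxy b0 e0.
pose s := Num.max a (b - del / 2).
have [as_ ds] : a <= s /\ b - del / 2 <= s by rewrite !le_max !lexx orbT.
have sb' : s < b by rewrite gt_max ab ltrBlDr ltrDl divr_gt0.
have bs : b - s < del by move: ds; lra.
have := h s (le_trans a0 as_); rewrite ltr0_norm ?subr_lt0// opprB => /(_ bs).
have := ler_normD (x s - y s) (x b - y b - (x s - y s)); rewrite [X in `|X|]addrC subrK.
by rewrite (distrC (x b - y b)); have := bound s as_ sb'; lra.
Qed.

End lamperti_stability.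

Lemma ae_forall_countable d (T : measurableType d) (R : realType)
    (m : {measure set T -> \bar R}) (C : countType) (Q : C -> T -> Prop) :
  (forall c, {ae m, forall x, Q c x}) -> {ae m, forall x, forall c, Q c x}.
Proof.
move=> h; have H : {ae m, forall x, forall n : nat,
    forall c : C, choice.unpickle n = Some c -> Q c x}.
  apply: ae_foralln => n; case: (choice.unpickle n) => [c|]; last first.
    by apply: filterE => x c.
  by move: (h c); apply: filterS => x Qx c' [<-].
by apply: filterS H => x H c; apply: (H (choice.pickle c)); rewrite choice.pickleK.
Qed.

Lemma small_in_proba_norm d (Omega : measurableType d) (R : realType)
    (P : probability Omega R) (Z : nat -> Omega -> R) :
  (forall n, measurable_fun setT (Z n)) -> small_in_proba P Z ->
  small_in_proba P (fun n w => `|Z n w|).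
Proof.
move=> mZ; apply: small_in_proba_le => //.
  by move=> n; apply: measurableT_comp.
by move=> n w; rewrite normr_id.
Qed.

Section switching_paths.
Context {R : realType} {E : finType}.

Lemma jump_times_countable (j : R -> E) :
  (forall T, 0 < T -> finite_set (jump_times j T)) ->
  countable (\bigcup_n jump_times j n.+1%:R).
Proof.
by move=> fj; apply: bigcup_countable => // n _; apply/finite_set_countable/fj.
Qed.

(** The left limit of [j] differs from its value only at jump times, which are countable. *)
Lemma switched_left_continuous (j : R -> E) (g : E -> R -> R) :
  cadlag j -> (forall T, 0 < T -> finite_set (jump_times j T)) ->
  (forall i, continuous_path (g i)) ->
  {ae lebesgue_measure, forall s : R, 0 < s -> forall e, 0 < e ->
    exists2 del, 0 < del & forall r, 0 <= r -> s - del < r -> r < s ->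
      `|g (j r) r - g (j s) s| < e}.
Proof.
move=> [_ lj] fj cg; pose A := \bigcup_n jump_times j n.+1%:R.
have cA : countable A := jump_times_countable fj.
exists A; split.
- exact: countable_measurable.
- exact: countable_lebesgue_measure0.
move=> s /= /not_implyP[s0]; apply: contra_notP => nA e e0.
have [i li] := lj s s0.
have jsi : j s = i.
  apply/eqP; apply: contra_notT nA => jsi.
  exists (Num.bound s) => //; split; last by exists i.
  rewrite s0/=; apply: ltW; apply: lt_trans (archi_boundP (ltW s0)) _.
  by rewrite ltr_nat.
have [d1 d10 h1] := continuous_path_at (cg i) (ltW s0) e0.
have [d2 /= d20 h2] := (iffLR (nbhs_ballP _ _) li : exists2 d2, _ & _).
exists (Num.min d1 d2); first by rewrite lt_min d10.
move=> r r0 sr rs.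
have : s - r < Num.min d1 d2 by move: sr; lra.
rewrite lt_min => /andP[sr1 sr2].
have jr : j r = i.
  by apply: h2; rewrite // /ball/= gtr0_norm ?subr_gt0.
rewrite jr jsi; apply: h1 => //.
by rewrite distrC gtr0_norm ?subr_gt0.
Qed.

End switching_paths.

(** * The transformed equations of the two processes *)

Section lamperti_sde.
Context {R : realType} {d : measure_display} {Omega : measurableType d}.
Variables (P : probability Omega R) (E : finType) (B X : R -> Omega -> R)
  (J : R -> Omega -> E) (mu sigma : E -> R -> R -> R) (x0 v V A : R).
Local Notation leb := (@lebesgue_measure R).
Local Notation filt := (augmented_filtration P B J).
Hypotheses (hB : brownian_motion P B) (hJ : jump_process J)
  (hBJ : independent_events P (sigma_process `[0, +oo[ B)
                              (sigma_state `[0, +oo[ J)).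
Hypotheses (v0 : 0 < v)
  (sb : forall i t x, 0 <= t -> v < sigma i t x < V)
  (sC : forall i, C11 (sigma i)) (lmu : forall i, box_lipschitz (mu i))
  (ls : forall i, box_lipschitz (sigma i))
  (ls1 : forall i, box_lipschitz (partial1 (sigma i)))
  (ls2 : forall i, box_lipschitz (partial2 (sigma i)))
  (d2A : forall i t x, 0 <= t -> `|partial2 (sigma i) t x| <= A).
Hypothesis hX : sde_solution P filt mu sigma x0 B J X.

Let hfb := augmented_filtered_brownian hB hJ hBJ.
Let fm t := @fb_measurable _ _ _ _ _ _ hfb t.

Let cX : continuous_process X. Proof. by case: hX. Qed.
Let aX : adapted filt X. Proof. by case: hX. Qed.
Let cXp w : continuous_path (X ^~ w). Proof. by case: cX. Qed.

Let box_path g w : box_lipschitz g -> continuous_path (fun s => g s (X s w)).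
Proof. by move=> lg; exact (box_lipschitz_path lg (@cXp w)). Qed.

Let box_wrt g s : box_lipschitz g -> 0 <= s ->
  measurable_wrt (filt s) (fun w => g s (X s w)).
Proof.
move=> lg s0; apply: measurable_wrt_comp (aX s0).
apply: continuous_measurable_fun; exact: box_lipschitz_continuous.
Qed.

Let box_process g : box_lipschitz g -> continuous_process (fun s w => g s (X s w)).
Proof.
move=> lg; split; last by move=> w; exact: box_path.
by move=> t t0; apply: (measurable_wrtW (@fm t)); exact: box_wrt.
Qed.

Let H s w := sigma (J s w) s (X s w).

Let state_wrt i s : 0 <= s -> measurable_wrt (filt s) (fun w => (J s w == i)%:R : R).
Proof.
move=> s0; apply/(measurable_wrtP _ (fb_sigma hfb s)).
have -> : (fun w => (J s w == i)%:R) = \1_(J s @^-1` [set i]) :> (Omega -> R).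
  apply/funext => w; rewrite indicE; congr (nat_of_bool _)%:R.
  by apply/eqP/idP; rewrite inE.
apply: measurable_indic; apply: sub_gen_smallest.
exact: augmented_state_measurable.
Qed.

Let H_wrt s : 0 <= s -> measurable_wrt (filt s) (H s).
Proof.
move=> s0; have -> : H s = (fun w => \sum_i (J s w == i)%:R * sigma i s (X s w)).
  apply/funext => w; rewrite (bigD1 (J s w))//= eqxx mul1r.
  by rewrite big1 ?addr0// => i; rewrite eq_sym => /negbTE ->; rewrite mul0r.
apply/(measurable_wrtP _ (fb_sigma hfb s)); apply: measurable_fun_finsum => i.
apply: measurable_funM.
  by apply/(measurable_wrtP _ (fb_sigma hfb s)); exact (@state_wrt i s s0).
by apply/(measurable_wrtP _ (fb_sigma hfb s)); exact (@box_wrt _ s (ls i) s0).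
Qed.

(** The weights use the coefficients of regime [i] on all paths, so they are adapted whatever [J]
    does. Only on the event that [J] stays in [i] does the integrand [H] coincide with [sigma i],
    and there the grid sums become those of [ito_path_approx]. *)
Lemma lamperti_sde_interval i a b : 0 <= a -> a < b ->
  {ae P, forall w, (forall s, a <= s <= b -> J s w = i) ->
    lamperti x0 (sigma i) b (X b w) - lamperti x0 (sigma i) a (X a w)
    = \int[leb]_(u in `[a, b]) lamperti_drift (sigma i) (mu i) x0 u (X u w)
      + (B b w - B a w)}.
Proof.
move=> a0 ab; have [cXp' _ [I [[mI cI] [S hS]] eqX]] := hX.
have b0 : 0 < b := le_lt_trans a0 ab.
have [gap0 sup0] := hS b b0.
have V0 : 0 < V by have /andP[_] := sb i 0 (lexx 0); have /andP[h _] := sb i 0 (lexx 0);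
  exact: lt_trans (lt_trans v0 h).
have [[mB cB] _ _ _] := hB.
have [mJ cJ fJ] := hJ.
have HV s w : 0 <= s -> `|H s w| <= V.
  move=> s0; have /andP[h1 h2] := sb (J s w) (X s w) s0.
  by rewrite ger0_norm ltW// (lt_trans v0).
have mH : measurable_fun setT
    (fun p : measurableTypeR R * Omega => H (Num.max 0 p.1) p.2).
  by apply: (switched_measurable hJ (g := fun j s w => sigma j s (X s w))) => j;
    exact: box_process.
have Hl w : {ae leb, forall s : R, 0 < s -> forall e : R, 0 < e ->
    exists2 del : R, 0 < del & forall r, 0 <= r -> s - del < r -> r < s ->
      `|H r w - H s w| < e}.
  by apply: (switched_left_continuous (g := fun j s => sigma j s (X s w))) => // [|j];
    [exact: fJ|exact: box_path].
pose w1 s w := (sigma i s (X s w))^-1.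
pose w2 s w := - partial2 (sigma i) s (X s w).
have lw1 := box_lipschitzV v0 (fun t x t0 => proj1 (andP (sb i x t0))) (ls i).
have lw2 : box_lipschitz (fun t x => - partial2 (sigma i) t x).
  have := box_lipschitzZ (-1) (ls2 i).
  by congr box_lipschitz; apply/funext => t; apply/funext => x; rewrite mulN1r.
have w1_wrt s : 0 <= s -> measurable_wrt (filt s) (w1 s).
  by move=> s0; exact: (box_wrt lw1).
have w2_wrt s : 0 <= s -> measurable_wrt (filt s) (w2 s).
  by move=> s0; exact: (box_wrt lw2).
have w1b s w : 0 <= s -> `|w1 s w| <= v^-1.
  move=> s0; have /andP[h1 h2] := sb i (X s w) s0.
  rewrite ger0_norm ?invr_ge0 ?(ltW (lt_trans v0 h1))// lef_pV2 ?posrE//; last first.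
    exact: lt_trans h1.
  exact: ltW.
have w2b s w : 0 <= s -> `|w2 s w| <= A by move=> s0; rewrite normrN; exact: d2A.
(* Weight [1] serves to bound the quadratic variation of [B] itself. *)
pose one (_ : R) (_ : Omega) : R := 1.
have one_wrt s : 0 <= s -> measurable_wrt (filt s) (one s).
  by move=> s0; apply/(measurable_wrtP _ (fb_sigma hfb s)); exact: measurable_cst.
have z1 := ito_weighted_residuals hfb cB (ltW V0) (ltW b0) HV mH H_wrt Hl gap0 mI cI sup0
  a0 ab (lexx b) w1_wrt w1b.
have z2 := ito_square_residuals hfb cB (ltW V0) (ltW b0) HV mH H_wrt Hl gap0 mI cI sup0
  a0 ab (lexx b).
have z3 := brownian_quadratic_variation hfb a0 ab w2_wrt w2b.
have one_b s w : 0 <= s -> `|one s w| <= 1 by rewrite normr1.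
have z4 := brownian_quadratic_variation hfb a0 ab one_wrt one_b.
have g0 n k : 0 <= grid a b n k.
  by rewrite /grid addr_ge0// divr_ge0// mulr_ge0// subr_ge0 ltW.
have mres n k : measurable_fun setT (resid B H a b I n k).
  apply: measurable_funB; first by apply: measurable_funB; exact: mI.
  apply: measurable_funM; last by apply: measurable_funB; exact: mB.
  exact: (measurable_wrtW (@fm _) (H_wrt (g0 _ _))).
have mQ n k : measurable_fun setT (fun w => (B (grid a b n k.+1) w - B (grid a b n k) w) ^+ 2
    - (grid a b n k.+1 - grid a b n k)).
  apply: measurable_funB => //; apply: measurable_funX.
  by apply: measurable_funB; exact: mB.
have m1 n : measurable_fun setT (fun w => \sum_(k < n) w1 (grid a b n k) w * resid B H a b I n k w).
  apply: measurable_fun_finsum => k; apply: measurable_funM => //.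
  exact: (measurable_wrtW (@fm _) (w1_wrt _ (g0 _ _))).
have m2 n : measurable_fun setT (fun w => \sum_(k < n) resid B H a b I n k w ^+ 2).
  by apply: measurable_fun_finsum => k; exact: measurable_funX.
have m3 n : measurable_fun setT (fun w => \sum_(k < n) w2 (grid a b n k) w *
    ((B (grid a b n k.+1) w - B (grid a b n k) w) ^+ 2
    - (grid a b n k.+1 - grid a b n k))).
  apply: measurable_fun_finsum => k; apply: measurable_funM => //.
  exact: (measurable_wrtW (@fm _) (w2_wrt _ (g0 _ _))).
have m4 n : measurable_fun setT (fun w => \sum_(k < n) one (grid a b n k) w *
    ((B (grid a b n k.+1) w - B (grid a b n k) w) ^+ 2
    - (grid a b n k.+1 - grid a b n k))).
  apply: measurable_fun_finsum => k; apply: measurable_funM => //.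
  exact: (measurable_cst (1 : R)).
have nm (f : Omega -> R) :
    measurable_fun [set: Omega] f -> measurable_fun [set: Omega] (fun w => `|f w|).
  by move=> mf; apply: measurableT_comp.
(* The four nonnegative quantities are added, so that they are small along the same meshes. *)
have M12 n := measurable_funD (nm _ (m1 n)) (m2 n).
have M123 n := measurable_funD (M12 n) (nm _ (m3 n)).
have M1234 n := measurable_funD (M123 n) (nm _ (m4 n)).
have s12 := small_in_probaD (fun n => nm _ (m1 n)) m2 (small_in_proba_norm m1 z1) z2.
have s123 := small_in_probaD M12 (fun n => nm _ (m3 n)) s12 (small_in_proba_norm m3 z3).
have s1234 := small_in_probaD M123 (fun n => nm _ (m4 n)) s123 (small_in_proba_norm m4 z4).
have often := small_in_proba_often M1234 s1234.
have {}often : {ae P, forall w, forall (e : R) (N : nat), 0 < e -> exists2 n, (N <= n)%N &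
    `| `|\sum_(k < n) w1 (grid a b n k) w * resid B H a b I n k w|
    + \sum_(k < n) resid B H a b I n k w ^+ 2
    + `|\sum_(k < n) w2 (grid a b n k) w *
      ((B (grid a b n k.+1) w - B (grid a b n k) w) ^+ 2
      - (grid a b n k.+1 - grid a b n k))|
    + `|\sum_(k < n) one (grid a b n k) w *
      ((B (grid a b n k.+1) w - B (grid a b n k) w) ^+ 2
      - (grid a b n k.+1 - grid a b n k))| | < e}.
  exact: often.
apply: filterS2 eqX often => w Xeq often Ji.
have cpsi : continuous_path (fun s => sigma i s (X s w)) by exact: box_path.
have cbeta : continuous_path (fun s => mu i s (X s w)) by exact: box_path.
have incr u z : a <= u -> u <= z -> z <= b -> X z w - X u w
    = \int[leb]_(s in `[u, z]) mu i s (X s w) + (I z w - I u w).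
  move=> au uz zb; have u0 := le_trans a0 au.
  have iw : leb.-integrable `[0, z] (EFin \o (fun s => mu (J s w) s (X s w))).
    apply: (switched_path_integrable hJ (g := fun j s => mu j s (X s w))) => // j.
    exact: box_path.
  rewrite (Xeq z (le_trans u0 uz)) (Xeq u u0) (Rintegral_itv_split u0 uz iw).
  have -> : \int[leb]_(s in `[u, z]) mu (J s w) s (X s w)
      = \int[leb]_(s in `[u, z]) mu i s (X s w).
    apply: eq_Rintegral => s; rewrite inE/= in_itv/= => /andP[us sz].
    by rewrite Ji// (le_trans au us) (le_trans sz zb).
  by ring.
have ito := @ito_path_approx _ (X ^~ w) (B ^~ w) (I ^~ w)
  (fun s => sigma i s (X s w)) (fun s => mu i s (X s w))
  (fun s => - partial2 (sigma i) s (X s w)) v V a b v0 V0 a0 ab (@cXp w) cpsi cbeta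
  (@box_path _ w lw2) (fun s => sb i (X s w)) incr.
case: ito => [e N e0|Q Q0 approx].
  have [n nN hn] := often e N e0; exists n => //=.
  apply: le_lt_trans hn; apply: le_trans (ler_norm _).
  have gE k : grid a b n k.+1 - grid a b n k = (b - a) / n%:R.
    by rewrite gridS addrAC subrr add0r.
  have HE (k : 'I_n) : H (grid a b n k) w = sigma i (grid a b n k) (X (grid a b n k) w).
    by rewrite /H (Ji _ (grid_in (ltW ab) (ltnW (ltn_ord k)))).
  rewrite le_eqVlt; apply/orP; left; apply/eqP.
  congr (_ + _ + _ + _); [congr Num.norm| |congr Num.norm|congr Num.norm];
    apply: eq_bigr => k _.
  - by rewrite /resid HE.
  - by rewrite /resid HE.
  - by rewrite gE.
  - by rewrite gE /one mul1r.
apply: (@lamperti_path _ (sigma i) (mu i) x0 v V v0 (sb i) (sC i) (ls i) (ls1 i) (ls2 i)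
  (X ^~ w) (B ^~ w) (fun s => mu i s (X s w)) (fun s => sigma i s (X s w) ^+ 2) a b Q) => //.
  have := continuous_pathM cpsi cpsi.
  by congr continuous_path; apply/funext => s; rewrite expr2.
move=> u u0; have /andP[h1 _] := sb i (X u w) u0.
rewrite /lamperti_drift divfK; last by rewrite expf_neq0// lt0r_neq0// (lt_trans v0).
by ring.
Qed.

(** Countably many null sets are discarded, one for each regime and rational pair. Transform minus
    drift integral minus [B] is then constant between rationals, and continuity gives all
    endpoints. *)
Lemma lamperti_sde_ae : {ae P, forall w, forall i a b, 0 <= a -> a < b ->
  (forall s, a <= s <= b -> J s w = i) ->
  lamperti_equation (sigma i) (mu i) x0 (X ^~ w) (B ^~ w) a b}.
Proof.
have HQ : {ae P, forall w, forall c : E * rat * rat,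
    0 <= ratr c.1.2 :> R -> ratr c.1.2 < ratr c.2 :> R ->
    (forall s : R, ratr c.1.2 <= s <= ratr c.2 -> J s w = c.1.1) ->
    lamperti_equation (sigma c.1.1) (mu c.1.1) x0 (X ^~ w) (B ^~ w)
      (ratr c.1.2) (ratr c.2)}.
  apply: ae_forall_countable => -[[i p] q] /=.
  have [p0|p0] := boolP (0 <= ratr p :> R); last by apply: filterE.
  have [pq|pq] := boolP (ratr p < ratr q :> R); last by apply: filterE.
  by have := lamperti_sde_interval i p0 pq; apply: filterS => w h _ _; exact: h.
apply: filterS HQ => w HQ i a b a0 ab Ji.
have [[_ cB] _ _ _] := hB.
have cF : continuous_path (fun t => lamperti x0 (sigma i) t (X t w)).
  exact: box_path (box_lipschitz_lamperti x0 v0 (sb i) (ls i)).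
have cD : continuous_path (fun t => lamperti_drift (sigma i) (mu i) x0 t (X t w)).
  exact: box_path (box_lipschitz_drift x0 v0 (sb i) (ls i) (ls1 i) (ls2 i) (lmu i)).
pose I t := \int[leb]_(s in `[0, t]) lamperti_drift (sigma i) (mu i) x0 s (X s w).
have cI : continuous_path I by exact: primitive_continuous.
have E1 s t : 0 <= s -> s <= t ->
    lamperti_equation (sigma i) (mu i) x0 (X ^~ w) (B ^~ w) s t
    <-> lamperti x0 (sigma i) s (X s w) - I s - B s w
      = lamperti x0 (sigma i) t (X t w) - I t - B t w.
  move=> s0 st; rewrite /lamperti_equation (Rintegral_primitive s0 st cD) -/(I s) -/(I t).
  by move: (I s) (I t) => Is It; split; lra.
apply/E1 => //; first exact: ltW.
apply: (constant_on_rationals (phi := fun t =>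
  lamperti x0 (sigma i) t (X t w) - I t - B t w) _ a0 ab).
  by apply: continuous_pathB; [exact: continuous_pathB|exact: cB].
move=> p q ap pq qb; have p0 := le_trans a0 (ltW ap).
apply/E1 => //; first exact: ltW.
apply: (HQ (i, p, q)) => //= s /andP[ps sq].
by apply: Ji; rewrite (le_trans (ltW ap) ps) (le_trans sq (ltW qb)).
Qed.

(** No null set here: the equation holds on each path. Zero quadratic variation removes the
    second-order term, and the correction in the drift supplies exactly what that term contributes
    in the Ito case. *)
Lemma lamperti_LS (f x : R -> R) w :
  pathwise_solution
    (fun i t x => mu i t x - 2^-1 * (sigma i t x * partial2 (sigma i) t x))
    sigma x0 (J ^~ w) f x ->
  forall i a b, 0 <= a -> a < b -> (forall s, a <= s <= b -> J s w = i) ->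
  lamperti_equation (sigma i) (mu i) x0 x f a b.
Proof.
move=> [cx hx] i a b a0 ab Ji.
pose beta i t x := mu i t x - 2^-1 * (sigma i t x * partial2 (sigma i) t x).
have lbeta j : box_lipschitz (beta j).
  have := box_lipschitzD (lmu j) (box_lipschitzZ (- 2^-1) (box_lipschitzM (ls j) (ls2 j))).
  by congr box_lipschitz; apply/funext => t; apply/funext => y; rewrite mulNr.
have path g : box_lipschitz g -> continuous_path (fun s => g s (x s)).
  by move=> lg; exact: box_lipschitz_path lg cx.
have lr := box_lipschitz_q2 v0 (sb i) (ls i) (ls2 i).
have [Q Q0 approx] := @LS_path_approx _ x f (fun s => sigma (J s w) s (x s))
  (fun s => sigma i s (x s)) (fun s => beta (J s w) s (x s)) (fun s => beta i s (x s))
  (fun s => - partial2 (sigma i) s (x s) / sigma i s (x s) ^+ 2) x0 v a b v0 a0 ab cx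
  (path _ (ls i)) (path _ (lbeta i)) (path _ lr)
  (fun s s0 => proj1 (andP (sb i (x s) s0)))
  (switched_path_integrable hJ (g := fun j s => beta j s (x s)) w b (lexx 0)
    (fun j => path _ (lbeta j)))
  (fun s sab => congr1 (fun j => beta j s (x s)) (Ji s sab))
  (fun s sab => congr1 (fun j => sigma j s (x s)) (Ji s sab)) hx.
apply: (@lamperti_path _ (sigma i) (mu i) x0 v V v0 (sb i) (sC i) (ls i) (ls1 i) (ls2 i)
  x f (fun s => beta i s (x s)) (fun=> 0) a b Q) => //.
- exact: path.
- by move=> s; exact: cvg_cst.
move=> u u0; have /andP[h1 _] := sb i (x u) u0.
rewrite /lamperti_drift /beta; field.
by rewrite lt0r_neq0// (lt_trans v0).
Qed.

End lamperti_sde.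

(** * Jump counts *)

Section jumps.
Context {R : realType} {E : finType}.
Implicit Types (j : R -> E) (a b s t u p q T : R) (n : nat).

Definition is_jump j u : Prop := exists2 i, left_limit j u i & j u != i.

Lemma cadlag_right j t : cadlag j -> 0 <= t ->
  exists2 del, 0 < del & forall r, t <= r -> r < t + del -> j r = j t.
Proof.
move=> [rj _] t0; have := rj t t0; rewrite near_withinE => /nbhs_ballP[del /= del0 h].
exists del => // r; rewrite le_eqVlt => /predU1P[<-//|tr] rd.
by apply: h => //; rewrite /ball/= ltr0_norm ?subr_lt0//; lra.
Qed.

Lemma left_limit_near j t i : left_limit j t i ->
  exists2 del, 0 < del & forall r, t - del < r -> r < t -> j r = i.
Proof.
rewrite /left_limit near_withinE => /nbhs_ballP[del /= del0 h]; exists del => // r rd rt.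
by apply: h => //; rewrite /ball/= gtr0_norm ?subr_gt0//; lra.
Qed.

(** Without jumps the indicator of [j s = j a] is continuous on [[a, b]]; if [j b] differed, the
    intermediate value theorem would give it the value [2^-1]. *)
Lemma no_jump_constant j a b : cadlag j -> 0 <= a -> a <= b ->
  (forall u, a < u -> u <= b -> ~ is_jump j u) -> j b = j a.
Proof.
move=> cj a0 ab nj; apply/eqP; apply/negPn/negP => jab.
pose g s : R := (j s == j a)%:R.
have cg : {within `[a, b], continuous g}.
  apply/subspace_continuousP => s; rewrite /= in_itv/= => /andP[as_ sb].
  have s0 := le_trans a0 as_.
  have [d1 d10 h1] := cadlag_right cj s0.
  have [d2 d20 h2] : exists2 del, 0 < del & forall r, a <= r -> s - del < r -> r < s -> j r = j s.
    (* At [s = a] there is nothing to the left inside the interval; elsewhere the absence of a jump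
       equates left limit and value. *)
    move: as_; rewrite le_eqVlt => /predU1P[<-|as_].
      by exists 1 => // r ar _ /(le_lt_trans ar); rewrite ltxx.
    have [i li] := cj.2 s (le_lt_trans a0 as_).
    have [d2 d20 h2] := left_limit_near li; exists d2 => // r _ r1 r2.
    rewrite (h2 r r1 r2); apply/eqP/negPn/negP => ij.
    by apply: (nj s as_ sb); exists i => //; rewrite eq_sym.
  apply/cvgrPdist_lt => e e0; rewrite near_withinE; apply/nbhs_ballP.
  exists (Num.min d1 d2); first by rewrite /= lt_min d10.
  move=> r; rewrite /ball/= lt_min => /andP[].
  rewrite ltr_norml => /andP[r1 r2]; rewrite ltr_norml => /andP[r3 r4].
  rewrite /= in_itv/= => /andP[ar rb].
  suff grs : g r = g s by rewrite /from_subspace grs subrr normr0.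
  rewrite /g; congr ((_ == _)%:R); have [sr|rs] := leP s r.
    by apply: h1 => //; lra.
  by apply: h2 => //; lra.
have [|c _] := IVT (v := 2^-1) ab cg.
  rewrite /g eqxx (negbTE jab) minEle maxEle ler10/=.
  by apply/andP; split; lra.
by rewrite /g; case: (_ == _) => /=; lra.
Qed.

Lemma jump_between j a b : cadlag j -> 0 <= a -> a < b -> j a <> j b ->
  exists u, [/\ a < u, u <= b & is_jump j u].
Proof.
move=> cj a0 ab jab; apply: contrapT => nu; apply: jab; apply/esym.
apply: no_jump_constant => //; first exact: ltW.
by move=> u au ub ju; apply: nu; exists u.
Qed.

(** Jumps counted downwards from [t], with a time [p] below each of them. The separating times can
    be moved to rationals, which a bare list of jump times does not allow. *)
Fixpoint jump_chain j n t : Prop :=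
  if n is m.+1
  then exists u p, [/\ is_jump j u, 0 <= p, p < u, u <= t & jump_chain j m p]
  else True.

Lemma jump_chain_le j n s t : s <= t -> jump_chain j n s -> jump_chain j n t.
Proof.
case: n => //= n st [u [p [ju p0 pu us h]]].
by exists u, p; split => //; exact: le_trans st.
Qed.

(** A jump at [u] is detected by different values at times [p < u <= q]. After [u], right-continuity
    provides a rational [q], unless [u = t], where only [t] itself is available: this is the case
    [None]. *)
Lemma jump_chain_rational j n t : cadlag j -> 0 <= t ->
  jump_chain j n.+1 t <-> exists (p : rat) (q : option rat),
    let q' := oapp ratr t q in
    [/\ 0 <= ratr p :> R, ratr p < q', q' <= t, j (ratr p) <> j q' & jump_chain j n (ratr p)].
Proof.
move=> cj t0; split.
  move=> [u [p [[i li jui] p0 pu ut h]]].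
  have u0 : 0 < u := le_lt_trans p0 pu.
  have [d1 d10 h1] := left_limit_near li.
  have [d2 d20 h2] := cadlag_right cj (ltW u0).
  have [|p'] := @rat_in_itvoo R (Num.max p (u - d1)) u.
    by rewrite gt_max pu ltrBlDr ltrDl.
  rewrite in_itv/= gt_max => /andP[/andP[pp' dp'] p'u].
  have chain : jump_chain j n (ratr p') by apply: jump_chain_le h; exact: ltW.
  have p'0 : 0 <= ratr p' :> R by exact: le_trans (ltW pp').
  have jp : j (ratr p') = i by exact: h1.
  have [ut'|tu] := ltP u t.
    have [|q] := @rat_in_itvoo R u (Num.min t (u + d2)); first by rewrite lt_min ut' ltrDl.
    rewrite in_itv/= lt_min => /andP[uq /andP[qt qd]].
    exists p', (Some q) => /=; split => //.
    - exact: lt_trans uq.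
    - exact: ltW.
    - by rewrite jp (h2 _ (ltW uq) qd) => /esym/eqP; rewrite (negbTE jui).
  have ut2 : u = t by apply/eqP; rewrite eq_le ut.
  exists p', None => /=; split => //; rewrite -?ut2//.
  by rewrite jp => /esym/eqP; rewrite (negbTE jui).
move=> [p [q [p0 pq qt jpq h]]].
have [u [pu uq ju]] := jump_between cj p0 pq jpq.
by exists u, (ratr p); split => //; exact: le_trans qt.
Qed.

Lemma seq_max (l : seq R) u : u \in l -> exists2 m, m \in l & forall z, z \in l -> z <= m.
Proof.
elim: l u => // x l IHl u _; case: l IHl => [_|y l IHl].
  by exists x; [exact: mem_head|move=> z; rewrite inE => /eqP ->].
have [m ml hm] := IHl y (mem_head _ _).
have [xm|mx] := leP x m.
  exists m; first by rewrite inE ml orbT.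
  by move=> z; rewrite inE => /predU1P[->//|]; exact: hm.
exists x; first exact: mem_head.
by move=> z; rewrite inE => /predU1P[->//|/hm zm]; exact: le_trans (ltW mx).
Qed.

(** Removing the largest jump from the list is the inductive step; what remains lies below some [p]
    smaller than it. *)
Lemma jump_chain_seq j n t : jump_chain j n t <-> exists s : seq R,
  [/\ uniq s, size s = n & forall u, u \in s -> jump_times j t u].
Proof.
elim: n t => [|n IHn] t; first by split => // _; exists [::].
split.
  move=> [u [p [ju p0 pu ut /IHn[s [us ss sj]]]]].
  exists (u :: s); split => /=; [|by rewrite ss|].
    rewrite us andbT; apply/negP => /sj[/andP[_ up] _].
    by move: (lt_le_trans pu up); rewrite ltxx.
  move=> z; rewrite inE => /predU1P[->|/sj[/andP[z0 zp] jz]].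
    by split => //; rewrite (le_lt_trans p0 pu).
  by split => //; rewrite z0/= (le_trans zp) // (le_trans (ltW pu)).
move=> [s [us ss sj]].
have [x xs] : exists x, x \in s.
  by case: s ss {us sj} => // x s _; exists x; exact: mem_head.
have [u us' hu] := seq_max xs.
have [/andP[u0 ut] ju] := sj u us'.
have lt z : z \in rem u s -> z < u.
  by rewrite mem_rem_uniq// => /andP[/= zu zs]; rewrite lt_neqAle zu hu.
have [p [p0 pu hp]] : exists p, [/\ 0 <= p, p < u & forall z, z \in rem u s -> z <= p].
  case E0 : (rem u s) lt => [|y l] lt; first by exists 0; split.
  have [m ml hm] := seq_max (mem_head y l).
  exists m; split => //; last exact: lt.
  have : m \in s by apply: (mem_rem (x := u)); rewrite E0.
  by move=> /sj[/andP[/ltW]].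
exists u, p; split => //; apply/IHn; exists (rem u s); split.
- exact: rem_uniq.
- by rewrite size_rem// ss.
- move=> z zr; have /sj[/andP[z0 _] jz] := mem_rem zr.
  by split => //; rewrite z0 hp.
Qed.

Lemma jump_count_chain j n T : finite_set (jump_times j T) ->
  (n%:R%:E < counting (jump_times j T) :> \bar R)%E <-> jump_chain j n.+1 T.
Proof.
move=> fj; rewrite /counting asboolT// lte_fin ltr_nat.
have mem u : (u \in fset_set (jump_times j T)) = (u \in jump_times j T).
  by rewrite in_fset_set.
rewrite jump_chain_seq; split => [h|[s [us ss sj]]].
  exists (take n.+1 (fset_set (jump_times j T))); split.
  - exact/take_uniq/fset_uniq.
  - by rewrite size_take; move: h; rewrite leq_eqVlt => /predU1P[<-|->]//; rewrite ltnn.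
  - by move=> u /mem_take; rewrite -[_ \in _]/(u \in fset_set _) mem => /set_mem.
rewrite -ss; apply: uniq_leq_size => // u /sj ju.
by rewrite -[_ \in _]/(u \in fset_set _) mem; exact/mem_set.
Qed.

(** By [jump_chain_rational] the event is built from countably many comparisons of [J] at two fixed
    times. *)
Lemma measurable_jump_chain d (Omega : measurableType d) (J : R -> Omega -> E) n t :
  jump_process J -> 0 <= t -> measurable [set w | jump_chain (J ^~ w) n t].
Proof.
move=> [mJ cJ _]; elim: n t => [|n IHn] t t0.
  by rewrite (_ : mkset _ = setT)//; apply/seteqP.
have -> : [set w | jump_chain (J ^~ w) n.+1 t] = \bigcup_(c : rat * option rat)
   [set w | [/\ 0 <= ratr c.1 :> R, ratr c.1 < oapp ratr t c.2, oapp ratr t c.2 <= t,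
       J (ratr c.1) w <> J (oapp ratr t c.2) w & jump_chain (J ^~ w) n (ratr c.1)]].
  apply/seteqP; split => w.
    by move=> /(jump_chain_rational _ (cJ w) t0)[p [q h]]; exists (p, q).
  by move=> [[p q] _ h]; apply/(jump_chain_rational _ (cJ w) t0); exists p, q.
apply: countable_bigcupT_measurable; first exact: countableP.
move=> [p q]; rewrite /= -/(oapp ratr t q).
have [p0|p0] := boolP (0 <= ratr p :> R); last first.
  by rewrite (_ : mkset _ = set0)//; apply/seteqP; split => // w [].
have [pq|pq] := boolP (ratr p < oapp ratr t q); last first.
  by rewrite (_ : mkset _ = set0)//; apply/seteqP; split => // w [].
have [qt|qt] := boolP (oapp ratr t q <= t); last first.
  by rewrite (_ : mkset _ = set0)//; apply/seteqP; split => // w [].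
have q0 := le_trans p0 (ltW pq).
have -> : [set w | [/\ true, true, true, J (ratr p) w <> J (oapp ratr t q) w
      & jump_chain (J^~ w) n (ratr p)]]
  = [set w | jump_chain (J^~ w) n (ratr p)] `\` \bigcup_(i in [set: E])
     ((J (ratr p) @^-1` [set i]) `&` (J (oapp ratr t q) @^-1` [set i])).
  apply/seteqP; split => w.
    move=> [_ _ _ jpq h]; split => // -[i _ [/= jp jq]].
    by apply: jpq; rewrite jp jq.
  move=> [h jpq]; split => // jE; apply: jpq.
  by exists (J (ratr p) w) => //; split => //=; rewrite jE.
apply: measurableD; first exact: IHn.
apply: fin_bigcup_measurable; first exact: finite_finset.
by move=> i _; apply: measurableI; exact: mJ.
Qed.

Lemma measurable_jump_count d (Omega : measurableType d) (J : R -> Omega -> E) n T :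
  jump_process J -> 0 < T ->
  measurable [set w | (n%:R%:E < jump_count J T w :> \bar R)%E].
Proof.
move=> hJ T0; have [_ _ fJ] := hJ.
rewrite (_ : mkset _ = [set w | jump_chain (J ^~ w) n.+1 T]).
  by apply: measurable_jump_chain => //; exact: ltW.
by apply/seteqP; split => w /(jump_count_chain _ (fJ w T T0)).
Qed.

(** Each interval between jumps multiplies [Delta + Phi] by at most [K + 1], and [n] jumps cut out
    [n.+1] intervals. *)
Lemma jump_induction j (Delta : R -> R) (K Phi T : R) n :
  cadlag j -> 0 < T -> finite_set (jump_times j T) -> 0 <= K -> 0 <= Phi ->
  (forall s, 0 <= Delta s) -> Delta 0 = 0 ->
  (forall a b, 0 <= a -> a < b -> b <= T -> (forall s, a <= s -> s < b -> j s = j a) ->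
    Delta b <= K * (Delta a + Phi)) ->
  (counting (jump_times j T) <= n%:R%:E :> \bar R)%E ->
  forall t, 0 <= t <= T -> Delta t + Phi <= (K + 1) ^+ n.+1 * Phi.
Proof.
move=> cj T0 fj K0 Phi0 Dge0 D0 step; rewrite leNgt => /negP cnt.
have nchain : ~ jump_chain j n.+1 T by move=> /(jump_count_chain _ fj).
have K1 : 1 <= K + 1 by rewrite lerDr.
have expK m : Phi <= (K + 1) ^+ m * Phi by rewrite ler_peMl// exprn_ege1.
(* Jumps are counted strictly before [t]: one at [t] itself does not spoil the step ending there,
   which asks for constancy on [[a, b[] only. *)
suff H m t : 0 <= t <= T -> (forall p, 0 <= p -> p < t -> ~ jump_chain j m.+1 p) ->
    Delta t + Phi <= (K + 1) ^+ m.+1 * Phi.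
  move=> t /[dup] tT /andP[t0 tT']; apply: H => // p p0 pt h; apply: nchain.
  by apply: jump_chain_le h; exact: le_trans (ltW pt) tT'.
elim: m t => [|m IHm] t /andP[t0 tT] nc.
  move: t0; rewrite le_eqVlt => /predU1P[<-|t0]; first by rewrite D0 add0r.
  have := step 0 t (lexx 0) t0 tT _; rewrite D0 add0r => H.
  rewrite expr1 mulrDl mul1r lerD2r; apply: H => s s0 st.
  apply: no_jump_constant => // u u0 us ju; apply: (nc u (ltW u0) (le_lt_trans us st)).
  by exists u, 0.
move: t0; rewrite le_eqVlt => /predU1P[<-|t0]; first by rewrite D0 add0r.
have [noj|] := pselect (forall u, 0 < u -> u < t -> ~ is_jump j u).
  have := step 0 t (lexx 0) t0 tT _; rewrite D0 add0r => H.
  apply: (@le_trans _ _ ((K + 1) * Phi)).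
    rewrite mulrDl mul1r lerD2r; apply: H => s s0 st.
    apply: no_jump_constant => // u u0 us; apply: noj => //; exact: le_lt_trans st.
  by rewrite exprS -mulrA ler_pM2l ?expK// (lt_le_trans ltr01).
move=> /existsNP[x /not_implyP[x0 /not_implyP[xt /contrapT jx]]].
(* The last jump [u] before [t] is the maximum of this list: before [u] there is one jump less to
   count, and after it [j] is constant up to [t]. *)
pose l := [seq u <- fset_set (jump_times j T) | u < t].
have memt u : u \in l = (u < t) && (u \in jump_times j T).
  by rewrite mem_filter -[u \in enum_fset _]/(u \in fset_set _) in_fset_set.
have xl : x \in l.
  rewrite memt xt/=; apply/mem_set; split => //.
  by rewrite x0 (le_trans (ltW xt)).
have [u] := seq_max xl; rewrite memt => /andP[ut /set_mem[/andP[u0 uT] ju]] hu.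
have Du : Delta u + Phi <= (K + 1) ^+ m.+1 * Phi.
  apply: IHm; first by rewrite ltW.
  move=> p p0 pu h; apply: (nc u (ltW u0) ut).
  by exists u, p.
have Dt : Delta t <= K * (Delta u + Phi).
  apply: step => //; first exact: ltW.
  move=> s us st; apply: no_jump_constant => //; first exact: ltW.
  move=> z uz zs jz; have zt := le_lt_trans zs st.
  have /hu : z \in l.
    rewrite memt zt/=; apply/mem_set; split => //.
    by rewrite (lt_trans u0 uz) (le_trans (ltW zt)).
  by rewrite leNgt uz.
rewrite exprS -mulrA; apply: (@le_trans _ _ ((K + 1) * (Delta u + Phi))).
  have Ku : Delta t + Phi <= K * (Delta u + Phi) + Phi by rewrite lerD2r.
  apply: le_trans Ku _; rewrite mulrDl mul1r lerD2l lerDr.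
  exact: Dge0.
by rewrite ler_pM2l// (lt_le_trans ltr01).
Qed.

End jumps.

(** * Pathwise stability and rates *)

(** Finiteness of [E] turns one constant per regime into a common one; the sum of the constants
    dominates each of them. *)
Lemma common_bound (R : realType) (E : finType) (Q : E -> R -> Prop) :
  (forall i M M', M <= M' -> Q i M -> Q i M') ->
  (forall i, exists2 M, 0 < M & Q i M) -> exists2 M, 0 < M & forall i, Q i M.
Proof.
move=> mono h; pose C i := projT1 (cid2 (h i)).
have CP i : 0 < C i /\ Q i (C i) by rewrite /C; case: cid2.
exists (1 + \sum_i C i).
  by rewrite ltr_pwDl// sumr_ge0// => i _; case: (CP i) => /ltW.
move=> i; apply: mono (CP i).2; rewrite (bigD1 i)//= addrCA lerDl addr_ge0//.
by rewrite sumr_ge0// => k _; case: (CP k) => /ltW.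
Qed.

Lemma lipschitz_partial2 (R : realType) (g : R -> R -> R) (M t x : R) :
  derivable (g t) x 1 -> (forall y z, `|g t y - g t z| <= M * `|y - z|) ->
  `|partial2 g t x| <= M.
Proof.
move=> /cvgrPdist_lt dg lip; rewrite /partial2 derive1E.
apply/ler_addgt0Pr => e e0; have := dg e e0; rewrite near_withinE => near0.
have /nbhs_ballP[del /= del0 h] := near0.
pose r := del / 2; have r0 : 0 < r by rewrite divr_gt0.
have rd : ball 0 del r.
  by rewrite /ball/= sub0r normrN gtr0_norm// /r ltr_pdivrMr// ltr_pMr// ltr1n.
have {}h := h r rd (lt0r_neq0 r0).
have -> : 'D_1 (g t) x = ('D_1 (g t) x - r^-1 *: ((g t \o shift x) (r *: (1 : R)) - g t x))
    + r^-1 *: ((g t \o shift x) (r *: (1 : R)) - g t x) by rewrite subrK.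
apply: le_trans (ler_normD _ _) _; rewrite addrC; apply: lerD; last exact: ltW.
have -> : r^-1 *: ((g t \o shift x) (r *: (1 : R)) - g t x)
    = (g t (r + x) - g t x) / r by rewrite /GRing.scale/= mulr1 mulrC.
rewrite normrM (gtr0_norm (x := r^-1)) ?invr_gt0// ler_pdivrMr//.
by have := lip (r + x) x; rewrite addrK (gtr0_norm r0).
Qed.

Section rates.
Context {R : realType}.

(** The tail in [n] decays faster than any exponential, so even an [n] of order [ln l] makes it
    smaller than any power of [l]. *)
Lemma tail_rate (p : nat -> R) (gamma0 C q eps : R) :
  1 < C -> 0 < q -> 0 < eps ->
  p =o_\oo (fun n : nat => expR (- (n%:R * (ln n%:R - gamma0)))) ->
  exists N : R -> nat, (forall l, 1 <= l -> C ^+ N l <= l `^ eps) /\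
    (fun l => p (N l)) =o_at_infinity (fun l => l `^ (- q)).
Proof.
move=> C1 q0 eps0 /eqoP small.
have C0 : 0 < C := lt_trans ltr01 C1.
have lnC : 0 < ln C by rewrite ln_gt0.
pose N (l : R) := Num.trunc (eps * ln l / ln C).
have lge0 l : 1 <= l -> 0 <= eps * ln l / ln C.
  by move=> l1; rewrite divr_ge0 ?(ltW lnC)// mulr_ge0 ?ln_ge0// ltW.
exists N; split.
  move=> l l1; have l0 := lt_le_trans ltr01 l1.
  have /andP[h _] := truncn_itv (lge0 l l1); rewrite -/(N l) in h.
  rewrite /powR gt_eqF// -[X in X ^+ _](lnK C0) -expRM_natl ler_expR.
  by rewrite -ler_pdivlMr.
apply/eqoP => e e0; pose c := q * ln C / eps.
have c0 : 0 < c by rewrite divr_gt0// mulr_gt0.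
(* Once [ln N] exceeds [L], the exponent [N * (ln N - gamma0)] is at least [c * (N + 1) - ln e], as
   [N] is at least [1]; and truncation in the definition of [N] gives [q * ln l <= c * (N + 1)]. *)
pose L := gamma0 + 2 * c + `|ln e|.
have [n0 _ hn0] := small 1 ltr01.
pose n1 := maxn (maxn n0 1) (Num.bound (expR L)).
near=> l.
have l1 : 1 <= l by near: l; exact: nbhs_pinfty_ge.
have l0 := lt_le_trans ltr01 l1.
have nN : (n1 <= N l)%N.
  rewrite truncn_ge_nat ?lge0// ler_pdivlMr// [leRHS]mulrC -ler_pdivrMr//.
  by rewrite -ler_expR lnK ?posrE//; near: l; exact: nbhs_pinfty_ge.
have /andP[Nl lN] := truncn_itv (lge0 l l1); rewrite -/(N l) in Nl lN.
have N0 : (1 <= N l)%N by apply: leq_trans nN; rewrite !leq_max leqnn !orbT.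
have N1 : 1 <= (N l)%:R :> R by rewrite ler1n.
have lnN : L <= ln (N l)%:R.
  rewrite -ler_expR lnK ?posrE ?ltr0n//.
  apply: ltW; apply: lt_le_trans (archi_boundP (expR_ge0 L)) _.
  by rewrite ler_nat; apply: leq_trans nN; rewrite leq_max leqnn orbT.
have := hn0 (N l) (leq_trans (leq_trans (leq_maxl _ _) (leq_maxl _ _)) nN).
rewrite mul1r [X in _ <= X -> _]ger0_norm ?expR_ge0// => pN.
apply: le_trans pN _; rewrite ger0_norm ?powR_ge0// /powR gt_eqF//.
rewrite (_ : e * _ = expR (ln e + - q * ln l)); last by rewrite expRD lnK ?posrE.
rewrite ler_expR.
have h1 : q * ln l <= c * ((N l)%:R + 1).
  have -> : q * ln l = c * (eps * ln l / ln C).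
    by rewrite /c; field; rewrite !lt0r_neq0.
  by rewrite ler_pM2l//; move: lN; rewrite -natr1 => /ltW.
have h2 : (N l)%:R * (2 * c + `|ln e|) <= (N l)%:R * (ln (N l)%:R - gamma0).
  by rewrite ler_pM2l ?ltr0n//; move: lnN; rewrite /L; lra.
have h3 : `|ln e| <= (N l)%:R * `|ln e| by rewrite ler_peMl.
have h4 : c <= c * (N l)%:R by rewrite ler_peMr// ltW.
have := ler_norm (- ln e); rewrite normrN.
lra.
Unshelve. all: by end_near. Qed.

End rates.

Section pathwise_stability.
Context {R : realType} {d : measure_display} {Omega : measurableType d}.
Variables (P : probability Omega R) (E : finType) (B X : R -> Omega -> R)
  (J : R -> Omega -> E) (mu sigma : E -> R -> R -> R) (x0 v V A M : R)
  (F Xl : R -> R -> Omega -> R).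
Local Notation leb := (@lebesgue_measure R).
Local Notation filt := (augmented_filtration P B J).
Hypotheses (hB : brownian_motion P B) (hJ : jump_process J)
  (hBJ : independent_events P (sigma_process `[0, +oo[ B)
                              (sigma_state `[0, +oo[ J)).
Hypotheses (v0 : 0 < v) (vV : v < V)
  (sb : forall i t x, 0 <= t -> v < sigma i t x < V)
  (sC : forall i, C11 (sigma i)) (lmu : forall i, box_lipschitz (mu i))
  (ls : forall i, box_lipschitz (sigma i))
  (ls1 : forall i, box_lipschitz (partial1 (sigma i)))
  (ls2 : forall i, box_lipschitz (partial2 (sigma i)))
  (d2A : forall i t x, 0 <= t -> `|partial2 (sigma i) t x| <= A)
  (M0 : 0 < M)
  (muM : forall i t l l', 0 <= t ->
     `|mu_star x0 (mu i) (sigma i) t l - mu_star x0 (mu i) (sigma i) t l'| <= M * `|l - l'|).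
Hypothesis hX : sde_solution P filt mu sigma x0 B J X.
Hypothesis hXl : forall lambda : R, 0 < lambda -> forall w,
  pathwise_solution
    (fun i t x => mu i t x - 2^-1 * (sigma i t x * partial2 (sigma i) t x))
    sigma x0 (J ^~ w) (F lambda ^~ w) (Xl lambda ^~ w).

Lemma pathwise_solution_start l w : 0 < l -> Xl l 0 w = x0.
Proof.
move=> l0; have [_ /(_ 0 (lexx 0))[G [H [_ _ _]]]] := hXl l0 w.
rewrite set_itv1 Rintegral_set1 set_itvoc0 !Rintegral_set0 !subr0.
by move/eqP; rewrite subr_eq0 => /eqP.
Qed.

(** The definition of the Ito integral does not state [I 0 = 0]. The simple integrals vanish at [0]
    and approximate [I] there in probability, so the constant sequence [I 0] is small in
    probability. *)
Lemma sde_solution_start : {ae P, forall w, X 0 w = x0}.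
Proof.
have [_ _ [I [[mI cI] [S hS]] eqX]] := hX.
have [[mB cB] _ _ _] := hB.
have hfb := augmented_filtered_brownian hB hJ hBJ.
have [_ sup0] := hS 1 ltr01.
have sI : small_in_proba P (fun _ : nat => I 0).
  move=> e eta e0 eta0; have := cvg_proba0_near sup0 e0 eta0.
  apply: filterS => n; apply: le_trans; apply: le_proba.
  - by apply: measurable_large; exact: mI.
  - apply: sup_dist_measurable => //.
    + by move=> t t0; exact: simple_integral_measurable hfb _ _ t0.
    + by move=> w; exact: simple_integral_continuous.
  move=> w; rewrite /large/= => eI.
  apply: (@le_trans _ _ (`|simple_integral B (S n) 0 w - I 0 w|%:E)).
    by rewrite simple_integral0 sub0r normrN lee_fin.
  by apply: (le_sup_dist (simple_integral B (S n) ^~ w) (I ^~ w));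
    rewrite lexx ler01.
have := small_in_proba_often (fun _ => mI 0 (lexx 0)) sI.
apply: filterS2 eqX => w eqX often; rewrite (eqX 0 (lexx 0)) set_itv1 Rintegral_set1 addr0.
suff -> : I 0 w = 0 by rewrite addr0.
apply/eqP; rewrite -normr_le0; apply/ler_addgt0Pr => e e0; rewrite add0r.
by have [n _ /ltW] := often e 0%N e0.
Qed.

(** The number [K + 1], with [K] the constant of [lamperti_stability] for enough Gronwall steps of
    length [1 / (2 * M)] to cross [[0, T]]. *)
Definition stability_rate (T : R) : R :=
  V * 2 ^+ Num.bound (T * (2 * M)) * (v^-1 + 4) + 1.

Lemma stability_rate_gt1 T : 1 < stability_rate T.
Proof.
rewrite ltrDr mulr_gt0// ?mulr_gt0 ?exprn_gt0//; first exact: lt_trans vV.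
by rewrite addr_gt0 ?invr_gt0.
Qed.

(** One null set for all [l], [T] and [n]: the only almost sure inputs are the initial value and the
    transformed equation of [X]. *)
Lemma pathwise_stability : {ae P, forall w, forall (l T : R) (n : nat), 0 < l -> 0 < T ->
  (jump_count J T w <= n%:R%:E)%E ->
  (sup_dist T (Xl l ^~ w) (X ^~ w)
    <= (stability_rate T ^+ n.+1)%:E * sup_dist T (F l ^~ w) (B ^~ w))%E}.
Proof.
have [_ cX] : continuous_process X by case: hX.
have [mJ cJ fJ] := hJ.
have := lamperti_sde_ae hB hJ hBJ v0 sb sC lmu ls ls1 ls2 d2A hX.
apply: filterS2 sde_solution_start => w X0 eqX l T n l0 T0 cnt.
have C1 := stability_rate_gt1 T; pose C := stability_rate T.
have Cn0 : 0 < C ^+ n.+1 by rewrite exprn_gt0// (lt_trans ltr01).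
have cXl : continuous_path (Xl l ^~ w) by have [] := hXl l0 w.
(* With an infinite supremum the claim is trivial, as the factor is positive; [-oo] cannot occur. *)
case supF : (sup_dist T (F l ^~ w) (B ^~ w)) => [Phi| |]; last first.
- have : (0%:E <= sup_dist T (F l ^~ w) (B ^~ w))%E.
    apply: (@le_trans _ _ (`|F l 0 w - B 0 w|%:E)); first by rewrite lee_fin.
    by apply: (le_sup_dist (F l ^~ w) (B ^~ w)); rewrite lexx ltW.
  by rewrite supF.
- by rewrite gt0_muley ?lte_fin// leey.
have FB t : 0 <= t <= T -> `|F l t w - B t w| <= Phi.
  move=> tT; rewrite -lee_fin -supF.
  exact: (le_sup_dist (F l ^~ w) (B ^~ w)).
have Phi0 : 0 <= Phi by apply: le_trans (FB 0 _); rewrite // lexx ltW.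
have Tb : T <= (Num.bound (T * (2 * M)))%:R / (2 * M).
  rewrite ler_pdivlMr ?mulr_gt0//; apply/ltW/archi_boundP.
  by rewrite !mulr_ge0 ?ltW.
have K0 : 0 <= C - 1 by rewrite subr_ge0 ltW.
have key := @jump_induction _ _ (J ^~ w) (fun t => `|Xl l t w - X t w|) (C - 1) Phi T n
  (cJ w) T0 (fJ w T T0) K0 Phi0 (fun=> normr_ge0 _).
apply: ub_ereal_sup => _ [t tT <-]; rewrite /= in_itv/= in tT.
rewrite -EFinM lee_fin; have {}key := key _ _ cnt t tT.
rewrite subrK in key; apply: le_trans (key _ _); first by rewrite lerDl.
  by rewrite pathwise_solution_start// X0 subrr normr0.
move=> a b a0 ab bT Ja.
(* [J a w] is the regime on [[a, b[]; it need not be the one at [b]. *)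
have Jab s t' : a <= s -> t' < b -> forall r, s <= r <= t' -> J r w = J a w.
  by move=> as_ tb r /andP[sr rt]; apply: Ja; [exact: le_trans sr|exact: le_lt_trans tb].
rewrite /C /stability_rate addrK.
apply: (@lamperti_stability _ (sigma (J a w)) (mu (J a w)) x0 v V M v0 (sb _) (ls _)
  (ls1 _) (ls2 _) (lmu _) M0 _ (Xl l ^~ w) (X ^~ w) (F l ^~ w) (B ^~ w) a b T) => //.
- move=> s x y s0; rewrite -!(mu_star_lamperti _ _ v0 (sb _) (sC _) (ls _) (ls1 _))//.
  exact: muM.
- move=> s t' as_ st tb; apply: (lamperti_LS hJ v0 sb sC lmu ls ls1 ls2 (hXl l0 w)) => //.
    exact: le_trans as_.
  exact: Jab.
- move=> s t' as_ st tb; apply: eqX => //; first exact: le_trans as_.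
  exact: Jab.
- by rewrite ltW// lexx.
Qed.

End pathwise_stability.

Lemma sup_dist_ge0 (R : realType) (T : R) (f g : R -> R) : 0 <= T -> (0 <= sup_dist T f g)%E.
Proof.
move=> T0; apply: (@le_trans _ _ (`|f 0 - g 0|%:E)); first by rewrite lee_fin.
by apply: (le_sup_dist f g); rewrite lexx.
Qed.

Theorem theorem1p1 (R : realType) (d : measure_display)
  (Omega : measurableType d) (P : probability Omega R)
  (E : finType) (B : R -> Omega -> R) (J : R -> Omega -> E)
  (mu sigma : E -> R -> R -> R) (x0 : R)
  (F Xl : R -> R -> Omega -> R) (X : R -> Omega -> R) (delta : R -> R)
  (hB : brownian_motion P B)
  (hJ : jump_process J)
  (hBJ : independent_events P (sigma_process `[0, +oo[ B)
                              (sigma_state `[0, +oo[ J))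
  (hmu : forall i : E, [/\ continuous_on_half_plane (mu i),
                       linearly_growing (mu i) & locally_lipschitz (mu i)])
  (hsigma : forall i : E, [/\ C11 (sigma i), linearly_growing (sigma i),
                          locally_lipschitz (sigma i) &
                          lipschitz_in_space (sigma i)])
  (hdsigma : forall i : E, locally_lipschitz (partial1 (sigma i)) /\
                       locally_lipschitz (partial2 (sigma i)))
  (hbounds : exists v V K : R, [/\ 0 < v, v < V, 0 < K &
     forall (i : E) (t x : R), 0 <= t ->
       v < sigma i t x < V /\
       `|partial1 (sigma i) t x| / sigma i t x ^+ 2 <= K])
  (hmustar : forall i : E, lipschitz_in_space (mu_star x0 (mu i) (sigma i)))
  (hN : forall T : R, 0 < T -> exists2 gamma0 : R, 0 < gamma0 &
     (fun n : nat => fine (P [set w | (n%:R%:E < jump_count J T w)%E]))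
       =o_\oo (fun n : nat => expR (- (n%:R * (ln n%:R - gamma0)))))
  (hF : forall lambda : R, 0 < lambda ->
     continuous_process (F lambda) /\
     forall w, finite_variation (F lambda ^~ w))
  (hFB : converges_strongly P F B)
  (hdelta0 : forall lambda : R, 0 <= lambda -> 0 <= delta lambda)
  (hdelta : delta lambda @[lambda --> +oo] --> 0)
  (hrate : forall q T : R, 0 < q -> 0 < T -> exists2 alpha : R, 0 < alpha &
     (fun lambda : R => fine (P [set w |
        ((alpha * delta lambda)%:E
           <= sup_dist T (F lambda ^~ w) (B ^~ w))%E]))
       =o_at_infinity (fun lambda : R => lambda `^ (- q)))
  (hXlm : forall lambda : R, 0 < lambda -> continuous_process (Xl lambda))
  (hXl : forall lambda : R, 0 < lambda -> forall w,
     pathwise_solution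
       (fun i t x => mu i t x - 2^-1 * (sigma i t x * partial2 (sigma i) t x))
       sigma x0 (J ^~ w) (F lambda ^~ w) (Xl lambda ^~ w))
  (hX : sde_solution P (augmented_filtration P B J) mu sigma x0 B J X) :
  converges_strongly P Xl X /\
  forall q T : R, 0 < q -> 0 < T -> exists2 gamma : R, 0 < gamma &
    forall eps : R, 0 < eps ->
      (fun lambda : R => fine (P [set w |
         ((gamma * delta lambda * lambda `^ eps)%:E
            <= sup_dist T (Xl lambda ^~ w) (X ^~ w))%E]))
        =o_at_infinity (fun lambda : R => lambda `^ (- q)).
Proof.
have [v [V [K [v0 vV K0 hb]]]] := hbounds.
have sb i t x : 0 <= t -> v < sigma i t x < V by move=> t0; case: (hb i t x t0).
have sC i : C11 (sigma i) by case: (hsigma i).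
have lmu i : box_lipschitz (mu i).
  by case: (hmu i) => _ _; exact: locally_lipschitz_box.
have ls i : box_lipschitz (sigma i).
  by case: (hsigma i) => _ _ + _; exact: locally_lipschitz_box.
have ls1 i : box_lipschitz (partial1 (sigma i)).
  by apply: locally_lipschitz_box; case: (hdsigma i).
have ls2 i : box_lipschitz (partial2 (sigma i)).
  by apply: locally_lipschitz_box; case: (hdsigma i).
have [A A0 d2A] : exists2 A, 0 < A & forall i t x, 0 <= t ->
    `|partial2 (sigma i) t x| <= A.
  apply: (common_bound (Q := fun i A => forall t x, 0 <= t ->
      `|partial2 (sigma i) t x| <= A)).
    by move=> i A A' AA' h t x t0; exact: le_trans (h t x t0) AA'.
  move=> i; have [[_ _ ds _ _] _ _ [A A0 lip]] := hsigma i.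
  exists A => // t x t0; apply: lipschitz_partial2; first exact: ds.
  by move=> y z; exact: lip.
have [M M0 muM] : exists2 M, 0 < M & forall i t l l', 0 <= t ->
    `|mu_star x0 (mu i) (sigma i) t l - mu_star x0 (mu i) (sigma i) t l'| <= M * `|l - l'|.
  apply: (common_bound (Q := fun i M => forall t l l', 0 <= t ->
    `|mu_star x0 (mu i) (sigma i) t l - mu_star x0 (mu i) (sigma i) t l'| <= M * `|l - l'|)).
    by move=> i M M' MM' h t l l' t0; apply: le_trans (h t l l' t0) _; exact: ler_wpM2r.
  exact: hmustar.
have stable := pathwise_stability hB hJ hBJ v0 vV sb sC lmu ls ls1 ls2 d2A M0 muM hX hXl.
have [mJ cJ fJ] := hJ.
have [[mX cX] _ _] := hX.
have [[mB cB] _ _ _] := hB.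
split.
  move=> T T0; apply: filterS2 stable (hFB T T0) => w stable FB.
  (* On each path the number of jumps is finite, so the constant [C] below does not depend on
     [l]. *)
  have [n cnt] : exists n : nat, (jump_count J T w <= n%:R%:E)%E.
    rewrite /jump_count /counting asboolT; last exact: fJ.
    by exists (#|` fset_set (jump_times (J ^~ w) T)|).
  pose C := stability_rate v V M T ^+ n.+1.
  have CFB : (C%:E * sup_dist T (F l ^~ w) (B ^~ w))%E @[l --> +oo] --> 0%E.
    by rewrite -(mule0 C%:E); apply: cvgeZl.
  apply: squeeze_cvge (cvg_cst _) CFB; near=> l.
  have l0 : 0 < l by near: l; exact: nbhs_pinfty_gt.
  by rewrite sup_dist_ge0 ?(ltW T0)//; exact: stable.
move=> q T q0 T0; have [alpha alpha0 rate] := hrate q T q0 T0.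
have [gamma0 _ tail] := hN T T0.
pose C := stability_rate v V M T.
have C1 : 1 < C by exact: stability_rate_gt1.
have C0 : 0 < C := lt_trans ltr01 C1.
(* The stability constant has exponent [N + 1] for at most [N] jumps: the extra factor [C] goes into
   [gamma], and [C ^+ N] is absorbed by the power of [lambda]. *)
exists (alpha * C); first exact: mulr_gt0.
move=> eps eps0; have [N [CN tailN]] := tail_rate C1 q0 eps0 tail.
have [Nul [mNul Nul0 hNul]] := stable.
apply/eqoP => e e0; have e20 : 0 < e / 2 by rewrite divr_gt0.
move/eqoP: rate => /(_ _ e20) rate; move/eqoP: tailN => /(_ _ e20) tailN.
near=> l.
have l1 : 1 <= l by near: l; exact: nbhs_pinfty_ge.
have l0 := lt_le_trans ltr01 l1.
have r1 : `|fine (P [set w | ((alpha * delta l)%:E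
    <= sup_dist T (F l ^~ w) (B ^~ w))%E])| <= e / 2 * `|l `^ (- q)|.
  by near: l; exact: rate.
have r2 : `|fine (P [set w | ((N l)%:R%:E < jump_count J T w)%E])|
    <= e / 2 * `|l `^ (- q)|.
  by near: l; exact: tailN.
have [[mF cF] _] := hF l l0.
have [mXl cXl] := hXlm l l0.
pose A1 := [set w | ((alpha * delta l)%:E <= sup_dist T (F l ^~ w) (B ^~ w))%E].
pose A2 := [set w | ((N l)%:R%:E < jump_count J T w)%E].
pose A3 := [set w | ((alpha * C * delta l * l `^ eps)%:E
  <= sup_dist T (Xl l ^~ w) (X ^~ w))%E].
(* Measurability of the three events is what allows monotonicity and subadditivity of [P]. *)
have mA1 : measurable A1 by apply: sup_dist_measurable => //; exact: ltW.
have mA2 : measurable A2 by exact: measurable_jump_count.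
have mA3 : measurable A3 by apply: sup_dist_measurable => //; exact: ltW.
(* Off the null set, a noise error below [alpha * delta l] and at most [N l] jumps keep the error of
   [Xl] strictly below the threshold. *)
have sub : A3 `<=` (A1 `|` A2) `|` Nul.
  move=> w A3w; have [nulw|nnul] := pselect (Nul w); [by right|left].
  apply: contrapT => /not_orP[/negP nA1 /negP nA2].
  rewrite -ltNge in nA1; rewrite -leNgt in nA2.
  have good := contra_notP (hNul w) nnul.
  have := le_trans A3w (good l T (N l) l0 T0 nA2).
  have FB0 := sup_dist_ge0 (F l ^~ w) (B ^~ w) (ltW T0).
  case supF : (sup_dist T (F l ^~ w) (B ^~ w)) nA1 FB0 => [Phi| |]//.
  rewrite lte_fin !lee_fin => Phia Phi0.
  rewrite leNgt => /negP; apply.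
  have leps : 0 < l `^ eps by exact: powR_gt0.
  apply: (@le_lt_trans _ _ (C * l `^ eps * Phi)).
    by rewrite exprS ler_wpM2r// ler_pM2l//; exact: CN.
  have -> : alpha * C * delta l * l `^ eps = C * l `^ eps * (alpha * delta l) by ring.
  by rewrite ltr_pM2l// mulr_gt0.
have PA : (P A3 <= P A1 + P A2)%E.
  have U12 : (P (A1 `|` A2) <= P A1 + P A2)%E by apply: le_probaU => //; exact: measurableU.
  apply: le_trans (le_probaU P mA3 (measurableU _ _ mA1 mA2) mNul sub) _.
  by rewrite [X in (_ + X)%E](_ : _ = 0%E)// adde0.
have fin S : measurable S -> P S \is a fin_num by move=> mS; exact: fin_num_measure.
have fPA : fine (P A3) <= fine (P A1) + fine (P A2).
  by rewrite -fineD ?fin// fine_le ?fin// fin_numD !fin.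
rewrite ger0_norm; last by rewrite fine_ge0.
apply: le_trans fPA (le_trans (lerD (le_trans (ler_norm _) r1)
  (le_trans (ler_norm _) r2)) _).
by rewrite -mulrDl -splitr.
Unshelve. all: by end_near. Qed.
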